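(* Assume that the pushforward $\bar\mu=\mu\circ v^{-1}$ is irreducible and contracting, let $s\in I_\mu$, and let $m\ge1$ be the number of eigenvalues of modulus $1$ of $Q_s$ on $C^\alpha(\mathrm{P}(\mathbb{C}^d),\mathbb{C})$. There exist $C>0$ and $0<\lambda<1$ such that for every $n\in\mathbb{N}^*$ and all $f,g\in\mathrm{Lip}_b(\Omega,\mathbb{R})$, $$\left|\frac1m\sum_{j=0}^{m-1}\mathbb{E}_{\mathbb{Q}^s}\bigl[f\cdot (g\circ\theta^{nm+j})\bigr]-\mathbb{E}_{\mathbb{Q}^s}[f]\,\mathbb{E}_{\mathbb{Q}^s}[g]\right|\le C\,\|f\|_1\|g\|_1\,\lambda^n.$$
   Context: Setting. $d\ge1$; $\|\cdot\|$ is the Euclidean norm on $\mathbb{C}^d$ and the induced operator norm on $M_d(\mathbb{C})$. $\mathcal{A}$ is a Polish space with metric $d_{\mathcal{A}}$, $\mu$ a Borel measure on $\mathcal{A}$, $v:\mathcal{A}\to M_d(\mathbb{C})$, $a\mapsto v_a$, a measurable map, $\bar\mu=\mu\circ v^{-1}$. $I_\mu=(s_-,s_+)$ where $0<s_-<s_+\le+\infty$ and $\int_{\mathcal{A}}\|v_a\|^s d\mu(a)<\infty$ for every finite $s\in[s_-,s_+]$; $\alpha=\min\{s_-/3,1\}$. $\Omega=\mathcal{A}^{\mathbb{N}}$ with product $\sigma$-algebra, left shift $\theta(a_1,a_2,\dots)=(a_2,a_3,\dots)$, and metric $d_\Omega(a,b)=\sum_{k\ge1}2^{-k}\min\{d_{\mathcal{A}}(a_k,b_k),1\}$.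 $\mathrm{Lip}_b(\Omega,\mathbb{R})$ is the set of bounded real-valued $d_\Omega$-Lipschitz functions, with norm $\|f\|_1=\|f\|_\infty+$ (Lipschitz constant of $f$). A measure $\bar\mu$ on $M_d(\mathbb{C})$ is irreducible if no linear subspace $F$ with $\{0\}\ne F\ne\mathbb{C}^d$ satisfies $wF\subset F$ for all $w\in\operatorname{supp}\bar\mu$. It is contracting if, with $T$ the set of all finite products of elements of $\operatorname{supp}\bar\mu$ together with the identity, there is a sequence of nonzero $w_k\in T$ such that $w_k/\|w_k\|$ converges to a rank-one matrix. $\mathrm{P}(\mathbb{C}^d)$ is the projective space; for $\hat x\in\mathrm{P}(\mathbb{C}^d)$, $x$ denotes a unit representative; $w\cdot\hat x$ is the class of $wx$ when $wx\ne0$, and any expression $f(w\cdot\hat x)\|wx\|^s$ is $0$ when $wx=0$. Metric: $d(\hat x,\hat y)=\sqrt{1-|\langle x,y\rangle|^2}$. $C^\alpha(\mathrm{P}(\mathbb{C}^d),\mathbb{C})$ is the Banach space of $\alpha$-Hölder functions with norm $\|f\|_\infty+m_\alpha(f)$, $m_\alpha(f)=\sup_{\hat x\ne\hat y}|f(\hat x)-f(\hat y)|/d(\hat x,\hat y)^\alpha$. Let $k(s)=\lim_n\left(\int_{\mathcal{A}^n}\|v_{a_n}\cdots v_{a_1}\|^s d\mu^{\otimes n}\right)^{1/n}$, which is positive, and $\Gamma_sf(\hat x)=\int_{\mathcal{A}}f(v_a\cdot\hat x)\|v_ax\|^sd\mu(a)$. There are a unique continuous $e_s:\mathrm{P}(\mathbb{C}^d)\to\mathbb{R}_+$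 and a unique probability measure $\sigma$ on $\mathrm{P}(\mathbb{C}^d)$ with $\Gamma_se_s=k(s)e_s$, $\int\Gamma_s\varphi\,d\sigma=k(s)\int\varphi\,d\sigma$ for all continuous $\varphi$, and $\int e_sd\sigma=1$; $e_s$ is strictly positive. Put $q^s_n(\hat x,A)=\frac{1}{k(s)^n}\frac{e_s(A\cdot\hat x)}{e_s(\hat x)}\|Ax\|^s$. For each $\hat x$, $\mathbb{Q}^s_{\hat x}$ is the probability measure on $\Omega$ whose marginal on the first $n$ coordinates is $q_n^s(\hat x,v_{a_n}\cdots v_{a_1})\,d\mu^{\otimes n}(a_1,\dots,a_n)$ for every $n\ge1$. The Markov operator $Q_sf(\hat x)=\int_{\mathcal{A}}f(v_a\cdot\hat x)q_1^s(\hat x,v_a)d\mu(a)$ has a unique invariant probability measure $\eta^s$, and $\mathbb{Q}^s=\int\mathbb{Q}^s_{\hat x}\,d\eta^s(\hat x)$. The operator $Q_s$ is quasi-compact on $C^\alpha(\mathrm{P}(\mathbb{C}^d),\mathbb{C})$ with spectral radius $1$, and its eigenvalues of modulus $1$ are simple and are exactly the $m$-th roots of unity $e^{2\pi i\ell/m}$, $0\le\ell\le m-1$, for some $m\ge1$. *)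

(* Defs.v *)
From HB Require Import structures.
From mathcomp Require Import all_boot all_order all_algebra.
From mathcomp Require Import sesquilinear spectral.
From mathcomp Require Import all_classical all_reals all_analysis.
From mathcomp Require Import complex ring lra.

Set Implicit Arguments.
Unset Strict Implicit.
Unset Printing Implicit Defensive.

Import Order.TTheory GRing.Theory Num.Theory.
Import numFieldNormedType.Exports.

Local Open Scope classical_set_scope.
Local Open Scope ring_scope.
Local Open Scope complex_scope.

HB.mixin Record isSeparable T & Topological T := {
  separable : exists2 D : set T, countable D & dense D }.

#[short(type="polishType")]
HB.structure Definition Polish (R : numDomainType) :=
  {T of Complete T & Metric R T & isSeparable T}.

Definition borel (T : ptopologicalType) := g_sigma_algebraType (@open T).
HB.instance Definition _ (T : ptopologicalType) := Measurable.on (borel T).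

HB.instance Definition _ (R : realType) :=
  PseudoPointedMetric.copy R[i] (R[i]^o).

Section Euclidean.
Variables (R : realType) (d : nat).
Implicit Types (x y z : 'cV[R[i]]_d) (c : R[i]).

Definition cdot x y : R[i] := dotmx x^T y^T.

Definition enorm x : R := Num.sqrt (\sum_i Normc.normc (x i 0) ^+ 2).

Lemma normcE c : (Normc.normc c)%:C = `|c|.
Proof. by []. Qed.

Lemma normc_ge0 c : 0 <= Normc.normc c.
Proof. by rewrite -ler0c normcE normr_ge0. Qed.

Lemma cdotE x y : cdot x y = \sum_i x i 0 * conjc (y i 0).
Proof. by rewrite /cdot dotmxE mxE; apply: eq_bigr => i _; rewrite !mxE. Qed.

Lemma enorm_sqr x : ((enorm x) ^+ 2)%:C = cdot x x.
Proof.
rewrite sqr_sqrtr ?sumr_ge0// => [|i _]; last exact: sqr_ge0.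
rewrite cdotE rmorph_sum; apply: eq_bigr => i _ /=.
by rewrite rmorphXn /= normcE normCK.
Qed.

Lemma enorm_ge0 x : 0 <= enorm x. Proof. exact: sqrtr_ge0. Qed.

Lemma enormE x : (enorm x)%:C = sqrtC (cdot x x).
Proof. by rewrite -enorm_sqr rmorphXn /= sqrCK// ler0c enorm_ge0. Qed.

Lemma enorm_eq0 x : (enorm x == 0) = (x == 0).
Proof.
rewrite -(inj_eq (@complexI R)) enormE sqrtC_eq0 /cdot.
by rewrite (dnorm_eq0 (@dotmx _ d)) trmx_eq0.
Qed.

Lemma ler_enormD x y : enorm (x + y) <= enorm x + enorm y.
Proof.
rewrite -lecR rmorphD /= !enormE /cdot linearD /=.
by case: (triangle_lerif (@dotmx _ d) x^T y^T).
Qed.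

Lemma enormZ c x : enorm (c *: x) = Normc.normc c * enorm x.
Proof.
rewrite /enorm -[in RHS](ger0_norm (normc_ge0 c)) -sqrtr_sqr -sqrtrM ?sqr_ge0//.
congr Num.sqrt; rewrite mulr_sumr; apply: eq_bigr => i _.
by rewrite mxE Normc.normcM exprMn.
Qed.

Lemma cdotC x y : cdot y x = conjc (cdot x y).
Proof.
rewrite !cdotE rmorph_sum; apply: eq_bigr => i _ /=.
by rewrite rmorphM /= conjcK mulrC.
Qed.

Lemma cdot_subZ x y c : cdot x x = 1 -> cdot y y = 1 ->
  cdot (x - c *: y) (x - c *: y) =
  1 - `|cdot x y| ^+ 2 + `|c - cdot x y| ^+ 2.
Proof.
move=> x1 y1; have yx := cdotC x y.
have -> : cdot (x - c *: y) (x - c *: y) = cdot x x - conjc c * cdot x y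
    - c * cdot y x + c * conjc c * cdot y y.
  rewrite !cdotE !mulr_sumr -!sumrB -big_split /=; apply: eq_bigr => i _.
  rewrite !mxE rmorphB rmorphM /=; ring.
rewrite x1 y1 yx !normCK -!/(conjc _) rmorphB /=; ring.
Qed.

End Euclidean.

Record projective (R : realType) (n : nat) := Projective {
  line : {vspace 'cV[R[i]]_n};
  dim_line : \dim line == 1%N }.

HB.instance Definition _ (R : realType) n :=
  [isSub for @line R n].
HB.instance Definition _ (R : realType) n :=
  [Choice of projective R n by <:].

Section Projective.
Variables (R : realType) (d : nat).
Implicit Types (X Y Z : projective R d) (x : 'cV[R[i]]_d).

Definition rep X : 'cV[R[i]]_d :=
  ((enorm (vpick (line X)))^-1)%:C *: vpick (line X).

Lemma enorm_rep X : enorm (rep X) = 1.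
Proof.
have X0 : vpick (line X) != 0.
  by rewrite vpick0 -dimv_eq0 (eqP (dim_line X)).
rewrite enormZ /= expr0n addr0 sqrtr_sqr ger0_norm ?invr_ge0 ?enorm_ge0//.
by rewrite mulVf// enorm_eq0.
Qed.

Lemma rep_neq0 X : rep X != 0.
Proof. by rewrite -enorm_eq0 enorm_rep oner_eq0. Qed.

Lemma line_rep X : line X = <[rep X]>%VS.
Proof.
apply/esym/eqP; rewrite eqEdim (eqP (dim_line X)) dim_vline rep_neq0 andbT.
by rewrite -memvE memvZ// memv_pick.
Qed.

Definition proj_dist X Y : R :=
  Num.sqrt (1 - Normc.normc (cdot (rep X) (rep Y)) ^+ 2).

Lemma cdot_rep X : cdot (rep X) (rep X) = 1.
Proof. by rewrite -enorm_sqr enorm_rep expr1n. Qed.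

Lemma normc_rep X Y c :
  enorm (rep X - c *: rep Y) ^+ 2 =
  1 - Normc.normc (cdot (rep X) (rep Y)) ^+ 2 +
  Normc.normc (c - cdot (rep X) (rep Y)) ^+ 2.
Proof.
apply: (@complexI R); rewrite enorm_sqr cdot_subZ ?cdot_rep//.
by rewrite rmorphD rmorphB rmorph1 !rmorphXn.
Qed.

Lemma proj_distE X Y :
  proj_dist X Y = enorm (rep X - cdot (rep X) (rep Y) *: rep Y).
Proof.
rewrite -[RHS]ger0_norm ?enorm_ge0// -sqrtr_sqr normc_rep subrr.
by rewrite Normc.normc0 expr0n addr0.
Qed.

Lemma proj_dist_le X Y c : proj_dist X Y <= enorm (rep X - c *: rep Y).
Proof.
rewrite -[leRHS]ger0_norm ?enorm_ge0// -sqrtr_sqr normc_rep.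
by rewrite ler_wsqrtr// lerDl sqr_ge0.
Qed.

Lemma normc_cdot_rep X Y : Normc.normc (cdot (rep X) (rep Y)) <= 1.
Proof.
rewrite -(@expr_le1 _ 2) ?normc_ge0// -subr_ge0.
have := sqr_ge0 (enorm (rep X - cdot (rep X) (rep Y) *: rep Y)).
by rewrite normc_rep subrr Normc.normc0 expr0n addr0.
Qed.

Lemma proj_distxx X : proj_dist X X = 0.
Proof. by rewrite /proj_dist cdot_rep Normc.normc1 expr1n subrr sqrtr0. Qed.

Lemma proj_dist_sep X Y : proj_dist X Y = 0 -> X = Y.
Proof.
rewrite proj_distE => /eqP; rewrite enorm_eq0 subr_eq0 => /eqP XY.
apply/val_inj/eqP; rewrite /= eqEdim !(eqP (dim_line _)) leqnn andbT.
by rewrite [line X]line_rep -memvE XY memvZ// [line Y]line_rep memv_line.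
Qed.

Lemma proj_dist_sym X Y : proj_dist X Y = proj_dist Y X.
Proof.
rewrite /proj_dist (cdotC (rep X) (rep Y)).
by case: (cdot (rep X) (rep Y)) => a b /=; rewrite sqrrN.
Qed.

Lemma proj_dist_triangle Y X Z :
  proj_dist X Z <= proj_dist X Y + proj_dist Y Z.
Proof.
pose c := cdot (rep X) (rep Y); pose e := cdot (rep Y) (rep Z).
apply: (le_trans (proj_dist_le X Z (c * e))).
have -> : rep X - (c * e) *: rep Z =
    (rep X - c *: rep Y) + c *: (rep Y - e *: rep Z).
  by rewrite scalerBr addrA subrK -[in LHS]scalerA.
apply: (le_trans (ler_enormD _ _)); rewrite -proj_distE lerD2l enormZ.
by rewrite -proj_distE ler_piMl ?sqrtr_ge0// normc_cdot_rep.
Qed.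

HB.instance Definition _ := @isMetric.Build R (projective R d) proj_dist
  proj_distxx proj_dist_sep proj_dist_sym proj_dist_triangle.

End Projective.

Section ProjectivePointed.
Variables (R : realType) (n : nat).

Lemma dim_line_delta :
  \dim <[delta_mx 0 0 : 'cV[R[i]]_n.+1]> == 1%N.
Proof.
rewrite dim_vline (_ : _ != 0)//; apply/eqP => /matrixP/(_ 0 0)/eqP.
by rewrite !mxE !eqxx oner_eq0.
Qed.

HB.instance Definition _ :=
  isPointed.Build (projective R n.+1) (Projective dim_line_delta).

End ProjectivePointed.

(* Operators on a normed space given by an extended norm [N] on an ambient
   module [V]: the space itself is the set of vectors with [N u < +oo]. *)
Section Operators.
Variables (R : realType) (V : lmodType R[i]) (N : V -> \bar R).
Implicit Types (T : V -> V) (F H : set V) (u w : V) (z : R[i]).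

Definition normed_space : set V := [set u | (N u < +oo)%E].

Definition bounded_operator T :=
  [/\ forall u, normed_space u -> normed_space (T u),
      forall z u w, normed_space u -> normed_space w ->
        T (z *: u + w) = z *: T u + T w
    & exists M : R, forall u, normed_space u -> (N (T u) <= M%:E * N u)%E].

Definition operator_norm H T : \bar R :=
  ereal_sup [set N (T u) | u in [set u | H u /\ (N u <= 1)%E]].

(* Gelfand's formula lim ||T^n||^(1/n) for the restriction of T to H; the limit
   exists for a bounded operator, so it is the upper limit. *)
Definition spectral_radius H T : \bar R :=
  limn_esup (fun n => poweR (operator_norm H (iter n T)) (n%:R^-1)).

Definition op_eigenvalue H T z := exists u, [/\ H u, u != 0 & T u = z *: u].

(* algebraic multiplicity one *)
Definition simple_eigenvalue H T z :=
  exists u, [/\ H u, u != 0, T u = z *: u &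
    forall w n, H w -> iter n (fun w' => T w' - z *: w') w = 0 ->
      exists c : R[i], w = c *: u].

Definition linear_subspace H :=
  H 0 /\ forall (z : R[i]) u w, H u -> H w -> H (z *: u + w).

Definition norm_closed H := forall (u : nat -> V) w,
  (forall n, H (u n)) -> normed_space w ->
  (fun n => N (u n - w)) @ \oo --> 0%E -> H w.

Definition finite_dim H := exists n (b : 'I_n -> V),
  forall u, H u -> exists c : 'I_n -> R[i], u = \sum_i c i *: b i.

(* Hennion and Herve, Limit theorems for Markov chains and stochastic
   properties of dynamical systems by quasi-compactness, Def. II.1 *)
Definition quasi_compact T := bounded_operator T /\
  exists F H : set V,
    [/\ [/\ linear_subspace F, F `<=` normed_space, norm_closed F &
            forall u, F u -> F (T u)],
        [/\ linear_subspace H, H `<=` normed_space, norm_closed H &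
            forall u, H u -> H (T u)],
        (forall u, normed_space u -> exists f h, [/\ F f, H h & u = f + h]) /\
          F `&` H = [set 0],
        finite_dim F /\
          (forall z, op_eigenvalue F T z ->
            (Normc.normc z)%:E = spectral_radius normed_space T)
      & (spectral_radius H T < spectral_radius normed_space T)%E].

Definition peripheral_eigenvalues T : set R[i] :=
  [set z | op_eigenvalue normed_space T z /\ Normc.normc z = 1].

End Operators.

Section MatrixMeasure.
Variables (R : realType) (d : nat).
Local Notation M := 'M[R[i]]_d.
Implicit Types (w : M) (nu : set M -> \bar R).

Definition opnorm w : R :=
  sup [set enorm (w *m x) | x in [set x | enorm x <= 1]].

Definition msupport nu : set M :=
  [set w | forall U, open U -> U w -> (0 < nu U)%E].

Definition irreducible nu :=
  ~ exists F : {vspace 'cV[R[i]]_d}, [/\ F != 0%VS, F != fullv &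
    forall w, msupport nu w -> forall x, x \in F -> w *m x \in F].

Definition support_products nu : set M :=
  [set w | exists l : seq M,
    (forall u, u \in l -> msupport nu u) /\ w = foldr mulmx 1%:M l].

Definition contracting nu :=
  exists w : nat -> M,
    (forall k, support_products nu (w k) /\ w k != 0) /\
    exists2 L : M, \rank L = 1%N &
      (fun k => ((opnorm (w k))^-1)%:C *: w k) @ \oo --> L.

End MatrixMeasure.

(* From here on the dimension is d.+1: it must be positive for the projective
   space to be inhabited, as measurable types are. *)
Section Projective_functions.
Variables (R : realType) (d : nat).
Local Notation P := (projective R d.+1).
Local Notation M := 'M[R[i]]_d.+1.

Definition proj_class (x : 'cV[R[i]]_d.+1) : P := insubd (point : P) <[x]>%VS.

(* Meaningful when [w *m rep X != 0] only; every use is guarded. *)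
Definition proj_act (w : M) (X : P) : P := proj_class (w *m rep X).

(* In both seminorms below the diagonal contributes 0, since 0^-1 = 0. *)
Definition holder_norm (alpha : R) (f : P -> R[i]^o) : \bar R :=
  (ereal_sup (range (fun X => (Normc.normc (f X))%:E)) +
   ereal_sup (range (fun XY : P * P =>
     (Normc.normc (f XY.1 - f XY.2) / (mdist XY.1 XY.2) `^ alpha)%:E)))%E.

End Projective_functions.

Section Sequences.
Variables (R : realType) (A : polishType R).

Definition cylinders : set (set (nat -> A)) :=
  [set B | exists i (D : set (borel A)),
    measurable D /\ B = [set w | D (w i)]].

Definition Omega := g_sigma_algebraType cylinders.
HB.instance Definition _ := Measurable.on Omega.

Definition left_shift (w : Omega) : Omega := fun i => w i.+1.

Definition first_coords n (w : Omega) : n.-tuple (borel A) :=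
  [tuple w (i : nat) | i < n].

Definition dist_Omega (a b : Omega) : R :=
  limn (series (fun k => 2%:R ^- k.+1 * Num.min (mdist (a k) (b k)) 1)).

Definition lip_norm (f : Omega -> R) : \bar R :=
  (ereal_sup (range (fun w => `|f w|%:E)) +
   ereal_sup (range (fun ab : Omega * Omega =>
     (`|f ab.1 - f ab.2| / dist_Omega ab.1 ab.2)%:E)))%E.

Definition Lip_b : set (Omega -> R) := [set f | (lip_norm f < +oo)%E].

End Sequences.

Section Transfer.
Variables (R : realType) (d : nat) (A : polishType R).
Variables (mu : {measure set (borel A) -> \bar R}) (v : A -> 'M[R[i]]_d.+1).
Variable s : R.
Local Notation P := (projective R d.+1).
Implicit Types (f e : P -> R) (X : P).

(* Integral over A^n against the n-fold product of mu, as an iterated integral;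
   mu itself is not assumed sigma-finite, but it is so on {v != 0}, outside of
   which all the integrands considered vanish. *)
Fixpoint product_integral n : (n.-tuple (borel A) -> \bar R) -> \bar R :=
  match n with
  | 0 => fun F => F [tuple]
  | n'.+1 => fun F =>
      (\int[mu]_a product_integral (fun t => F [tuple of a :: t]))%E
  end.

(* the sequence a_1, ..., a_n is sent to v_{a_n} *m ... *m v_{a_1} *)
Definition cocycle (t : seq A) : 'M[R[i]]_d.+1 :=
  foldl (fun w a => v a *m w) 1%:M t.

Definition kappa : R :=
  fine (limn (fun n => poweR
    (product_integral (fun t : n.-tuple _ => (opnorm (cocycle t) `^ s)%:E))
    (n%:R^-1))).

Definition Gamma f X : R :=
  \int[mu]_a (if v a *m rep X == 0 then 0
              else f (proj_act (v a) X) * enorm (v a *m rep X) `^ s).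

Definition eigenpair e (sigma : probability (borel P) R) :=
  [/\ continuous e /\ (forall X, 0 <= e X),
      (forall X, Gamma e X = kappa * e X),
      (forall phi : P -> R, continuous phi ->
         \int[sigma]_X Gamma phi X = kappa * \int[sigma]_X phi X)
    & \int[sigma]_X e X = 1].

Definition unique_eigenpair e (sigma : probability (borel P) R) :=
  eigenpair e sigma /\
  forall e' (sigma' : probability (borel P) R), eigenpair e' sigma' ->
    e' = e /\ (forall B, measurable B -> sigma' B = sigma B).

Definition qn e n X (w : 'M[R[i]]_d.+1) : R :=
  if w *m rep X == 0 then 0
  else (kappa ^+ n)^-1 * (e (proj_act w X) / e X) * enorm (w *m rep X) `^ s.

Definition Qop e f X : R :=
  \int[mu]_a (if v a *m rep X == 0 then 0
              else f (proj_act (v a) X) * qn e 1 X (v a)).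

Definition QopC e (f : P -> R[i]^o) (X : P) : R[i]^o :=
  Qop e (fun Y => complex.Re (f Y)) X +i* Qop e (fun Y => complex.Im (f Y)) X.

Definition path_law e X (Q : probability (Omega A) R) :=
  forall n, (0 < n)%N -> forall B : set (n.-tuple (borel A)), measurable B ->
    Q (@first_coords R A n @^-1` B) =
    product_integral (fun t : n.-tuple _ => (qn e n X (cocycle t) * \1_B t)%:E).

Definition invariant_probability e (eta : probability (borel P) R) :=
  forall phi : P -> R, continuous phi ->
    \int[eta]_X Qop e phi X = \int[eta]_X phi X.

Definition unique_invariant_probability e (eta : probability (borel P) R) :=
  invariant_probability e eta /\
  forall eta' : probability (borel P) R, invariant_probability e eta' ->
    forall B, measurable B -> eta' B = eta B.

Definition root_of_unity (p l : nat) : R[i] :=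
  cos (2 * pi * l%:R / p%:R) +i* sin (2 * pi * l%:R / p%:R).

Definition peripheral_spectrum_of_Q e (alpha : R) :=
  let N := @holder_norm R d alpha in
  [/\ quasi_compact N (QopC e),
      spectral_radius N (normed_space N) (QopC e) = 1%E
    & exists p : nat, [/\ (0 < p)%N,
        peripheral_eigenvalues N (QopC e) = root_of_unity p @` `I_p
      & forall z, peripheral_eigenvalues N (QopC e) z ->
          simple_eigenvalue (normed_space N) (QopC e) z]].

End Transfer.

(* Main.v *)
(**
Write [weight s phi X w] for phi(w.X) |w x|^s.  By the cocycle identity
[weightM], the integral of a function of the first n coordinates against Q_X is
k(s)^-n e(X)^-1 times its integral against the n-fold product of mu weighted by
[weight s e X (v_{a_n} ... v_{a_1})].  Since [weight s phi X w] is
alpha-Hölder in X with constant O(|w|^s), and the integral of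
|v_{a_n} ... v_{a_1}|^s is O(k(s)^n) because Gamma e = k(s) e and inf e > 0,
these expectations are alpha-Hölder in X uniformly in n.  The same estimate
gives an alpha-Hölder fixed function of Gamma / k(s), so e is Hölder by
uniqueness.

Truncating f and g to finitely many coordinates costs an exponentially small
error; the correlation then becomes the integral of the truncation of f against
Q_s^{nm+j} G with G(X) = E_X[g] Hölder.  On the peripheral subspace of the
quasi-compact operator Q_s the eigenvalues are simple m-th roots of unity, so
Q_s^m is the identity there; the mean of m consecutive iterates maps this
subspace to the fixed functions, which are the constants, and the complement
decays geometrically.
*)
Require Import Defs.
From HB Require Import structures.
From mathcomp Require Import all_boot all_order all_algebra.
From mathcomp Require Import all_classical all_reals all_analysis.
From mathcomp Require Import measurable_realfun.
From mathcomp Require Import complex ring lra.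

Set Implicit Arguments.
Unset Strict Implicit.
Unset Printing Implicit Defensive.

Import Order.TTheory GRing.Theory Num.Theory.
Import numFieldNormedType.Exports.

Local Open Scope classical_set_scope.
Local Open Scope ring_scope.
Local Open Scope complex_scope.

(** * Integration against mixtures of measures *)

(** Three obstacles shape the argument. Since [mu] may fail to be sigma-finite, Tonelli does not
    apply to it; as every integrand carries a factor |v_a x|^s, [mu] is replaced by a sigma-finite
    [nu] agreeing with it off {v = 0}, and the n-fold products of [nu] are realised as measures
    [paths nu n] on the sequence space itself, so that functions of sequences are integrated without
    passing to tuples. Measurability of X |-> [QX X B] is not given: it is derived for cylinders
    from Hölder continuity in X, and the mixture formula for [QQ] is applied only to functions of
    finitely many coordinates. Finally, the sizes of the two components in the quasi-compact
    decomposition are controlled not by continuity of the projections but by uniform bounds on the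
    iterates, which hold because Q_s^n phi is Hölder uniformly in n. The truncation lengths grow
    with n, so the estimate for functions of finitely many coordinates must have constants
    independent of these lengths. *)

Section Mixture.
Local Open Scope ereal_scope.
Context d d' (X : measurableType d) (T : measurableType d') (R : realType).
Variables (eta : {measure set X -> \bar R}) (k : X -> {measure set T -> \bar R}).
Variables (w : X -> R) (m : {measure set T -> \bar R}).
Hypothesis mw : measurable_fun setT w.
Hypothesis w_ge0 : forall x, (0 <= w x)%R.
Hypothesis mk : forall B, measurable B -> measurable_fun setT (fun x => k x B).
Hypothesis mE : forall B, measurable B -> m B = \int[eta]_x ((w x)%:E * k x B).
Import HBNNSimple.

Let nnsfun_int (n : {measure set T -> \bar R}) (f : {nnsfun T >-> R}) :
  \int[n]_t (f t)%:E =
  \sum_(r \in range f) r%:E * n (f @^-1` [set r]).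
Proof.
by rewrite integralT_nnsfun sintegralE.
Qed.

Let mkf (f : {nnsfun T >-> R}) :
  measurable_fun setT (fun x => \int[k x]_t (f t)%:E).
Proof.
apply: (eq_measurable_fun (fun x =>
  \sum_(r \in range f) r%:E * k x (f @^-1` [set r]))).
  by move=> x _; rewrite nnsfun_int.
apply: emeasurable_fsum => // r.
by apply: emeasurable_funM => //; apply: mk.
Qed.

Let nnsfun_mixture (f : {nnsfun T >-> R}) :
  \int[m]_t (f t)%:E = \int[eta]_x ((w x)%:E * \int[k x]_t (f t)%:E).
Proof.
rewrite nnsfun_int.
under [RHS]eq_integral do rewrite nnsfun_int.
have f0 r : range f r -> 0 <= r%:E.
  by move=> [x _ <-]; rewrite lee_fin.
transitivity (\int[eta]_x
    (\sum_(r \in range f) ((w x)%:E * (r%:E * k x (f @^-1` [set r]))))).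
  rewrite ge0_integral_fsum//; last 2 first.
  - move=> r; apply: emeasurable_funM; [exact/measurable_EFinP|]; apply: emeasurable_funM => //.
    exact: mk.
  - move=> r x _; apply: mule_ge0; first by rewrite lee_fin.
    have [r0|r0] := leP 0%R r; first by rewrite mule_ge0// lee_fin.
    by rewrite preimage_nnfun0// measure0 mule0.
  apply: eq_fsbigr => r /set_mem rf; rewrite mE//.
  rewrite -ge0_integralZl//=; last 3 first.
  - apply: emeasurable_funM; first exact/measurable_EFinP.
    exact: mk.
  - by move=> x _; rewrite mule_ge0// lee_fin.
  - exact: f0.
  by apply: eq_integral => x _; rewrite muleCA.
apply: eq_integral => x _; rewrite ge0_mule_fsumr// => r.
have [r0|r0] := leP 0%R r; first by rewrite mule_ge0// lee_fin.
by rewrite preimage_nnfun0// measure0 mule0.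
Qed.

Let approx_int (n : {measure set T -> \bar R}) (F : T -> \bar R)
    (mF : measurable_fun setT F) : (forall t, 0 <= F t) ->
  (\int[n]_t (nnsfun_approx measurableT mF i t)%:E) @[i --> \oo]
    --> \int[n]_t F t.
Proof.
move=> F0; pose f_ := nnsfun_approx measurableT mF.
rewrite (_ : \int[n]_t F t = \int[n]_t limn (fun i => (f_ i t)%:E)).
  apply: cvg_monotone_convergence => //.
  - by move=> i; exact/measurable_EFinP.
  - by move=> i t _; rewrite lee_fin.
  - by move=> t _ a b ab; rewrite lee_fin; exact/lefP/nd_nnsfun_approx.
apply: eq_integral => t _; apply/esym/cvg_lim => //.
exact: cvg_nnsfun_approx.
Qed.

(** Simple functions reduce to [mE] on level sets, and monotone convergence under [m], [eta] and
    each [k x] does the rest. Dirac kernels turn this into integration against a density or an image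
    law; the weight 1 gives the averaging of the [QX] over [eta]. *)
Lemma ge0_integral_mixture (F : T -> \bar R) : measurable_fun setT F ->
  (forall t, 0 <= F t) ->
  \int[m]_t F t = \int[eta]_x ((w x)%:E * \int[k x]_t F t).
Proof.
move=> mF F0; pose f_ := nnsfun_approx measurableT mF.
have nd x : nondecreasing_seq (fun i => \int[k x]_t (f_ i t)%:E).
  move=> a b ab; apply: ge0_le_integral => //.
  - by move=> t _; rewrite lee_fin.
  - exact/measurable_EFinP.
  - exact/measurable_EFinP.
  - by move=> t _; rewrite lee_fin; exact/lefP/nd_nnsfun_approx.
have f0 x i : 0 <= \int[k x]_t (f_ i t)%:E.
  by apply: integral_ge0 => t _; rewrite lee_fin.
rewrite -(cvg_lim _ (@approx_int m _ mF F0))//.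
under eq_fun do rewrite nnsfun_mixture.
rewrite -monotone_convergence//; last 3 first.
- by move=> n; apply: emeasurable_funM; [exact/measurable_EFinP|exact: mkf].
- by move=> n x _; rewrite mule_ge0// lee_fin.
- by move=> x _ a b ab; apply: lee_wpmul2l; [rewrite lee_fin|exact: nd].
apply: eq_integral => x _; apply/cvg_lim => //.
by apply: cvgeZl => //; exact: approx_int.
Qed.

End Mixture.

Section Density.
Local Open Scope ereal_scope.
Context d (T : measurableType d) (R : realType).

Lemma ge0_integral_density (eta m : {measure set T -> \bar R}) (w : T -> R) :
  measurable_fun setT w -> (forall x, (0 <= w x)%R) ->
  (forall B, measurable B -> m B = \int[eta]_x (w x * \1_B x)%:E) ->
  forall F : T -> \bar R, measurable_fun setT F -> (forall t, 0 <= F t) ->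
  \int[m]_t F t = \int[eta]_x ((w x)%:E * F x).
Proof.
move=> mw w0 mE F mF F0.
rewrite (@ge0_integral_mixture _ _ _ _ _ eta (fun x : T => \d_x) w)//.
- by apply: eq_integral => x _; rewrite integral_dirac// diracT mul1e.
- by move=> B mB; rewrite /dirac; exact/measurable_EFinP/measurable_indic.
Qed.

Lemma ge0_integral_mrestr (mu : {measure set T -> \bar R}) D
    (mD : measurable D) (F : T -> \bar R) :
  measurable_fun setT F -> (forall t, 0 <= F t) ->
  \int[mrestr mu mD]_t F t = \int[mu]_t ((\1_D t)%:E * F t).
Proof.
move=> mF F0; apply: ge0_integral_density => // B mB.
transitivity (\int[mu]_x (\1_(B `&` D) x)%:E).
  by rewrite integral_indic ?setIT//; exact: measurableI.
by apply: eq_integral => x _; rewrite indicI mulrC.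
Qed.

End Density.

(* Sealed: unification otherwise tries to evaluate representatives of lines. *)
HB.lock Definition growth (R : realType) (d : nat) (w : 'M[R[i]]_d.+1)
  (X : projective R d.+1) : R := enorm (w *m rep X).

HB.lock Definition act (R : realType) (d : nat) (w : 'M[R[i]]_d.+1)
  (X : projective R d.+1) : projective R d.+1 := proj_act w X.

(** A sum of column norms instead of [opnorm]: it still dominates |w x| / |x|, and the column norms
    are growths at the basis points, so that its powers are measurable and integrable as soon as the
    growths are. *)
HB.lock Definition mxnorm (R : realType) (d : nat) (w : 'M[R[i]]_d.+1) : R :=
  \sum_i enorm (col i w).

(** * Geometry of the projective action *)

Section Geometry.
Variables (R : realType) (d : nat).
Local Notation V := 'cV[R[i]]_d.+1.
Local Notation M := 'M[R[i]]_d.+1.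
Local Notation P := (projective R d.+1).
Implicit Types (w : M) (x y : V) (X Y : P).

Lemma mxnormE w : mxnorm w = \sum_i enorm (col i w).
Proof. by rewrite mxnorm.unlock. Qed.

Lemma growthE w X : growth w X = enorm (w *m rep X).
Proof. by rewrite growth.unlock. Qed.

Lemma actE w X : act w X = proj_act w X.
Proof. by rewrite act.unlock. Qed.

Lemma mxnorm_ge0 w : 0 <= mxnorm w.
Proof. by rewrite mxnormE; apply: sumr_ge0 => i _; exact: enorm_ge0. Qed.

Lemma enorm0 : enorm (0 : V) = 0.
Proof. by apply/eqP; rewrite enorm_eq0. Qed.

Lemma enorm_gt0 x : (0 < enorm x) = (x != 0).
Proof. by rewrite lt_def enorm_ge0 andbT enorm_eq0. Qed.

Lemma normc_le_enorm x i : Normc.normc (x i 0) <= enorm x.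
Proof.
rewrite -[leLHS]ger0_norm ?normc_ge0// -sqrtr_sqr ler_wsqrtr//.
by rewrite (bigD1 i)//= lerDl sumr_ge0// => j _; exact: sqr_ge0.
Qed.

Lemma enorm_sum (I : Type) (r : seq I) (Q : pred I) (F : I -> V) :
  enorm (\sum_(i <- r | Q i) F i) <= \sum_(i <- r | Q i) enorm (F i).
Proof.
elim/big_ind2 : _ => //; first by rewrite enorm0.
by move=> x a y b xa yb; rewrite (le_trans (ler_enormD _ _))// lerD.
Qed.

Lemma mulmx_col_sum w x : w *m x = \sum_i x i 0 *: col i w.
Proof.
apply/colP => k; rewrite !mxE summxE; apply: eq_bigr => i _.
by rewrite !mxE mulrC.
Qed.

Lemma enorm_mulmx w x : enorm (w *m x) <= mxnorm w * enorm x.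
Proof.
rewrite mxnormE mulmx_col_sum (le_trans (enorm_sum _ _ _))// mulr_suml.
apply: ler_sum => i _; rewrite enormZ mulrC.
by rewrite ler_wpM2l ?enorm_ge0// normc_le_enorm.
Qed.

Lemma line_class x : x != 0 -> line (proj_class x) = <[x]>%VS.
Proof. by move=> x0; rewrite /proj_class val_insubd dim_vline x0. Qed.

(** [rep] normalises a vector picked in the line, so it recovers [x] only up to a scalar of modulus
    1/|x| and unknown phase. *)
Lemma rep_class x : x != 0 ->
  exists2 c : R[i], Normc.normc c = (enorm x)^-1 & rep (proj_class x) = c *: x.
Proof.
move=> x0; have /vlineP[c cx] : rep (proj_class x) \in <[x]>%VS.
  by rewrite -line_class// line_rep memv_line.
exists c => //; have := enorm_rep (proj_class x); rewrite cx enormZ.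
by move=> /(canRL (mulfK _)); rewrite enorm_eq0 => /(_ x0); rewrite mul1r.
Qed.

Lemma class_scale (c : R[i]) x : c != 0 -> proj_class (c *: x) = proj_class x.
Proof.
move=> c0; rewrite /proj_class; congr insubd.
have [->|x0] := eqVneq x 0; first by rewrite scaler0.
apply/eqP; rewrite eqEdim -memvE memvZ ?memv_line//=.
by rewrite !dim_vline scaler_eq0 negb_or c0 x0.
Qed.

Lemma class_rep X : proj_class (rep X) = X.
Proof. by apply/val_inj; rewrite /= line_class ?rep_neq0// -line_rep. Qed.

Lemma normc_eq0 (c : R[i]) : (Normc.normc c == 0) = (c == 0).
Proof.
apply/eqP/eqP => [|->]; [exact: Normc.eq0_normc|exact: Normc.normc0].
Qed.

(** By [proj_dist_le] the distance is at most that of one unit representative to any multiple of the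
    other. The scalar [z] stays free: an inner product in [dist_act], and 1 in
    [class_continuous]. *)
Lemma dist_class (z : R[i]) x y : x != 0 -> y != 0 ->
  proj_dist (proj_class x) (proj_class y) <= enorm (x - z *: y) / enorm x.
Proof.
move=> x0 y0; have [a na ax] := rep_class x0; have [b nb byy] := rep_class y0.
have b0 : b != 0 by rewrite -normc_eq0 nb invr_eq0 enorm_eq0.
apply: (le_trans (proj_dist_le _ _ (a * z / b))).
by rewrite ax byy scalerA divfK// -scalerA -scalerBr enormZ na mulrC.
Qed.

Lemma mdistE X Y : mdist X Y = proj_dist X Y. Proof. by []. Qed.

Lemma growth_ge0 w X : 0 <= growth w X.
Proof. by rewrite growthE enorm_ge0. Qed.

Lemma growth_eq0 w X : (growth w X == 0) = (w *m rep X == 0).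
Proof. by rewrite growthE enorm_eq0. Qed.

Lemma growth_le w X : growth w X <= mxnorm w.
Proof.
by rewrite growthE (le_trans (enorm_mulmx _ _))// enorm_rep mulr1.
Qed.

Lemma growth1 X : growth 1%:M X = 1.
Proof. by rewrite growthE mul1mx enorm_rep. Qed.

Lemma act1 X : act 1%:M X = X.
Proof. by rewrite actE /proj_act mul1mx class_rep. Qed.

Lemma rep_act w X : growth w X != 0 -> exists2 c : R[i],
  Normc.normc c = (growth w X)^-1 & rep (act w X) = c *: (w *m rep X).
Proof.
by rewrite growth_eq0 growthE actE; exact: rep_class.
Qed.

Lemma actM w' w X : growth w X != 0 -> act w' (act w X) = act (w' *m w) X.
Proof.
move=> wX; have [c nc cE] := rep_act wX.
rewrite [act w' _]actE /proj_act cE -scalemxAr mulmxA class_scale//.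
  by rewrite actE.
by rewrite -normc_eq0 nc invr_eq0.
Qed.

Lemma growthM w' w X : growth w X != 0 ->
  growth (w' *m w) X = growth w' (act w X) * growth w X.
Proof.
move=> wX; have [c nc cE] := rep_act wX.
rewrite [growth w' _]growthE cE -scalemxAr mulmxA enormZ nc.
by rewrite mulrAC mulVf// mul1r growthE.
Qed.

Lemma growthM0 w' w X : growth w X = 0 -> growth (w' *m w) X = 0.
Proof.
move/eqP; rewrite growth_eq0 => /eqP wX.
by rewrite growthE -mulmxA wX mulmx0 enorm0.
Qed.

(** Project [rep X] orthogonally on the line of [rep Y]: the remainder has norm exactly the
    distance, and the coefficient [c] has modulus at most 1. *)
Lemma growth_lip w X Y : growth w X - growth w Y <= mxnorm w * mdist X Y.
Proof.
rewrite !growthE mdistE proj_distE; set c := cdot _ _.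
have -> : w *m rep X = w *m (rep X - c *: rep Y) + c *: (w *m rep Y).
  by rewrite mulmxBr scalemxAr subrK.
rewrite lerBlDr (le_trans (ler_enormD _ _))// lerD ?enorm_mulmx//.
by rewrite enormZ ler_piMl ?enorm_ge0// normc_cdot_rep.
Qed.

Let ler_mul_of_ler_div (a b c n : R) :
  0 < b -> a <= c / b -> c <= n -> a * b <= n.
Proof. by move=> b0; rewrite ler_pdivlMr// => /le_trans; apply. Qed.

Lemma dist_act w X Y : growth w X != 0 -> growth w Y != 0 ->
  mdist (act w X) (act w Y) * growth w X <= mxnorm w * mdist X Y.
Proof.
rewrite !growth_eq0 => wX wY.
have := dist_class (cdot (rep X) (rep Y)) wX wY.
rewrite growthE !actE => /ler_mul_of_ler_div; apply.
  by rewrite enorm_gt0; exact: wX.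
by rewrite mdistE proj_distE scalemxAr -mulmxBr; exact: enorm_mulmx.
Qed.

End Geometry.

(** * Hölder estimates for powers and weights *)

Section PowerHolder.
Variable R : realType.

Lemma bernoulli_le (t : R) n : 0 <= t <= 1 -> 1 - t ^+ n <= n%:R * (1 - t).
Proof.
move=> /andP[t0 t1]; elim: n => [|n IH]; first by rewrite expr0 subrr mul0r.
have h : t * (1 - t ^+ n) <= n%:R * (1 - t).
  apply: le_trans IH; rewrite ler_piMl// subr_ge0 exprn_ile1//.
rewrite exprS -natr1; move: h; lra.
Qed.

Lemma powR_split (x a s : R) : 0 < s -> x `^ s = x `^ (s - a) * x `^ a.
Proof. by move=> s0; rewrite -powRD subrK// gt_eqF. Qed.

Lemma ler_powR2 (x y a : R) : 0 <= a -> 0 <= x -> x <= y -> x `^ a <= y `^ a.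
Proof.
by move=> a0 x0 xy; apply: ge0_ler_powR => //; rewrite nnegrE// (le_trans x0).
Qed.

Lemma powR_holder_mul (p N delta a s : R) : 0 < a -> a <= s ->
  0 <= delta -> 0 <= p <= N ->
  p `^ (s - a) * (N * delta) `^ a <= N `^ s * delta `^ a.
Proof.
move=> a0 as_ d0 /andP[p0 pN].
have s0 : 0 < s by exact: lt_le_trans as_.
have N0 : 0 <= N by exact: le_trans pN.
rewrite powRM// mulrA ler_wpM2r ?powR_ge0// (powR_split N a s0).
by rewrite ler_wpM2r ?powR_ge0// ler_powR2// subr_ge0.
Qed.

(** Covers s below and above 1. With q = t p and an integer K >= s, Bernoulli gives 1 - t^s <= 1 -
    t^K <= K (1 - t), and 1 - t <= (1 - t)^a as a <= 1. Then p (1 - t) = p - q <= N delta, while the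
    remaining p^(s - a) is at most N^(s - a). *)
Lemma powR_sub_holder (p q N delta a s : R) (K : nat) : 0 < a -> a <= 1 ->
    a <= s -> s <= K%:R -> 0 <= delta -> 0 <= q -> q <= p -> p <= N ->
    p - q <= N * delta ->
  p `^ s - q `^ s <= K%:R * (N `^ s * delta `^ a).
Proof.
move=> a0 a1 as_ sK d0 q0 qp pN pqd.
have s0 : 0 < s by exact: lt_le_trans as_.
have K1 : 1 <= K%:R :> R.
  by rewrite -[1]/(1%:R) ler_nat -(ltr_nat R) (lt_le_trans s0).
have p0 : 0 <= p by exact: le_trans qp.
have N0 : 0 <= N by exact: le_trans pN.
have [pe0|pn0] := eqVneq p 0.
  have qe0 : q = 0 by apply/eqP; rewrite eq_le q0 andbT -pe0.
  by rewrite pe0 qe0 subrr !mulr_ge0// powR_ge0.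
have pp : 0 < p by rewrite lt_def pn0.
pose t := q / p.
have t0 : 0 <= t by rewrite divr_ge0.
have t1 : t <= 1 by rewrite ler_pdivrMr// mul1r.
have qE : q = p * t by rewrite /t mulrC divfK.
have ts : 1 - t `^ s <= K%:R * (1 - t).
  apply: le_trans (bernoulli_le K _); last by rewrite t0.
  rewrite lerD2l lerN2 -powR_mulrn//.
  have [->|tn0] := eqVneq t 0; last by rewrite ger_powR// lt_def tn0 t0.
  rewrite powR0; first exact: powR_ge0.
  by rewrite gt_eqF// (lt_le_trans _ K1).
have ta : 1 - t <= (1 - t) `^ a.
  have [->|tn1] := eqVneq (1 - t) 0; first exact: powR_ge0.
  by rewrite ger1_powR// lt_def tn1 subr_ge0 t1 gerBl.
rewrite qE powRM// -[X in X - _]mulr1 -mulrBr.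
apply: (@le_trans _ _ (p `^ s * (K%:R * (1 - t) `^ a))).
  rewrite ler_wpM2l ?powR_ge0// (le_trans ts)// ler_wpM2l//.
rewrite mulrCA ler_wpM2l// (powR_split p a s0) -mulrA -powRM ?subr_ge0//.
rewrite mulrBr mulr1 -qE.
apply: (@le_trans _ _ (p `^ (s - a) * (N * delta) `^ a)).
  by rewrite ler_wpM2l ?powR_ge0// ler_powR2 ?(ltW a0)// subr_ge0.
by apply: powR_holder_mul => //; rewrite p0.
Qed.

End PowerHolder.

Definition holder_fun (R : realType) (T : metricType R) (a m : R) (f : T -> R)
  := forall X Y, `|f X - f Y| <= m * mdist X Y `^ a.

Section Weight.
Variables (R : realType) (d : nat) (s : R).
Local Notation M := 'M[R[i]]_d.+1.
Local Notation P := (projective R d.+1).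
Implicit Types (w : M) (X Y : P) (phi : P -> R).

(** When [w] kills the line, [act w X] is a default value, but the factor growth^s vanishes since s
    > 0: the guards of [Gamma] and [qn] are built in. *)
Definition weight phi X w : R := phi (act w X) * growth w X `^ s.

Hypothesis s_gt0 : 0 < s.

Let s_neq0 : s != 0. Proof. by rewrite gt_eqF. Qed.

Lemma weight0 phi X w : growth w X = 0 -> weight phi X w = 0.
Proof. by move=> wX; rewrite /weight wX powR0// mulr0. Qed.

Lemma weightM phi X w' w : weight phi X (w' *m w) =
  weight phi (act w X) w' * growth w X `^ s.
Proof.
have [wX|wX] := eqVneq (growth w X) 0.
  by rewrite weight0 ?growthM0// wX powR0// mulr0.
rewrite /weight -actM// growthM// powRM ?growth_ge0//.
by rewrite mulrA.
Qed.

Lemma weight1 phi X : weight phi X 1%:M = phi X.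
Proof. by rewrite /weight act1 growth1 powR1 mulr1. Qed.

Variables (alpha : R) (K : nat).
Hypotheses (a_gt0 : 0 < alpha) (a_le1 : alpha <= 1) (a_le_s : alpha <= s).
Hypothesis s_leK : s <= K%:R.

Lemma weight_le phi (B : R) X w : (forall X, `|phi X| <= B) ->
  `|weight phi X w| <= B * growth w X `^ s.
Proof.
by move=> phiB; rewrite normrM [X in _ * X]ger0_norm ?powR_ge0//
  ler_wpM2r// powR_ge0.
Qed.

Let enorm_powR_holder w X Y :
  growth w X `^ s - growth w Y `^ s <=
  K%:R * (mxnorm w `^ s * mdist X Y `^ alpha).
Proof.
have [h|h] := leP (growth w Y) (growth w X).
  apply: powR_sub_holder => //; first exact: mdist_ge0.
  - exact: growth_ge0.
  - exact: growth_le.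
  - exact: growth_lip.
apply: (@le_trans _ _ 0); last by rewrite !mulr_ge0// powR_ge0.
by rewrite subr_le0 ler_powR2// ?growth_ge0 ?ltW.
Qed.

Let weight_holder_le phi (B m : R) w X Y : 0 <= m ->
    (forall X, `|phi X| <= B) -> holder_fun alpha m phi ->
    growth w X != 0 ->
  `|weight phi X w - weight phi Y w| <=
  (m + B * K%:R) * (mxnorm w `^ s * mdist X Y `^ alpha).
Proof.
move=> m0 phiB phim wX; have B0 : 0 <= B by rewrite (le_trans _ (phiB X)).
set D := mxnorm w `^ s * _.
have D0 : 0 <= D by rewrite mulr_ge0// powR_ge0.
have XY : growth w X `^ s - growth w Y `^ s <= K%:R * D.
  exact: enorm_powR_holder.
have YX : growth w Y `^ s - growth w X `^ s <= K%:R * D.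
  by rewrite /D metric_sym; exact: enorm_powR_holder.
rewrite mulrDl -mulrA.
have [wY|wY] := eqVneq (growth w Y) 0.
  move: XY; rewrite wY powR0// subr0 => XY.
  rewrite (weight0 _ wY) subr0 (le_trans (weight_le _ _ phiB))//.
  rewrite (le_trans (ler_wpM2l B0 XY))// lerDr mulr_ge0//.
have -> : weight phi X w - weight phi Y w =
    (phi (act w X) - phi (act w Y)) * growth w X `^ s +
    phi (act w Y) *
      (growth w X `^ s - growth w Y `^ s).
  by rewrite /weight mulrBl mulrBr addrA subrK.
rewrite (le_trans (ler_normD _ _))// lerD// normrM.
  rewrite [X in _ * X]ger0_norm ?powR_ge0//.
  apply: (le_trans (ler_wpM2r (powR_ge0 _ _) (phim _ _))).
  (* The power alpha of the growth compensates the expansion of [act w] through [dist_act]; the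
     remaining power s - alpha, nonnegative, is bounded by the matrix norm. *)
  rewrite -mulrA ler_wpM2l// (powR_split _ alpha s_gt0) mulrCA.
  rewrite -powRM ?growth_ge0 ?mdist_ge0//.
  apply: (@le_trans _ _ (growth w X `^ (s - alpha) *
      (mxnorm w * mdist X Y) `^ alpha)).
    apply: ler_wpM2l; first exact: powR_ge0.
    apply: ler_powR2; first exact: ltW.
      by rewrite mulr_ge0 ?mdist_ge0 ?growth_ge0.
    exact: dist_act.
  apply: powR_holder_mul => //; first exact: mdist_ge0.
  by rewrite growth_ge0 growth_le.
apply: ler_pM => //.
rewrite ler_norml XY andbT lerNl opprB; exact: YX.
Qed.

Lemma weight_holder phi (B m : R) w X Y : 0 <= m ->
    (forall X, `|phi X| <= B) -> holder_fun alpha m phi ->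
  `|weight phi X w - weight phi Y w| <=
  (m + B * K%:R) * (mxnorm w `^ s * mdist X Y `^ alpha).
Proof.
move=> m0 phiB phim.
have [wX|wX] := eqVneq (growth w X) 0; last exact: weight_holder_le.
have [wY|wY] := eqVneq (growth w Y) 0.
  have B0 : 0 <= B by rewrite (le_trans _ (phiB X)).
  rewrite !weight0// subrr normr0 !mulr_ge0 ?powR_ge0// addr_ge0// mulr_ge0//.
by rewrite distrC metric_sym weight_holder_le.
Qed.

End Weight.

(** * Measurability and compactness *)

Section ComplexMeasurable.
Context d (T : measurableType d) (R : realType).
Implicit Types f g : T -> R[i].

Definition cmeasurable f := measurable_fun setT (fun t => complex.Re (f t)) /\
  measurable_fun setT (fun t => complex.Im (f t)).

Lemma cmeasurable_cst (c : R[i]) : cmeasurable (fun=> c).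
Proof. by split; exact: measurable_cst. Qed.

Lemma cmeasurableD f g : cmeasurable f -> cmeasurable g ->
  cmeasurable (fun t => f t + g t).
Proof.
move=> [f1 f2] [g1 g2]; split.
  rewrite (_ : (fun t => _) = (fun t => complex.Re (f t) + complex.Re (g t))).
    exact: measurable_funD.
  by apply/funext => t; case: (f t); case: (g t).
rewrite (_ : (fun t => _) = (fun t => complex.Im (f t) + complex.Im (g t))).
  exact: measurable_funD.
by apply/funext => t; case: (f t); case: (g t).
Qed.

Lemma cmeasurableM f g : cmeasurable f -> cmeasurable g ->
  cmeasurable (fun t => f t * g t).
Proof.
move=> [f1 f2] [g1 g2]; split.
  rewrite (_ : (fun t => _) = (fun t => complex.Re (f t) * complex.Re (g t) -
      complex.Im (f t) * complex.Im (g t))).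
    by apply: measurable_funB; exact: measurable_funM.
  by apply/funext => t; case: (f t); case: (g t).
rewrite (_ : (fun t => _) = (fun t => complex.Re (f t) * complex.Im (g t) +
      complex.Im (f t) * complex.Re (g t))).
  by apply: measurable_funD; exact: measurable_funM.
by apply/funext => t; case: (f t); case: (g t).
Qed.

Lemma cmeasurable_sum (I : Type) (r : seq I) (F : I -> T -> R[i]) :
  (forall i, cmeasurable (F i)) ->
  cmeasurable (fun t => \sum_(i <- r) F i t).
Proof.
move=> mF; elim: r => [|i r IH].
  under eq_fun do rewrite big_nil; exact: cmeasurable_cst.
by under eq_fun do rewrite big_cons; exact: cmeasurableD.
Qed.

Definition mxmeasurable m n (w : T -> 'M[R[i]]_(m, n)) :=
  forall i j, cmeasurable (fun t => w t i j).

Lemma mxmeasurable_cst m n (a : 'M[R[i]]_(m, n)) : mxmeasurable (fun=> a).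
Proof. by move=> i j; exact: cmeasurable_cst. Qed.

Lemma mxmeasurableM m n p (a : T -> 'M[R[i]]_(m, n)) (b : T -> 'M[R[i]]_(n, p)) :
  mxmeasurable a -> mxmeasurable b -> mxmeasurable (fun t => a t *m b t).
Proof.
move=> ma mb i j; under eq_fun do rewrite mxE.
by apply: cmeasurable_sum => k; exact: cmeasurableM.
Qed.

Lemma mxmeasurableB m n (a b : T -> 'M[R[i]]_(m, n)) :
  mxmeasurable a -> mxmeasurable b -> mxmeasurable (fun t => a t - b t).
Proof.
move=> ma mb i j; under eq_fun do rewrite !mxE -mulN1r.
apply: cmeasurableD => //; apply: cmeasurableM => //; exact: cmeasurable_cst.
Qed.

Lemma enorm_sqrtE m (x : 'cV[R[i]]_m) : enorm x =
  Num.sqrt (\sum_i (complex.Re (x i 0) ^+ 2 + complex.Im (x i 0) ^+ 2)).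
Proof.
congr Num.sqrt; apply: eq_bigr => i _; case: (x i 0) => a b /=.
by rewrite sqr_sqrtr// addr_ge0// sqr_ge0.
Qed.

Lemma enorm_distC m (x y : 'cV[R[i]]_m) : enorm (x - y) = enorm (y - x).
Proof.
rewrite !enorm_sqrtE; congr Num.sqrt; apply: eq_bigr => i _; rewrite !mxE.
by case: (x i 0) (y i 0) => a b [a' b'] /=; ring.
Qed.

Lemma measurable_enorm m (y : T -> 'cV[R[i]]_m) : mxmeasurable y ->
  measurable_fun setT (fun t => enorm (y t)).
Proof.
move=> my; under eq_fun do rewrite enorm_sqrtE.
apply: measurableT_comp; first exact: continuous_measurable_fun (@sqrt_continuous R).
by apply: measurable_sum => i; apply: measurable_funD; apply: measurable_funX;
  case: (my i 0).
Qed.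

End ComplexMeasurable.

Section EnormOpen.
Context d (T : measurableType d) (R : realType) (m : nat).
Local Notation V := 'cV[R[i]]_m.

(** Openness for the Euclidean norm, which avoids a comparison with the topology of matrices: all
    estimates on the projective action are in terms of [enorm]. *)
Definition enorm_open (O : set V) :=
  forall x, O x -> exists2 r : R, 0 < r & forall y, enorm (y - x) < r -> O y.

Definition ratvec (q : {ffun 'I_m -> rat * rat}) : V :=
  \col_k (ratr (q k).1 +i* ratr (q k).2).

Lemma ratvec_dense (x : V) (r : R) : 0 < r ->
  exists q, enorm (x - ratvec q) < r.
Proof.
(* Each of the m coordinates contributes at most 2 e. Dividing by m + 1 instead of m makes the total
   strictly smaller than r, also for m = 0. *)
move=> r0; pose e := r / (2 * m.+1%:R).
have e0 : 0 < e by rewrite divr_gt0// mulr_gt0.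
have dense (a : R) : {q : rat | `|a - ratr q| < e}.
  apply: cid; have [q] := @rat_in_itvoo R (a - e) (a + e) ltac:(lra).
  rewrite in_itv/= => /andP[h1 h2]; exists q.
  by rewrite ltr_norml; apply/andP; split; lra.
pose q : {ffun 'I_m -> rat * rat} :=
  [ffun k => (sval (dense (complex.Re (x k 0))),
             sval (dense (complex.Im (x k 0))))].
exists q.
have le_sum : enorm (x - ratvec q) <= \sum_(k < m) (e + e).
  have sum_sqr (s : seq 'I_m) (F : 'I_m -> R) : (forall k, 0 <= F k) ->
      \sum_(k <- s) F k ^+ 2 <= (\sum_(k <- s) F k) ^+ 2.
    move=> F0; elim: s => [|k s IH]; first by rewrite !big_nil expr0n.
    rewrite !big_cons sqrrD -addrA lerD2l (le_trans IH)// lerDr mulrn_wge0//.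
    by rewrite mulr_ge0// sumr_ge0.
  have F0 k : 0 <= `|complex.Re ((x - ratvec q) k 0)| +
                   `|complex.Im ((x - ratvec q) k 0)| by rewrite addr_ge0.
  rewrite enorm_sqrtE (@le_trans _ _ (\sum_(k < m)
      (`|complex.Re ((x - ratvec q) k 0)| +
       `|complex.Im ((x - ratvec q) k 0)|)))//; last first.
    apply: ler_sum => k _; rewrite !mxE ffunE/=.
    case: (x k 0) (svalP (dense (complex.Re (x k 0))))
      (svalP (dense (complex.Im (x k 0)))) => a b /= h1 h2.
    by rewrite lerD// ltW.
  rewrite -[leRHS]ger0_norm ?sumr_ge0// -sqrtr_sqr ler_wsqrtr//.
  apply: le_trans (sum_sqr _ _ F0); apply: ler_sum => k _.
  rewrite sqrrD !real_normK ?num_real//.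
  by rewrite addrAC lerDl mulrn_wge0// mulr_ge0.
apply: (le_lt_trans le_sum); rewrite sumr_const card_ord -mulr_natr /e.
rewrite (_ : _ * _ = r * (m%:R / m.+1%:R)); last first.
  have M0 : m.+1%:R != 0 :> R by rewrite pnatr_eq0.
  by move: M0; move: (m.+1%:R : R) (m%:R : R) => M m' M0; field.
by rewrite gtr_pMr// ltr_pdivrMr ?ltr0n// mul1r ltr_nat.
Qed.

(** [O] is the countable union of the balls with rational centre and radius 1/(n + 1) that it
    contains. *)
Lemma enorm_open_measurable (O : set V) (y : T -> V) :
  enorm_open O -> mxmeasurable y -> measurable [set t | O (y t)].
Proof.
move=> oO my.
pose B (qn : {ffun 'I_m -> rat * rat} * nat) : set V :=
  [set x | enorm (x - ratvec qn.1) < qn.2.+1%:R^-1].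
rewrite (_ : [set t | _] =
   \bigcup_(qn in [set qn | B qn `<=` O]) [set t | B qn (y t)]).
  rewrite bigcup_mkcond; apply: countable_bigcupT_measurable => // qn.
  case: ifP => // _; rewrite [X in measurable X](_ : _ =
     setT `&` (fun t => enorm (y t - ratvec qn.1)) @^-1`
              [set` `]-oo, (qn.2.+1%:R^-1 : R)[]).
    apply: measurable_enorm => //.
    by apply: mxmeasurableB => //; exact: mxmeasurable_cst.
  by rewrite setTI; apply/seteqP; split => t /=; rewrite in_itv.
apply/seteqP; split => [t /= Oyt|t [qn /= BO]]; last exact: BO.
have [r r0 rO] := oO _ Oyt.
have [n rn] : exists n : nat, n.+1%:R^-1 < r / 2.
  exists (Num.truncn (r / 2)^-1); rewrite invf_plt ?posrE ?divr_gt0//.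
  exact: truncnS_gt.
have [q yq] := @ratvec_dense (y t) n.+1%:R^-1 ltac:(by rewrite invr_gt0).
exists (q, n) => // z /= zq; apply: rO.
rewrite -[z](subrK (ratvec q)) -addrA (le_lt_trans (ler_enormD _ _))//.
rewrite (enorm_distC (ratvec q)).
by rewrite (splitr r) ltrD// (lt_trans _ rn).
Qed.

End EnormOpen.

Section BorelMatrix.
Variables (R : realType) (m n : nat).

Lemma mxmeasurable_borel : mxmeasurable
  (fun w : borel 'M[R[i]]_(m.+1, n.+1) => (w : 'M[R[i]]_(m.+1, n.+1))).
Proof.
have normc_ball (w w' : 'M[R[i]]_(m.+1, n.+1)) (r : R) i j :
    ball w r%:C w' -> Normc.normc (w i j - w' i j) < r.
  move=> [_ /(_ i j)] h; rewrite -ltcR; exact: h.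
have Re_le (z : R[i]) : complex.Re z <= Normc.normc z.
  case: z => a b /=; rewrite (le_trans (ler_norm _))// -sqrtr_sqr.
  by rewrite ler_wsqrtr// lerDl sqr_ge0.
have Im_le (z : R[i]) : complex.Im z <= Normc.normc z.
  case: z => a b /=; rewrite (le_trans (ler_norm _))// -sqrtr_sqr.
  by rewrite ler_wsqrtr// lerDr sqr_ge0.
move=> i j; split; apply: (measurability _ (RGenOInfty.measurableE R)) => //.
  move=> _ [_ [a ->] <-]; rewrite setTI; apply: sub_sigma_algebra.
  rewrite /= openE => w /=; rewrite in_itv/= andbT => aw.
  apply/nbhs_ballP; exists (complex.Re (w i j) - a)%:C.
    by rewrite /= ltcR subr_gt0.
  move=> w' h; have {h} := normc_ball _ _ _ i j h; rewrite /= in_itv/= andbT.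
  move=> /(le_lt_trans (Re_le _)); case: (w i j); case: (w' i j) => ? ? ? ? /=.
  lra.
move=> _ [_ [a ->] <-]; rewrite setTI; apply: sub_sigma_algebra.
rewrite /= openE => w /=; rewrite in_itv/= andbT => aw.
apply/nbhs_ballP; exists (complex.Im (w i j) - a)%:C.
  by rewrite /= ltcR subr_gt0.
move=> w' h; have {h} := normc_ball _ _ _ i j h; rewrite /= in_itv/= andbT.
move=> /(le_lt_trans (Im_le _)); case: (w i j); case: (w' i j) => ? ? ? ? /=.
lra.
Qed.

End BorelMatrix.

Section ProjectiveContinuity.
Variables (R : realType) (d : nat).
Local Notation V := 'cV[R[i]]_d.+1.
Local Notation M := 'M[R[i]]_d.+1.
Local Notation P := (projective R d.+1).

Lemma class_continuous (phi : P -> R) : continuous phi ->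
  forall x : V, x != 0 -> forall eps : R, 0 < eps -> exists2 r : R, 0 < r &
    forall y, enorm (y - x) < r ->
      y != 0 /\ `|phi (proj_class x) - phi (proj_class y)| < eps.
Proof.
move=> cphi x x0 eps eps0.
have /cvgrPdist_lt/(_ _ eps0)/nbhs_ballP[r /= r0 rP] := cphi (proj_class x).
have ex0 : 0 < enorm x by rewrite enorm_gt0.
(* The first radius keeps [y] nonzero; the second compensates the division by |x| in
   [dist_class]. *)
exists (Num.min (enorm x) (r * enorm x)).
  by rewrite lt_min ex0 mulr_gt0.
move=> y; rewrite lt_min => /andP[h1 h2].
have y0 : y != 0.
  apply: contraTneq h1 => ->.
  by rewrite enorm_distC subr0 ltxx.
split=> //; apply: rP; rewrite ballEmdist /= mdistE.
rewrite (le_lt_trans (dist_class 1 x0 y0))// scale1r enorm_distC.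
by rewrite ltr_pdivrMr.
Qed.

Lemma enorm_open_neq0 : enorm_open [set x : V | x != 0].
Proof.
move=> x /= x0; exists (enorm x); first by rewrite enorm_gt0.
move=> y h; apply: contraTneq h => ->.
by rewrite enorm_distC subr0 ltxx.
Qed.

Lemma enorm_open_class (phi : P -> R) : continuous phi -> forall a : R,
  enorm_open [set x : V | x != 0 /\ a < phi (proj_class x)].
Proof.
move=> cphi a x /= [x0 ax].
have [r r0 rP] := @class_continuous _ cphi x x0 (phi (proj_class x) - a)
  ltac:(by rewrite subr_gt0).
exists r => // y /rP[y0 b]; split=> //.
by move: b; rewrite ltr_norml => /andP[]; lra.
Qed.

Section Measurable.
Context d' (T : measurableType d') (s : R).
Hypothesis s_gt0 : 0 < s.

Lemma measurable_growth (w : T -> M) X : mxmeasurable w ->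
  measurable_fun setT (fun t => growth (w t) X).
Proof.
move=> mw; under eq_fun do rewrite growthE.
by apply: measurable_enorm; apply: mxmeasurableM => //; exact: mxmeasurable_cst.
Qed.

Lemma measurable_weight (phi : P -> R) (w : T -> M) X : continuous phi ->
  mxmeasurable w -> measurable_fun setT (fun t => weight s phi X (w t)).
Proof.
move=> cphi mw; pose y t := w t *m rep X.
have my : mxmeasurable y.
  by apply: mxmeasurableM => //; exact: mxmeasurable_cst.
pose psi t := if y t == 0 then 0 else phi (proj_class (y t)).
rewrite (_ : (fun t => _) = (fun t => psi t * growth (w t) X `^ s)); last first.
  apply/funext => t; rewrite /weight /psi; case: eqVneq => [yt|yt].
    by rewrite growthE -/(y t) yt enorm0 powR0 ?mulr0// gt_eqF.
  by rewrite actE.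
apply: measurable_funM; last first.
  apply: (measurableT_comp (measurable_powR s)).
  exact: measurable_growth.
apply: (measurability _ (RGenOInfty.measurableE R)) => //.
move=> _ [_ [a ->] <-]; rewrite setTI.
have my0 : measurable [set t | y t = 0].
  rewrite (_ : [set t | _] = ~` [set t | y t != 0]).
    by apply: measurableC; exact: (enorm_open_measurable enorm_open_neq0).
  by apply/seteqP; split => t /=;
    [move=> ->; rewrite eqxx|move=> /negP; rewrite negbK => /eqP].
have mo := enorm_open_measurable (enorm_open_class cphi (a := a)) my.
(* On the event y = 0 the value of [psi] is 0, which exceeds [a] exactly when a < 0; only then does
   this event join the superlevel set. *)
have [a0|a0] := ltP a 0.
  rewrite (_ : _ @^-1` _ = [set t | y t = 0] `|`
      [set t | y t != 0 /\ a < phi (proj_class (y t))]).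
    exact: measurableU.
  apply/seteqP; split => t /=; rewrite in_itv/= andbT /psi.
    by case: eqVneq => [|yt]; [left|right].
  by case=> [->|[/negbTE->]//]; rewrite eqxx.
rewrite (_ : _ @^-1` _ = [set t | y t != 0 /\ a < phi (proj_class (y t))])//.
apply/seteqP; split => t /=; rewrite in_itv/= andbT /psi.
  by case: eqVneq => [_|yt]; [rewrite ltNge a0|].
by case=> /negbTE->.
Qed.

End Measurable.

End ProjectiveContinuity.

(** * Boundedness of continuous functions on the projective space *)

Section ProjectiveCompact.
Variables (R : realType) (d : nat).
Local Notation V := 'cV[R[i]]_d.+1.
Local Notation P := (projective R d.+1).
Local Notation U := 'rV[R]_(d.+1 + d.+1).

Definition ctovec (u : U) : V :=
  \col_k (u 0 (lshift d.+1 k) +i* u 0 (rshift d.+1 k)).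

Lemma enorm_ctovec u : enorm (ctovec u) ^+ 2 = \sum_j u 0 j ^+ 2.
Proof.
rewrite enorm_sqrtE sqr_sqrtr; last first.
  by apply: sumr_ge0 => i _; rewrite addr_ge0// sqr_ge0.
by rewrite big_split_ord/= -big_split/=; apply: eq_bigr => i _; rewrite mxE.
Qed.

Lemma ctovecB u u' : ctovec (u - u') = ctovec u - ctovec u'.
Proof. by apply/colP => k; rewrite !mxE. Qed.

Lemma ctovec_surj x : exists u, ctovec u = x.
Proof.
exists (row_mx (\row_k complex.Re (x k 0)) (\row_k complex.Im (x k 0))).
apply/colP => k; rewrite mxE row_mxEl row_mxEr !mxE.
by case: (x k 0).
Qed.

Let N : R := (d.+1 + d.+1)%:R.

Let sum_sqr_le (I : Type) (r : seq I) (F : I -> R) :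
  \sum_(k <- r) F k ^+ 2 <= (\sum_(k <- r) `|F k|) ^+ 2.
Proof.
elim: r => [|k r IH]; first by rewrite !big_nil expr0n.
rewrite !big_cons sqrrD real_normK ?num_real// -addrA lerD2l (le_trans IH)//.
by rewrite lerDr mulrn_wge0// mulr_ge0// sumr_ge0.
Qed.

Lemma enorm_ctovec_le (u : U) (r : R) : (forall j, `|u 0 j| <= r) ->
  enorm (ctovec u) <= N * r.
Proof.
move=> ur; have r0 : 0 <= r by rewrite (le_trans _ (ur ord0)).
rewrite -(@ler_pXn2r _ 2)// ?nnegrE ?enorm_ge0 ?mulr_ge0 ?ler0n//.
rewrite enorm_ctovec (le_trans (sum_sqr_le _ _))//.
rewrite ler_pXn2r ?nnegrE ?sumr_ge0 ?mulr_ge0 ?ler0n//.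
by rewrite (le_trans (ler_sum _ (fun j _ => ur j)))// sumr_const card_ord mulr_natl.
Qed.

Lemma ctovec_near (u : U) (r : R) : 0 < r ->
  \forall u' \near u, enorm (ctovec u' - ctovec u) < r.
Proof.
move=> r0; have N0 : 0 < N + 1 by rewrite addr_gt0// ltr0n.
apply/nbhs_ballP; exists (r / (N + 1)) => /=; first by rewrite divr_gt0.
move=> u' [_ uu']; rewrite -ctovecB.
apply: (@le_lt_trans _ _ (N * (r / (N + 1)))).
  apply: enorm_ctovec_le => j; rewrite !mxE distrC ltW//; exact: uu'.
by rewrite mulrCA gtr_pMr// ltr_pdivrMr// mul1r ltrDl.
Qed.

(** The unit sphere, read in real coordinates where closed bounded sets are compact, maps onto the
    projective space; boundedness of the composite function is all the compactness that is used. *)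
Lemma projective_bounded (phi : P -> R) : continuous phi ->
  exists B : R, forall X, `|phi X| <= B.
Proof.
move=> cphi; pose K : set U := [set u | enorm (ctovec u) = 1].
have cK : compact K.
  apply: bounded_closed_compact.
    exists 1; split => // M M1 u /= uK; rewrite (le_trans _ (ltW M1))//.
    rewrite [leLHS]mx_normrE; apply: bigmax_le => // -[i j] _ /=; rewrite ord1.
    have : u 0 j ^+ 2 <= 1.
      move: (enorm_ctovec u); rewrite uK expr1n => ->.
      by rewrite (bigD1 j)//= lerDl sumr_ge0// => k _; exact: sqr_ge0.
    by rewrite -real_normK ?num_real// expr_le1.
  rewrite (_ : K = (fun u => enorm (ctovec u)) @^-1` [set 1])//.
  apply: preimage_closed; last exact: closed_eq.
  move=> u _; apply/(@cvgrPdist_lt _ _ _ (nbhs u) (nbhs_filter u)) => eps eps0.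
  apply: filterS (ctovec_near u eps0) => u' uu'.
  rewrite (@le_lt_trans _ _ (enorm (ctovec u' - ctovec u)))//.
  rewrite ler_norml; apply/andP; split.
    rewrite lerNl opprB lerBlDr -[X in enorm X <= _](subrK (ctovec u)).
    exact: ler_enormD.
  rewrite lerBlDr -[X in enorm X <= _](subrK (ctovec u')) enorm_distC.
  exact: ler_enormD.
have K0 u : K u -> ctovec u != 0.
  by move=> uK; rewrite -enorm_eq0 uK oner_eq0.
have cf : {within K, continuous (fun u => phi (proj_class (ctovec u)))}.
  apply: continuous_in_subspaceT => u /set_mem uK.
  apply/(@cvgrPdist_lt _ _ _ (nbhs u) (nbhs_filter u)) => eps eps0.
  have [r r0 rP] := class_continuous cphi (K0 _ uK) eps0.
  by apply: filterS (ctovec_near u r0) => u' uu'; exact: (rP _ uu').2.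
have /compact_bounded[M [_ MP]] := continuous_compact cf cK.
exists (M + 1) => X; apply: (MP (M + 1)); first by rewrite ltrDl.
have [u uE] := ctovec_surj (rep X).
exists u; last by rewrite uE class_rep.
by rewrite /K /= uE enorm_rep.
Qed.

End ProjectiveCompact.

(** * The sequence space and the path measures *)

Section OmegaMeasurable.
Variables (R : realType) (A : polishType R).
Local Notation Om := (Omega A).

Lemma measurable_coord i :
  measurable_fun setT (fun w : Om => (w i : borel A)).
Proof.
move=> _ B mB; rewrite setTI; apply: sub_sigma_algebra.
by exists i, B.
Qed.

Lemma measurable_Omega d (T : measurableType d) (f : T -> Om) :
  (forall i, measurable_fun setT (fun t => (f t i : borel A))) ->
  measurable_fun setT f.
Proof.
move=> mf; apply: (@measurability _ _ T (Omega A) setT f (@cylinders R A)) => //.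
by move=> _ [_ [i [B [mB ->]]] <-]; exact: mf.
Qed.

Definition ocons (x : borel A * Om) : Om :=
  fun i => if i is j.+1 then x.2 j else x.1.

Definition trunc n (w : Om) : Om := fun i => if (i < n)%N then w i else point.

Lemma measurable_ocons : measurable_fun setT ocons.
Proof.
apply: measurable_Omega => -[|i] /=; first exact: measurable_fst.
exact: (measurableT_comp (measurable_coord i) measurable_snd).
Qed.

Lemma measurable_shift : measurable_fun setT (@left_shift R A : Om -> Om).
Proof. by apply: measurable_Omega => i; exact: measurable_coord. Qed.

Lemma measurable_iter_shift n :
  measurable_fun setT (iter n (@left_shift R A) : Om -> Om).
Proof.
elim: n => [|n IH]; first exact: measurable_id.
exact: (measurableT_comp measurable_shift IH).
Qed.

Lemma measurable_trunc n : measurable_fun setT (trunc n).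
Proof.
apply: measurable_Omega => i; rewrite /trunc; case: (i < n)%N.
  exact: measurable_coord.
exact: measurable_cst.
Qed.

Lemma measurable_ocons_cst a : measurable_fun setT (fun w : Om => ocons (a, w)).
Proof.
apply: measurable_Omega => -[|i] /=; first exact: measurable_cst.
exact: measurable_coord.
Qed.

Lemma measurable_first_coords n : measurable_fun setT (@first_coords R A n).
Proof.
apply/measurable_fun_tnthP => i /=.
rewrite (_ : _ \o _ = (fun w : Om => (w i : borel A))).
  exact: measurable_coord.
by apply/funext => w /=; rewrite tnth_mktuple.
Qed.

Lemma iter_shiftE n (w : Om) i : iter n (@left_shift R A) w i = w (n + i)%N.
Proof. by elim: n i => [//|n IH] i; rewrite iterS /left_shift IH addnS. Qed.

Lemma shift_ocons a w : left_shift (ocons (a, w)) = w.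
Proof. by []. Qed.

Lemma ocons_shift w : ocons (w 0, left_shift w) = w.
Proof. by apply/funext => -[]. Qed.

Lemma first_coords_ocons n a w :
  first_coords n.+1 (ocons (a, w)) = [tuple of a :: first_coords n w].
Proof.
apply: eq_from_tnth => i; rewrite tnth_mktuple.
case: i => -[|i] /= ilt; first by rewrite (tnth_nth a).
have ilt' : (i < n)%N by [].
by rewrite (tnth_nth a)/= (nth_map (Ordinal ilt')) ?size_enum_ord// nth_enum_ord.
Qed.

End OmegaMeasurable.

Section PathMeasure.
Variables (R : realType) (A : polishType R).
Local Notation Om := (Omega A).
Variable nu : {sigma_finite_measure set (borel A) -> \bar R}.
Local Open Scope ereal_scope.

Section Step.
Variable M : {sigma_finite_measure set Om -> \bar R}.

Definition path_step : set Om -> \bar R := pushforward (nu \x M) (@ocons R A).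

Let path_step0 : path_step set0 = 0.
Proof. by rewrite /path_step /pushforward preimage_set0 measure0. Qed.

Let path_step_ge0 B : 0 <= path_step B.
Proof. by rewrite /path_step /pushforward measure_ge0. Qed.

Let mpre B : measurable B -> measurable (@ocons R A @^-1` B).
Proof. by move=> mB; rewrite -[X in measurable X]setTI; exact: measurable_ocons. Qed.

Let path_step_sigma_additive : semi_sigma_additive path_step.
Proof.
move=> F mF tF mUF; rewrite /path_step /pushforward preimage_bigcup.
apply: measure_semi_sigma_additive.
- by move=> n; exact: mpre.
- apply/trivIsetP => /= i j _ _ ij; rewrite -preimage_setI.
  by move/trivIsetP : tF => /(_ _ _ _ _ ij) ->//; rewrite preimage_set0.
- by rewrite -preimage_bigcup; exact: mpre.
Qed.

HB.instance Definition _ := isMeasure.Build _ _ _ path_step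
  path_step0 path_step_ge0 path_step_sigma_additive.

Let path_step_sigma_finite : sigma_finite setT path_step.
Proof.
have /sigma_finiteP[F [FT ndF Foo]] := sigma_finiteT nu.
have /sigma_finiteP[G [GT ndG Goo]] := sigma_finiteT M.
(* [g] inverts [ocons], so pulling back rectangles along [g] exhausts the sequences by sets whose
   measure is a product of finite measures. *)
pose g (w : Om) : borel A * Om := (w 0%N, left_shift w).
have mg : measurable_fun setT g.
  apply: measurable_fun_pair; first exact: measurable_coord.
  exact: measurable_shift.
exists (fun n => g @^-1` (F n `*` G n)).
  rewrite -preimage_bigcup -[LHS](@preimage_setT _ _ g); congr (g @^-1` _).
  apply/seteqP; split=> // -[a w] _.
  have [n _ Fa] : (\bigcup_n F n) a by rewrite -FT.
  have [k _ Gw] : (\bigcup_n G n) w by rewrite -GT.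
  exists (maxn n k) => //; split => /=.
    by move: Fa; apply: subsetPset; exact/ndF/leq_maxl.
  by move: Gw; apply: subsetPset; exact/ndG/leq_maxr.
move=> n; have [mFn Fnoo] := Foo n; have [mGn Gnoo] := Goo n; split.
  by rewrite -[X in measurable X]setTI; apply: mg => //; exact: measurableX.
rewrite /path_step /pushforward -comp_preimage (_ : g \o _ = id); last first.
  by apply/funext => -[a w].
by rewrite preimage_id product_measure1E// lte_mul_pinfty// ge0_fin_numE.
Qed.

HB.instance Definition _ :=
  Measure_isSigmaFinite.Build _ _ _ path_step path_step_sigma_finite.

Lemma ge0_integral_path_step (F : Om -> \bar R) :
  measurable_fun setT F -> (forall w, 0 <= F w) ->
  \int[path_step]_w F w = \int[nu]_a \int[M]_w F (ocons (a, w)).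
Proof.
move=> mF F0; rewrite /path_step ge0_integral_pushforward//.
- rewrite preimage_setT fubini_tonelli1//.
    exact: (measurableT_comp mF (@measurable_ocons _ _)).
  by move=> x; exact: F0.
- exact: measurable_ocons.
Qed.

Lemma measurable_int_ocons (F : Om -> \bar R) :
  measurable_fun setT F -> (forall w, 0 <= F w) ->
  measurable_fun setT (fun a => \int[M]_w F (ocons (a, w))).
Proof.
move=> mF F0.
apply: (@measurable_fun_fubini_tonelli_F _ _ _ _ _ M (F \o @ocons R A)) => //.
  exact: (measurableT_comp mF (@measurable_ocons _ _)).
by move=> x; exact: F0.
Qed.

Lemma integral_path_step (F : Om -> \bar R) :
  path_step.-integrable setT F ->
  \int[path_step]_w F w = \int[nu]_a \int[M]_w F (ocons (a, w)).
Proof.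
move=> iF; rewrite /path_step.
have mF : measurable_fun setT F := measurable_int _ iF.
have iFo : (nu \x M).-integrable setT (F \o @ocons R A).
  apply/integrableP; split; first exact: (measurableT_comp mF (@measurable_ocons _ _)).
  have /integrableP[_] := iF; rewrite /path_step ge0_integral_pushforward//.
  + exact: measurable_ocons.
  + exact: measurableT_comp.
rewrite integral_pushforward//; last exact: measurable_ocons.
by rewrite preimage_setT -integral12_prod_meas1.
Qed.

End Step.

(** The n-fold product of [nu] on the first n coordinates, all later ones being frozen at [point].
    Living on one space for every n, it integrates functions of sequences directly and satisfies a
    one-letter recursion. *)
Fixpoint paths n : {sigma_finite_measure set Om -> \bar R} :=
  if n is n'.+1 then path_step (paths n') else \d_(point : Om).

End PathMeasure.

Section ProductIntegral.
Variables (R : realType) (d : nat) (A : polishType R).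
Local Notation Om := (Omega A).
Local Notation M := 'M[R[i]]_d.+1.
Variable v : borel A -> borel M.
Hypothesis mv : measurable_fun setT v.

Lemma mxmeasurable_v : mxmeasurable (fun a => (v a : M)).
Proof.
by move=> i j; have [h1 h2] := @mxmeasurable_borel R d d i j;
  split; [exact: (measurableT_comp h1 mv)|exact: (measurableT_comp h2 mv)].
Qed.

(** The same product v_{a_n} ... v_{a_1} as [cocycle], but peeling off the first letter, as
    [path_step] does; [cocycle_first_coords] identifies the two. *)
Fixpoint prodmx n (w : Om) : M :=
  if n is n'.+1 then prodmx n' (left_shift w) *m (v (w 0%N) : M) else 1%:M.

Lemma mxmeasurable_comp d1 d2 (T1 : measurableType d1) (T2 : measurableType d2)
    m n (w : T2 -> 'M[R[i]]_(m, n)) (f : T1 -> T2) :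
  mxmeasurable w -> measurable_fun setT f -> mxmeasurable (w \o f).
Proof.
by move=> mw mf i j; have [h1 h2] := mw i j;
  split; [exact: (measurableT_comp h1 mf)|exact: (measurableT_comp h2 mf)].
Qed.

Lemma mxmeasurable_prodmx n : mxmeasurable (prodmx n).
Proof.
elim: n => [|n IH] /=; first exact: mxmeasurable_cst.
apply: mxmeasurableM; first exact: (mxmeasurable_comp IH (@measurable_shift _ _)).
exact: (mxmeasurable_comp mxmeasurable_v (@measurable_coord _ _ 0%N)).
Qed.

Lemma cocycle_rec (t : seq A) (w : M) :
  foldl (fun w a => (v a : M) *m w) w t = cocycle v t *m w.
Proof.
rewrite /cocycle; elim: t w => [|a t IH] w /=; first by rewrite mul1mx.
by rewrite IH [in RHS]IH mulmx1 mulmxA.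
Qed.

Lemma cocycle_cons a (t : seq A) : cocycle v (a :: t) = cocycle v t *m v a.
Proof. by rewrite {1}/cocycle /= cocycle_rec mulmx1. Qed.

Lemma cocycle_first_coords n (w : Om) :
  cocycle v (first_coords n w) = prodmx n w.
Proof.
elim: n w => [|n IH] w.
  by rewrite /cocycle [X in foldl _ _ X](_ : _ = [::])//;
    exact: (congr1 val (tuple0 _)).
rewrite -[in LHS](ocons_shift w) first_coords_ocons.
by rewrite [LHS]cocycle_cons IH.
Qed.

Variables (mu : {measure set (borel A) -> \bar R}).
Variable nu : {sigma_finite_measure set (borel A) -> \bar R}.
Local Open Scope ereal_scope.

(** Allows [mu] to be exchanged for a sigma-finite [nu] under every integrand that vanishes where
    [v] does. *)
Definition restr_nonzero := forall G : borel A -> \bar R,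
  measurable_fun setT G -> (forall a, 0 <= G a) ->
  (forall a, (v a : M) = 0%R -> G a = 0) -> \int[mu]_a G a = \int[nu]_a G a.

Hypothesis nuE : restr_nonzero.

(** If [v] vanishes at one letter then so does F, hence each successive integrand vanishes where [v]
    does and [mu] can be exchanged for [nu] one variable at a time. *)
Lemma product_integralE n (F : n.-tuple (borel A) -> \bar R) :
  measurable_fun setT F -> (forall t, 0 <= F t) ->
  (forall t : n.-tuple (borel A), (exists2 a, a \in (t : seq A) & (v a : M) = 0%R) ->
     F t = 0) ->
  product_integral mu F = \int[paths nu n]_w F (first_coords n w).
Proof.
elim: n F => [|n IH] F mF F0 Fv.
  rewrite /= integral_dirac//.
    by rewrite diracT mul1e; congr F; exact/esym/tuple0.
  exact: (measurableT_comp mF (@measurable_first_coords _ _ _)).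
have mFa a : measurable_fun setT (fun t : n.-tuple (borel A) =>
    F [tuple of a :: t]).
  apply: (measurableT_comp mF); apply: measurable_cons => //.
have mFo : measurable_fun setT (fun w : Om => F (first_coords n.+1 w)).
  exact: (measurableT_comp mF (@measurable_first_coords _ _ _)).
rewrite /= ge0_integral_path_step//.
transitivity (\int[mu]_a \int[paths nu n]_w F (first_coords n.+1 (ocons (a, w)))).
  apply: eq_integral => a _; rewrite IH//.
    by apply: eq_integral => w _; rewrite first_coords_ocons.
  move=> t [b bt vb]; apply: Fv; exists b => //.
  by rewrite in_cons bt orbT.
apply: nuE.
- exact: (@measurable_int_ocons _ _ (paths nu n) (fun w => F (first_coords n.+1 w))).
- by move=> a; apply: integral_ge0.
- move=> a va; apply: integral0_eq => w _; rewrite first_coords_ocons.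
  by apply: Fv; exists a => //; rewrite in_cons eqxx.
Qed.

End ProductIntegral.

Section BasisVectors.
Variables (R : realType) (d : nat).
Local Notation M := 'M[R[i]]_d.+1.

Definition basis_pt (i : 'I_d.+1) : projective R d.+1 :=
  proj_class (delta_mx i 0).

Lemma growth_basis (w : M) i : growth w (basis_pt i) = enorm (col i w).
Proof.
have d0 : delta_mx i 0 != 0 :> 'cV[R[i]]_d.+1.
  by apply/eqP => /matrixP/(_ i 0)/eqP; rewrite !mxE !eqxx oner_eq0.
have [c nc cE] := rep_class d0.
rewrite growthE /basis_pt cE -scalemxAr enormZ nc -colE.
suff -> : enorm (delta_mx i 0 : 'cV[R[i]]_d.+1) = 1 by rewrite invr1 mul1r.
rewrite enorm_sqrtE (bigD1 i)//= big1 => [|j ji]; last first.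
  by rewrite !mxE (negbTE ji) /= expr0n addr0.
by rewrite !mxE !eqxx /= expr1n expr0n !addr0 sqrtr1.
Qed.

(** The norm is at most d + 1 times its largest column. Using the maximum rather than convexity
    treats s below and above 1 alike. *)
Lemma mxnorm_powR_le (s : R) (w : M) : 0 < s ->
  mxnorm w `^ s <= (d.+1%:R) `^ s * \sum_i growth w (basis_pt i) `^ s.
Proof.
move=> s0; pose i0 := [arg max_(i > ord0) growth w (basis_pt i)]%O.
have i0P j : growth w (basis_pt j) <= growth w (basis_pt i0).
  by rewrite /i0; case: Order.TotalTheory.arg_maxP => // i _; apply.
have le1 : mxnorm w <= d.+1%:R * growth w (basis_pt i0).
  rewrite mxnormE (@le_trans _ _ (\sum_(i < d.+1) growth w (basis_pt i0)))//.
    by apply: ler_sum => i _; rewrite -growth_basis.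
  by rewrite sumr_const card_ord mulr_natl.
rewrite (le_trans (ler_powR2 (ltW s0) (mxnorm_ge0 w) le1))//.
rewrite powRM ?growth_ge0// ler_wpM2l ?powR_ge0//.
by rewrite (bigD1 i0)//= lerDl sumr_ge0// => j _; exact: powR_ge0.
Qed.

End BasisVectors.

(** [nu] is [mu] restricted to {W > 0}, where [W] sums the s-th powers of the column norms: [W] is
    positive wherever [v] is nonzero, and its integral is finite. *)
Lemma exists_restr_nonzero (R : realType) (d : nat) (A : polishType R)
    (v : borel A -> borel 'M[R[i]]_d.+1) (mv : measurable_fun setT v)
    (mu : {measure set (borel A) -> \bar R}) (s : R) : 0 < s ->
  (forall X, (\int[mu]_a (growth (v a) X `^ s)%:E < +oo)%E) ->
  exists nu : {sigma_finite_measure set (borel A) -> \bar R},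
    restr_nonzero v mu nu.
Proof.
move=> s0 fin.
have mvx := mxmeasurable_v mv.
have mg X : measurable_fun setT (fun a => growth (v a) X `^ s).
  apply: (measurableT_comp (measurable_powR s)).
  exact: measurable_growth.
pose W a := \sum_(i < d.+1) growth (v a) (basis_pt R i) `^ s.
have mW : measurable_fun setT W by apply: measurable_sum.
have W0 a : 0 <= W a by apply: sumr_ge0 => i _; exact: powR_ge0.
have Wpos a : (v a : 'M[R[i]]_d.+1) <> 0 -> 0 < W a.
  move=> va; rewrite lt_def W0 andbT; apply: contra_notN va.
  rewrite psumr_eq0 => [/allP h|i _]; last exact: powR_ge0.
  apply/matrixP => k l; have := h l (mem_index_enum _).
  rewrite powR_eq0 growth_basis enorm_eq0 => /andP[/eqP/colP/(_ k)].
  by rewrite !mxE.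
pose D := [set a | 0 < W a].
have mWge (r : R) : measurable [set a | r <= W a].
  rewrite (_ : [set a | _] = setT `&` W @^-1` `[r, +oo[).
    exact: mW.
  by rewrite setTI; apply/seteqP; split => a /=; rewrite in_itv/= andbT.
have mD : measurable D.
  rewrite (_ : D = setT `&` W @^-1` `]0, +oo[).
    exact: mW.
  by rewrite setTI; apply/seteqP; split => a /=; rewrite in_itv/= andbT.
have intW : (\int[mu]_a (W a)%:E < +oo)%E.
  under eq_integral do rewrite -sumEFin.
  rewrite ge0_integral_sum//.
  - by apply: lte_sum_pinfty => i _; exact: fin.
  - by move=> i; exact/measurable_EFinP.
  - by move=> i a _; rewrite lee_fin powR_ge0.
(* Markov's inequality for W, on the sets where W >= 1/(k+1). *)
have sf : sigma_finite setT (mrestr mu mD).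
  exists (fun k => [set a | k.+1%:R^-1 <= W a] `|` ~` D).
    apply/seteqP; split=> // a _; have [Da|nDa] := pselect (D a); last first.
      by exists 0%N => //; right.
    exists (Num.truncn (W a)^-1) => //; left => /=.
    by rewrite invf_ple ?posrE// ltW// truncnS_gt.
  move=> k; split; first by apply: measurableU => //; exact: measurableC.
  rewrite /mrestr setIUl setICl setU0.
  apply: (@le_lt_trans _ _ (mu [set a | k.+1%:R^-1 <= W a])).
    by apply: le_measure; rewrite ?inE//; exact: measurableI.
  apply: (@le_lt_trans _ _ (\int[mu]_a (k.+1%:R%:E * (W a)%:E))%E).
    rewrite -[X in mu X]setIT -integral_indic//.
    apply: ge0_le_integral => //.
    - exact/measurable_EFinP/measurable_indic.
    - apply/measurable_EFinP; exact: measurable_funM.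
    - move=> a _; rewrite -EFinM lee_fin indicE.
      case: (boolP (a \in _)) => [|_]; last by rewrite mulr_ge0.
      by rewrite inE /= => ha; rewrite -ler_pdivrMl// mulr1.
  rewrite ge0_integralZl//; first by rewrite lte_mul_pinfty.
    exact/measurable_EFinP.
  by move=> a _; rewrite lee_fin.
pose nu0 := mrestr mu mD.
pose nu1 := Measure_isSigmaFinite.Build _ _ _ nu0 sf.
pose nu : {sigma_finite_measure set (borel A) -> \bar R} := HB.pack nu0 nu1.
exists nu => G mG G0 Gv.
rewrite ge0_integral_mrestr//; apply: eq_integral => a _.
rewrite indicE; have [//|] := boolP (a \in D); first by rewrite mul1e.
rewrite notin_setE => Da; rewrite mul0e; apply: Gv.
by apply: contrapT => /Wpos.
Qed.

(** * Lipschitz functions of sequences *)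

Section LipschitzOmega.
Variables (R : realType) (A : polishType R).
Local Notation Om := (Omega A).
Implicit Types (a b w : Om) (f : Om -> R).

Definition dist_terms a b : nat -> R :=
  fun k => 2%:R ^- k.+1 * Num.min (mdist (a k) (b k)) 1.

Let half_gt0 k : 0 < 2%:R ^- k :> R.
Proof. by rewrite invr_gt0 exprn_gt0. Qed.

Let halfS k : 2%:R ^- k = 2%:R ^- k.+1 + 2%:R ^- k.+1 :> R.
Proof. by rewrite exprS; field; rewrite expf_neq0. Qed.

Lemma dist_terms_ge0 a b k : 0 <= dist_terms a b k.
Proof.
by rewrite mulr_ge0 ?(ltW (half_gt0 _))// le_min mdist_ge0 ler01.
Qed.

Lemma dist_series_le a b n (r : R) N : 0 <= r ->
  (forall i, (i < n)%N -> mdist (a i) (b i) <= r) ->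
  series (dist_terms a b) N <= r + 2%:R ^- n.
Proof.
move=> r0 abr.
(* The induction carries the exact geometric sums: the first n terms are at most r 2^-(k+1), the
   others at most 2^-(k+1). *)
suff : series (dist_terms a b) N <= r * (1 - 2%:R ^- N) +
    (if (N <= n)%N then 0 else 2%:R ^- n - 2%:R ^- N).
  move=> /le_trans; apply; rewrite lerD//.
    by rewrite ler_piMr// gerBl ltW.
  by case: ifP => _; rewrite ?(ltW (half_gt0 _))// gerBl ltW.
elim: N => [|N IH].
  by rewrite /series /= big_nil expr0 invr1 subrr mulr0 addr0.
rewrite /series /= big_nat_recr//=.
have h0 := ltW (half_gt0 N.+1); have hS := halfS N.
have rh : 0 <= r * 2%:R ^- N.+1 by rewrite mulr_ge0.
have tl : dist_terms a b N <= 2%:R ^- N.+1.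
  by rewrite ler_piMr// ge_min lexx orbT.
have rE : r * (1 - 2%:R ^- N.+1) = r * (1 - 2%:R ^- N) + r * 2%:R ^- N.+1.
  by rewrite hS; ring.
rewrite rE; move: IH; rewrite /series /=.
case: (ltngtP N n) => [Nn|nN|Nn].
- have tr : dist_terms a b N <= r * 2%:R ^- N.+1.
    by rewrite /dist_terms mulrC ler_wpM2r ?(ltW (half_gt0 _))// ge_min abr.
  by lra.
- by lra.
- by subst n; lra.
Qed.

Lemma dist_series_nd a b : nondecreasing_seq (series (dist_terms a b)).
Proof. by apply: nondecreasing_series => n _ _; exact: dist_terms_ge0. Qed.

Lemma dist_series_cvg a b : cvgn (series (dist_terms a b)).
Proof.
apply: nondecreasing_is_cvgn; first exact: dist_series_nd.
exists (0 + 2%:R ^- 0) => _ [N _ <-].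
exact: (@dist_series_le a b 0 0).
Qed.

Lemma dist_Omega_le a b n (r : R) : 0 <= r ->
  (forall i, (i < n)%N -> mdist (a i) (b i) <= r) ->
  dist_Omega a b <= r + 2%:R ^- n.
Proof.
move=> r0 abr; apply: limr_le; first exact: dist_series_cvg.
by apply: nearW => N; exact: dist_series_le.
Qed.

Lemma dist_Omega_trunc a n : dist_Omega a (trunc n a) <= 2%:R ^- n.
Proof.
rewrite -[leRHS]add0r; apply: dist_Omega_le => // i ilt.
by rewrite /trunc ilt mdistxx.
Qed.

Lemma dist_terms_le a b k : dist_terms a b k <= dist_Omega a b.
Proof.
apply: (@le_trans _ _ (series (dist_terms a b) k.+1)).
  rewrite /series /= big_nat_recr//= lerDr.
  by apply: sumr_ge0 => i _; exact: dist_terms_ge0.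
exact: (nondecreasing_cvgn_le (@dist_series_nd a b) (@dist_series_cvg a b)).
Qed.

Lemma dist_Omega_ge0 a b : 0 <= dist_Omega a b.
Proof. exact: le_trans (dist_terms_ge0 a b 0) (dist_terms_le a b 0). Qed.

Lemma dist_Omega_eq0 a b : dist_Omega a b = 0 -> a = b.
Proof.
move=> ab0; apply/funext => k; apply: mdist_positivity; apply/eqP.
rewrite eq_le mdist_ge0 andbT.
have := dist_terms_le a b k; rewrite ab0 /dist_terms pmulr_rle0//.
by rewrite ge_min => /orP[//|]; rewrite ler10.
Qed.

(** A single real L serves both as supremum bound and as Lipschitz constant. At distance 0 the
    quotient in [lip_norm] is 0 by convention and says nothing, so there the Lipschitz bound comes
    from separation of points. *)
Lemma lip_norm_bounds f : Lip_b f -> exists L : R,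
  [/\ lip_norm f = L%:E, 0 <= L, forall w, `|f w| <= L &
      forall a b, `|f a - f b| <= L * dist_Omega a b].
Proof.
rewrite /Lip_b /= /lip_norm; set S1 := ereal_sup _; set S2 := ereal_sup _.
have f1 w : ((`|f w|)%:E <= S1)%E by apply: ereal_sup_ubound; exists w.
have f2 a b : ((`|f a - f b| / dist_Omega a b)%:E <= S2)%E.
  by apply: ereal_sup_ubound; exists (a, b).
have S10 : (0 <= S1)%E by apply: le_trans (f1 point); rewrite lee_fin.
have S20 : (0 <= S2)%E.
  by apply: le_trans (f2 point point); rewrite subrr normr0 mul0r.
move=> Soo.
have S1f : S1 \is a fin_num.
  by rewrite ge0_fin_numE// (le_lt_trans _ Soo)// leeDl.
have S2f : S2 \is a fin_num.
  by rewrite ge0_fin_numE// (le_lt_trans _ Soo)// leeDr.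
exists (fine S1 + fine S2).
have F1 : 0 <= fine S1 by rewrite fine_ge0.
have F2 : 0 <= fine S2 by rewrite fine_ge0.
split; first by rewrite EFinD !fineK.
- by rewrite addr_ge0.
- move=> w; apply: (@le_trans _ _ (fine S1)); last by rewrite lerDl.
  by rewrite -lee_fin fineK.
- move=> a b; have [d0|d0] := eqVneq (dist_Omega a b) 0.
    by rewrite (dist_Omega_eq0 d0) subrr normr0 mulr_ge0 ?dist_Omega_ge0 ?addr_ge0.
  have dp : 0 < dist_Omega a b by rewrite lt_def d0 dist_Omega_ge0.
  rewrite -ler_pdivrMr// (@le_trans _ _ (fine S2))//; last by rewrite lerDr.
  by rewrite -lee_fin fineK.
Qed.

Lemma measurable_mdist (b : A) :
  measurable_fun setT (fun x : borel A => mdist (x : A) b).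
Proof.
apply: (measurability _ (RGenInftyO.measurableE R)) => //.
move=> _ [_ [r ->] <-]; rewrite setTI; apply: sub_sigma_algebra.
rewrite /= openE => x /=; rewrite in_itv/= => xr.
apply/nbhs_ballP; exists (r - mdist x b) => /=; first by rewrite subr_gt0.
move=> y; rewrite ballEmdist /= in_itv/= => xy.
have := metric_triangle y x b; rewrite (metric_sym y x); lra.
Qed.

Lemma measurable_dist_Omega b : measurable_fun setT (fun a => dist_Omega a b).
Proof.
apply: (measurable_fun_cvg (h := fun n a => series (dist_terms a b) n)).
  move=> n; apply: measurable_sum => k; apply: measurable_funM => //.
  apply: measurable_minr => //.
  exact: (measurableT_comp (measurable_mdist (b k)) (@measurable_coord _ _ k)).
by move=> a _; exact: dist_series_cvg.
Qed.

Lemma exists_dense_seq : exists dd : nat -> A,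
  forall (x : A) (r : R), 0 < r -> exists k, mdist x (dd k) < r.
Proof.
have [D /countable_injP[g ginj] Dd] := @separable R A.
exists (fun k => xget point [set x | D x /\ g x = k]) => x r r0.
have ne : (ball x r)° !=set0 by exists x; exact: nbhsx_ballx.
have [y [xy Dy]] := Dd _ ne (@open_interior _ _).
exists (g y); move: (interior_subset xy); rewrite ballEmdist /=.
case: xgetP => [z _ [Dz gz]|/(_ y)[]//].
by rewrite (ginj z y _ _ gz)// inE.
Qed.

(** The sigma-algebra on sequences is the product one, so continuity does not give measurability at
    once. McShane's formula over a countable dense family does, because the distance to a fixed
    sequence is product measurable. *)
Lemma measurable_lipschitz f (L : R) : 0 <= L ->
  (forall a b, `|f a - f b| <= L * dist_Omega a b) -> measurable_fun setT f.
Proof.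
move=> L0 fL; have [dd ddP] := exists_dense_seq.
pose pt (l : seq nat) : Om := fun i => if (i < size l)%N then dd (nth 0%N l i) else point.
have pt_dense a (eps : R) : 0 < eps -> exists l, dist_Omega a (pt l) < eps.
  move=> eps0.
  have [n neps] : exists n, 2%:R ^- n < eps / 2.
    exists (Num.truncn (eps / 2)^-1).
    rewrite invf_plt ?posrE ?divr_gt0 ?exprn_gt0//.
    by rewrite (lt_le_trans (truncnS_gt _))// -natrX ler_nat ltn_expl.
  have /choice[k kP] (i : nat) : exists k, mdist (a i) (dd k) < eps / 2.
    by apply: ddP; rewrite divr_gt0.
  exists (mkseq k n).
  apply: (@le_lt_trans _ _ (eps / 2 + 2%:R ^- n)).
    apply: dist_Omega_le => [|i ilt]; first by rewrite divr_ge0// ltW.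
    by rewrite /pt size_mkseq ilt nth_mkseq// ltW.
  by move: neps; lra.
apply: (measurability _ (RGenInftyO.measurableE R)) => //.
move=> _ [_ [r ->] <-]; rewrite setTI.
(* f a is the infimum over l of f (pt l) + L * dist_Omega a (pt l). *)
rewrite (_ : _ @^-1` _ =
  \bigcup_l [set a | f (pt l) + L * dist_Omega a (pt l) < r]).
  apply: countable_bigcupT_measurable => // l.
  rewrite (_ : [set a | _] = setT `&`
     (fun a => f (pt l) + L * dist_Omega a (pt l)) @^-1` `]-oo, r[).
    apply: measurable_funD => //; apply: measurable_funM => //.
    exact: measurable_dist_Omega.
  by rewrite setTI; apply/seteqP; split => a /=; rewrite in_itv.
apply/seteqP; split => a /=; rewrite in_itv/=.
  (* At a point within eps of [a], the tested quantity is at most f a + 2 L eps; the extra 1 in the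
     denominator makes this strictly less than r and covers L = 0. *)
  move=> far; pose eps := (r - f a) / (2 * L + 1).
  have L1 : 0 < 2 * L + 1 by lra.
  have eps0 : 0 < eps by rewrite divr_gt0// subr_gt0.
  have [l al] := pt_dense a eps eps0; exists l => //=.
  have := fL a (pt l); rewrite ler_norml => /andP[h _].
  have h2 : 2 * (L * dist_Omega a (pt l)) <= 2 * (L * eps).
    by rewrite ler_pM2l// ler_wpM2l// ltW.
  have h3 : eps * (2 * L + 1) = r - f a by rewrite /eps divfK// gt_eqF.
  by move: h h2 h3 eps0; nra.
move=> [l _ /= h]; have := fL a (pt l); rewrite ler_norml => /andP[_].
by lra.
Qed.

End LipschitzOmega.

Section FirstCoords.
Variables (R : realType) (A : polishType R).

HB.instance Definition _ n := isMeasurableFun.Build _ _ _ _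
  (@first_coords R A n) (@measurable_first_coords R A n).

Definition extend n (t : n.-tuple (borel A)) : Omega A :=
  fun i => nth (point : A) t i.

Lemma measurable_extend n : measurable_fun setT (@extend n).
Proof.
apply: measurable_Omega => i; case: (ltnP i n) => ilt.
  rewrite (_ : (fun t => _) = (@tnth n (borel A) ^~ (Ordinal ilt))).
    exact: measurable_tnth.
  by apply/funext => t; rewrite (tnth_nth (point : A)).
rewrite (_ : (fun t => _) = cst (point : borel A)).
  exact: measurable_cst.
by apply/funext => t; rewrite /extend nth_default// size_tuple.
Qed.

Lemma extend_first_coords n w : extend (@first_coords R A n w) = trunc n w.
Proof.
apply/funext => j; rewrite /extend /trunc; case: ltnP => ilt.
  rewrite -[j]/(nat_of_ord (Ordinal ilt)) -tnth_nth tnth_mktuple//.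
by rewrite nth_default// size_tuple.
Qed.

End FirstCoords.

(** * Spectral gap *)

Section FiniteDimensional.
Variables (R : realType) (V : lmodType R[i]) (T : V -> V) (F : set V).
Hypothesis F_sub : linear_subspace F.
Hypothesis F_stable : forall f, F f -> F (T f).
Hypothesis T_lin : forall (z : R[i]) f g, F f -> F g -> T (z *: f + g) = z *: T f + T g.

Lemma subspaceD f g : F f -> F g -> F (f + g).
Proof. by move=> Ff Fg; rewrite -[f]scale1r; apply: F_sub.2. Qed.

Lemma subspaceZ (z : R[i]) f : F f -> F (z *: f).
Proof. by move=> Ff; rewrite -[z *: f]addr0; apply: F_sub.2 => //; exact: F_sub.1. Qed.

Lemma subspaceB f g : F f -> F g -> F (f - g).
Proof. by move=> Ff Fg; rewrite -scaleN1r; apply: subspaceD => //; exact: subspaceZ. Qed.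

Lemma subspace_sum n (f : 'I_n -> V) : (forall j, F (f j)) -> F (\sum_j f j).
Proof. by move=> Ff; elim/big_ind : _ => //; [exact: F_sub.1|exact: subspaceD]. Qed.

Lemma op0 : T 0 = 0.
Proof.
have := T_lin 1 F_sub.1 F_sub.1; rewrite !scale1r addr0 => /esym/eqP.
by rewrite -subr_eq0 addrK => /eqP.
Qed.

Lemma opZ (z : R[i]) f : F f -> T (z *: f) = z *: T f.
Proof. by move=> Ff; rewrite -[z *: f]addr0 T_lin ?op0 ?addr0//; exact: F_sub.1. Qed.

Lemma opB f g : F f -> F g -> T (f - g) = T f - T g.
Proof.
by move=> Ff Fg; rewrite -scaleN1r addrC T_lin// scaleN1r addrC.
Qed.

Lemma iter_subspace n f : F f -> F (iter n T f).
Proof. by move=> Ff; elim: n => //= n; exact: F_stable. Qed.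

Lemma iter_opB (z : R[i]) n f : F f ->
  iter n T (T f - z *: f) = iter n.+1 T f - z *: iter n T f.
Proof.
move=> Ff; elim: n => [//|n IH]; rewrite iterS IH opB ?opZ//.
- exact: iter_subspace.
- exact: (iter_subspace n.+1).
- exact/subspaceZ/iter_subspace.
Qed.

(** T^n - z^n is divisible by T - z, the quotient being the sum of the z^(n-1-j) T^j. When z^n = 1
    this puts T^n f - f in the image of T - z. *)
Lemma opB_geometric (z : R[i]) n f : F f ->
  exists2 w, F w & T w - z *: w = iter n T f - z ^+ n *: f.
Proof.
move=> Ff; elim: n => [|n [w Fw wE]].
  by exists 0; [exact: F_sub.1|rewrite op0 scaler0 expr0 scale1r !subrr].
have Fn := iter_subspace n Ff.
exists (z *: w + iter n T f); first by apply: F_sub.2.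
rewrite T_lin// -iterS exprS -scalerA scalerDr.
rewrite -[z ^+ n *: f](subKr (iter n T f)) -wE.
by rewrite !scalerBr opprD opprB !addrA (addrC (z *: T w)).
Qed.

Definition opB_seq (zs : seq R[i]) f := foldl (fun g z => T g - z *: g) f zs.

Lemma opB_seq_poly zs f : F f ->
  \sum_(j < (size zs).+1) (\prod_(z <- zs) ('X - z%:P))`_j *: iter j T f =
  opB_seq zs f.
Proof.
elim: zs f => [|z zs IH] f Ff.
  by rewrite big_nil big_ord1 coef1 /= scale1r.
rewrite /= -IH; last by apply: subspaceB; [exact: F_stable|exact: subspaceZ].
rewrite big_cons; set q := \prod_(_ <- _) _.
have q0 : q`_(size zs).+1 = 0 by rewrite nth_default// size_prod_XsubC.
under eq_bigr do rewrite mulrBl coefB coefXM coefCM scalerBl.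
under [RHS]eq_bigr do rewrite iter_opB// scalerBr.
rewrite !sumrB big_ord_recl /= scale0r add0r; congr (_ - _).
rewrite big_ord_recr /= q0 mulr0 scale0r addr0.
by apply: eq_bigr => j _; rewrite scalerA mulrC.
Qed.

(** The n + 1 vectors f, T f, ..., T^n f lie in a span of n vectors, so some nonzero polynomial in T
    kills f; it splits over the complex numbers, and dividing by its leading coefficient leaves a
    product of factors T - z. *)
Lemma annihilating_seq f : finite_dim F -> F f ->
  exists zs, opB_seq zs f = 0.
Proof.
move=> [n [b bE]] Ff.
have /choice[C CE] (j : 'I_n.+1) := bE _ (iter_subspace j Ff).
pose X := \matrix_(j < n.+1, l < n) C j l.
have : kermx X != 0.
  rewrite -mxrank_eq0 mxrank_ker -lt0n subn_gt0.
  exact: leq_ltn_trans (rank_leq_col X) _.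
move=> /rowV0Pn[a /sub_kermxP aX a0].
pose p := \poly_(j < n.+1) a 0 (inord j).
have pE (j : 'I_n.+1) : p`_j = a 0 j by rewrite coef_poly ltn_ord inord_val.
have p0 : p != 0.
  apply: contra_neq a0 => p0; apply/rowP => j.
  by rewrite -pE p0 coef0 mxE.
have pf : \sum_(j < n.+1) p`_j *: iter j T f = 0.
  under eq_bigr do rewrite pE CE scaler_sumr.
  rewrite exchange_big big1// => l _.
  under eq_bigr do rewrite scalerA.
  rewrite -scaler_suml (_ : \sum__ _ = (a *m X) 0 l).
    by rewrite aX mxE scale0r.
  by rewrite mxE; apply: eq_bigr => j _; rewrite [in RHS]mxE.
have [zs zsE] := closed_field_poly_normal p; exists zs.
have lp0 : lead_coef p != 0 by rewrite lead_coef_eq0.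
apply: (scalerI lp0); rewrite scaler0 -opB_seq_poly// scaler_sumr -[RHS]pf.
have sp : size p = (size zs).+1.
  by rewrite zsE size_scale// size_prod_XsubC.
have : (size p <= n.+1)%N by exact: size_poly.
rewrite sp => szn.
rewrite -(big_mkord xpredT (fun j => lead_coef p *: (_`_j *: iter j T f))).
rewrite -(big_mkord xpredT (fun j => p`_j *: iter j T f)).
rewrite [RHS](big_cat_nat (leq0n _) szn) /=.
rewrite [X in _ = _ + X](_ : _ = 0) ?addr0.
  by apply: eq_bigr => j _; rewrite zsE coefZ -zsE scalerA.
rewrite big_nat_cond big1// => j /andP[/andP[jz _] _].
by rewrite nth_default ?scale0r// sp.
Qed.

(* Peel off one factor T - z of an annihilating product at a time.  If T g - z g
   is m-periodic, then h = T^m g - g satisfies T h = z h, and when z^m = 1 it is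
   also of the form T w - z w; simplicity of z then forces h = 0. *)
Lemma periodic_of_simple m : finite_dim F ->
  (forall z, op_eigenvalue F T z -> z ^+ m = 1 /\ simple_eigenvalue F T z) ->
  forall f, F f -> iter m T f = f.
Proof.
move=> fF simp f Ff; have [zs] := annihilating_seq fF Ff.
elim: zs f Ff => [|z zs IH] f Ff /=; first by move=> ->; elim: {simp} m => //= n ->; exact: op0.
have FTf : F (T f - z *: f) by apply: subspaceB; [exact: F_stable|exact: subspaceZ].
move=> /(IH _ FTf); rewrite iter_opB// => E.
apply: contrapT => /eqP; rewrite -subr_eq0 => h0; set h := _ - _ in h0.
have Fm := iter_subspace m Ff.
have Fh : F h by exact: subspaceB.
have hE : T h = z *: h.
  rewrite /h opB// scalerBr -iterS -(subrK (z *: iter m T f) (iter m.+1 T f)) E.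
  by rewrite addrC -!addrA addKr addrC.
have [zm [u [Fu u0 uE gen]]] : z ^+ m = 1 /\ simple_eigenvalue F T z.
  by apply: simp; exists h.
have [w Fw] := opB_geometric z m Ff; rewrite zm scale1r -/h => wE.
(* (T - z)^2 w = (T - z) h = 0, so algebraic simplicity, and not only a one-dimensional eigenspace,
   makes [w] an eigenvector and h = (T - z) w zero. *)
have [|c wc] := gen w 2 Fw; first by rewrite /= wE hE subrr.
by move: h0; rewrite -wE wc opZ// uE !scalerA mulrC subrr eqxx.
Qed.

End FiniteDimensional.

(** * Roots of unity and their number *)

Section RootsOfUnity.
Variable R : realType.

Lemma cis_exp (t : R) n :
  ((cos t +i* sin t) ^+ n = cos (t * n%:R) +i* sin (t * n%:R))%C.
Proof.
elim: n => [|n IH]; first by rewrite mulr0 cos0 sin0 expr0.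
rewrite exprSr IH -natr1 mulrDr mulr1 cosD sinD.
by apply/eqP; rewrite eq_complex /= eqxx/= addrC eqxx.
Qed.

Lemma root_of_unity_exp p l : (0 < p)%N -> @Defs.root_of_unity R p l ^+ p = 1.
Proof.
move=> p0; rewrite /Defs.root_of_unity cis_exp mulfVK ?pnatr_eq0 -?lt0n//.
have c n : cos (2 * pi * n%:R) = 1 :> R /\ sin (2 * pi * n%:R) = 0 :> R.
  elim: n => [|n [cn sn]]; first by rewrite mulr0 cos0 sin0.
  rewrite -(natr1 n) mulrDr mulr1 [X in _ + X](_ : _ = pi *+ 2) ?mulr_natl//.
  by rewrite cosD2pi sinD2pi; move: cn sn; rewrite mulr_natl.
by have [-> ->] := c l.
Qed.

(** For l < k < p put t = pi (k - l) / p, which lies strictly between 0 and pi. Equality of the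
    roots would give cos (2 t) = 1, whereas cos (2 t) = 1 - 2 sin^2 t < 1. *)
Lemma root_of_unity_inj p : {in `I_p &, injective (@Defs.root_of_unity R p)}.
Proof.
move=> l k; wlog lk : l k / (l <= k)%N => [H lp kp E|].
  by have /orP[?|?] := leq_total l k; [exact: H|exact/esym/H].
rewrite !inE /= => lp kp [cE sE]; apply/eqP; rewrite eqn_leq lk /= leqNgt.
apply/negP => {}lk.
have p0 : 0 < p%:R :> R by rewrite ltr0n (leq_trans _ lp).
pose t : R := pi * (k - l)%:R / p%:R.
have tE : t *+ 2 = 2 * pi * k%:R / p%:R - 2 * pi * l%:R / p%:R.
  by rewrite /t natrB ?(ltnW lk)//; field; rewrite gt_eqF.
have t0 : 0 < sin t.
  apply: sin_gt0_pi; rewrite /t divr_gt0//= ?mulr_gt0 ?pi_gt0 ?ltr0n ?subn_gt0//=.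
  rewrite ltr_pdivrMr// ltr_pM2l ?pi_gt0// ltr_nat.
  by rewrite (leq_ltn_trans (leq_subr _ _)).
have : cos (t *+ 2) = 1 by rewrite tE cosB cE sE -!expr2 cos2Dsin2.
rewrite cos_mulr2n cos2sin2; have := exprn_gt0 2 t0; lra.
Qed.

(** The spectral hypothesis provides some order p; counting the eigenvalues identifies it with
    [m]. *)
Lemma card_roots_of_unity p m :
  (@Defs.root_of_unity R p @` `I_p #= `I_m)%card -> p = m.
Proof.
move=> E; apply/card_eq_II; rewrite (card_eq_trans _ E)// card_eq_sym.
exact: inj_card_eq (@root_of_unity_inj p).
Qed.

End RootsOfUnity.

Section SpectralGap.
Variables (R : realType) (V : lmodType R[i]) (N : V -> \bar R) (T : V -> V).
Local Notation E := (normed_space N).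
Hypothesis N_triangle : forall u w (a b : R),
  (N u <= a%:E -> N w <= b%:E -> N (u + w) <= (a + b)%:E)%E.
Hypothesis N_scale : forall (z : R[i]) u (a : R),
  (N u <= a%:E -> N (z *: u) <= (Normc.normc z * a)%:E)%E.

Lemma spectral_radius_lt1 (H : set V) : (spectral_radius N H T < 1)%E ->
  exists lam : R, [/\ 0 < lam, lam < 1 & exists k0, forall k, (k0 <= k)%N ->
    (operator_norm N H (iter k T) <= (lam ^+ k)%:E)%E].
Proof.
move=> /ereal_inf_lt[_ [U [k0 _ Uk0] <-]].
set x := ereal_sup _ => x1.
have xU k : (k0 <= k)%N -> (poweR (operator_norm N H (iter k T)) (k%:R^-1) <= x)%E.
  by move=> kk; apply: ereal_sup_ubound; exists k => //; exact: Uk0.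
have x0 : (0 <= x)%E := le_trans (poweR_ge0 _ _) (xU k0 (leqnn _)).
have xfin : x \is a fin_num by rewrite ge0_fin_numE// (lt_trans x1)// ltry.
(* The upper limit may be 0; the maximum with 1/2 makes the rate positive and keeps it below 1. *)
pose lam := Num.max (fine x) 2^-1.
have lam0 : 0 < lam by rewrite /lam lt_max invr_gt0 ltr0n orbT.
exists lam; split => //.
  by rewrite /lam gt_max -lte_fin fineK// x1/= invf_lt1 ?ltr1n.
(* Starting at [k0.+1] excludes k = 0, where the exponent 0^-1 is 0 and the root carries no
   information. *)
exists k0.+1 => k k0k.
have k_gt0 : 0 < k%:R :> R by rewrite ltr0n (leq_trans _ k0k).
have : (poweR (operator_norm N H (iter k T)) (k%:R^-1) <= lam%:E)%E.
  by rewrite (le_trans (xU k (ltnW k0k)))// -(fineK xfin) lee_fin le_max lexx.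
case: (operator_norm _ _ _) => [q| |] h; last by rewrite leNye.
- have [q0|q0] := leP 0 q; last first.
    by rewrite lee_fin (le_trans (ltW q0))// exprn_ge0// ltW.
  move: h; rewrite poweR_EFin !lee_fin => h.
  rewrite -(powRr1 q0) -(mulVf (lt0r_neq0 k_gt0)) powRrM powR_mulrn ?powR_ge0//.
  by rewrite lerXn2r ?nnegrE ?powR_ge0 ?(ltW lam0).
- by move: h; rewrite poweRyr// invr_eq0 gt_eqF.
Qed.

Lemma normed_bound u : E u -> exists2 a : R, 0 < a & (N u <= a%:E)%E.
Proof.
rewrite /normed_space /=; case: (N u) => [r _||] //.
  by exists (`|r| + 1); rewrite ?ltr_wpDl// lee_fin (le_trans (ler_norm r))// lerDl.
by exists 1 => //; rewrite leNye.
Qed.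

Lemma bound_normed u (a : R) : (N u <= a%:E)%E -> E u.
Proof. by move=> h; rewrite /normed_space /= (le_lt_trans h)// ltry. Qed.

Lemma N_sub u w (a b : R) :
  (N u <= a%:E -> N w <= b%:E -> N (u - w) <= (a + b)%:E)%E.
Proof.
move=> ua wb; apply: N_triangle => //; rewrite -scaleN1r -[b]mul1r.
have -> : 1 = Normc.normc (-1 : R[i]) :> R by rewrite /= oppr0 expr0n addr0 sqrrN expr1n sqrtr1.
exact: N_scale.
Qed.

Variables (m : nat) (one : V).
Hypothesis m_gt0 : (0 < m)%N.
Hypotheses (T_one : T one = one) (one_neq0 : one != 0) (one_normed : E one).
Hypothesis T_qc : quasi_compact N T.
Hypothesis T_rad : spectral_radius N E T = 1%E.
Hypothesis T_per : forall z, peripheral_eigenvalues N T z ->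
  z ^+ m = 1 /\ simple_eigenvalue E T z.

Definition cesaro k u := m%:R^-1 *: \sum_(j < m) iter (m * k + j) T u.

(** The rate and the constant are uniform in u, although no norm of the projections onto [F] and [H]
    enters: the assumed bound on the iterates of u controls its component in [F], hence also the one
    in [H]. The limit constant c depends on u and is identified only later. *)
Lemma spectral_gap (C1 : R) : 1 <= C1 -> exists C lam : R,
  [/\ 0 < C, 0 < lam, lam < 1 & exists k0, forall u (B : R), 0 < B ->
    (N u <= B%:E)%E -> (forall k, N (iter k T u) <= (C1 * B)%:E)%E ->
    exists c : R[i], forall k, (k0 <= k)%N ->
      (N (cesaro k u - c *: one)%R <= (C * B * lam ^+ k)%:E)%E].
Proof.
move=> C1_ge1.
have [T_bd [F [H [[F_sub FE _ F_st] [H_sub HE _ H_st] [dec FH] [fF Fper] Hrad]]]] := T_qc.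
have [T_E T_lin _] := T_bd.
have linF z f g : F f -> F g -> T (z *: f + g) = z *: T f + T g.
  by move=> Ff Fg; apply: T_lin; exact: FE.
have linH z f g : H f -> H g -> T (z *: f + g) = z *: T f + T g.
  by move=> Ff Fg; apply: T_lin; exact: HE.
(* An eigenvalue on [F] has modulus equal to the spectral radius 1, so it is peripheral. Its
   simplicity passes from the whole space to [F] because the generating eigenvector is proportional
   to one lying in [F]. *)
have F_per f : F f -> iter m T f = f.
  apply: (periodic_of_simple F_sub F_st linF fF) => z Fz.
  have [f0 [Ff0 f00 Tf0]] := Fz.
  have [|zm [u [Eu u0 Tu gen]]] := @T_per z.
    split; first by exists f0; split=> //; exact: FE.
    by apply/EFin_inj; rewrite (Fper _ Fz).
  split=> //.
  have [|c f0E] := gen f0 1 (FE _ Ff0); first by rewrite /= Tf0 subrr.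
  have c0 : c != 0 by apply: contra_neq f00 => c0; rewrite f0E c0 scale0r.
  have Fu : F u.
    by rewrite -[u]scale1r -(mulVf c0) -scalerA -f0E; exact: subspaceZ.
  exists u; split=> // w n Fw; exact: gen (FE _ Fw).
have F_pern k f : F f -> iter (m * k) T f = f.
  move=> Ff; elim: k => [|k IH]; first by rewrite muln0.
  by rewrite mulnS iterD IH F_per.
have [lam [lam0 lam1 [k0 Tlam]]] : exists lam : R, [/\ 0 < lam, lam < 1 &
    exists k0, forall k, (k0 <= k)%N ->
    (operator_norm N H (iter k T) <= (lam ^+ k)%:E)%E].
  by apply: spectral_radius_lt1; rewrite -T_rad.
have iterE k f h : F f -> H h -> iter k T (f + h) = iter k T f + iter k T h.
  move=> Ff Hh; elim: k => [//|k IH]; rewrite !iterS IH.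
  rewrite -[iter k T f]scale1r T_lin ?scale1r//.
    by apply: FE; exact: iter_subspace.
  by apply: HE; exact: iter_subspace.
have iterZ k z h : H h -> iter k T (z *: h) = z *: iter k T h.
  move=> Hh; elim: k => [//|k IH]; rewrite !iterS IH.
  by rewrite (opZ H_sub linH)//; exact: iter_subspace.
(* The operator norm is a supremum over the unit ball; rescaling by a positive bound b instead of
   the norm avoids dividing by 0. *)
have H_dec h (b : R) k : 0 < b -> H h -> (N h <= b%:E)%E -> (k0 <= k)%N ->
    (N (iter k T h) <= (lam ^+ k * b)%:E)%E.
  move=> b0 Hh hb kk.
  have normb (r : R) : 0 < r -> Normc.normc (r%:C) = r.
    by move=> r0; rewrite /= expr0n addr0 sqrtr_sqr gtr0_norm.
  have hE : iter k T h = b%:C *: iter k T (b^-1%:C *: h).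
    rewrite iterZ// scalerA -rmorphM /= divff ?gt_eqF// scale1r//.
  rewrite hE [lam ^+ k * b]mulrC -[X in (X * _)%:E](normb b b0); apply: N_scale.
  apply: le_trans (Tlam k kk); apply: ereal_sup_ubound; exists (b^-1%:C *: h) => //.
  split; first exact: subspaceZ.
  rewrite (le_trans (N_scale _ hb))// normb ?invr_gt0//.
  by rewrite mulVf ?gt_eqF.
(* The component in [F] has norm at most (C1 + 1) B, so the one in [H] has norm at most B + (C1 + 1)
   B. *)
exists (C1 + 2), lam; split => //; first by rewrite ltr_wpDl// (le_trans ler01).
exists k0 => u B B0 uB TuB.
have [f [h [Ff Hh uE]]] := dec u (bound_normed uB).
(* f = T^{mk} u - T^{mk} h for every k, and the last term tends to 0. *)
have fB : (N f <= ((C1 + 1) * B)%:E)%E.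
  have [b b0 hb] := normed_bound (HE _ Hh).
  have : (fun k => lam ^+ k * b) @ \oo --> (0 : R).
    rewrite -[X in _ --> X](mul0r b); apply: cvgM; last exact: cvg_cst.
    by apply: cvg_expr; rewrite gtr0_norm.
  move=> /cvgrPdist_lt/(_ B B0)[k1 _ Hk1].
  pose k := maxn k0 k1.
  have -> : f = iter (m * k) T u - iter (m * k) T h.
    by rewrite uE iterE// F_pern// addrK.
  rewrite mulrDl mul1r; apply: N_sub; first exact: TuB.
  have mk : (k <= m * k)%N by rewrite leq_pmull.
  rewrite (le_trans (H_dec _ _ _ b0 Hh hb _))//.
    exact: leq_trans (leq_maxl _ _) mk.
  rewrite lee_fin; have := Hk1 (m * k)%N (leq_trans (leq_maxr _ _) mk).
  by rewrite /= sub0r normrN => /ltW; apply: le_trans; exact: ler_norm.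
have hB : (N h <= ((C1 + 2) * B)%:E)%E.
  have -> : h = u - f by rewrite uE addrC addKr.
  rewrite (_ : (C1 + 2) * B = B + (C1 + 1) * B); last by ring.
  exact: N_sub.
(* The mean over one period is fixed by T. As 1 is a simple eigenvalue, [a] and [one] are multiples
   of the same eigenvector. *)
pose a := m%:R^-1 *: \sum_(j < m) iter j T f : V.
have Fsum k : F (\sum_(j < k) iter j T f).
  by apply: subspace_sum => // j; exact: iter_subspace.
have Fa : F a by exact: subspaceZ.
have Tsum k : T (\sum_(j < k) iter j T f) = \sum_(j < k) iter j.+1 T f.
  elim: k => [|k IH]; first by rewrite !big_ord0 (op0 F_sub linF).
  rewrite !big_ord_recr /= -IH -[X in T (X + _)]scale1r linF ?scale1r//.
    exact: Fsum.
  exact: iter_subspace.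
have Ta : T a = a.
  rewrite /a (opZ F_sub linF)// Tsum; congr (_ *: _).
  case: (m) m_gt0 F_per => // m' _ F_per'.
  by rewrite big_ord_recr big_ord_recl /= -iterS F_per'// addrC.
have [c aE] : exists c, a = c *: one.
  have [|_ [w [Ew w0 Tw gen]]] := @T_per 1.
    split; first by exists one; rewrite scale1r.
    by rewrite /= expr0n addr0 expr1n sqrtr1.
  have [|c1 oneE] := gen one 1 one_normed; first by rewrite /= T_one scale1r subrr.
  have [|c2 aE] := gen a 1 (FE _ Fa); first by rewrite /= Ta scale1r subrr.
  have c10 : c1 != 0 by apply: contra_neq one_neq0 => c10; rewrite oneE c10 scale0r.
  by exists (c2 / c1); rewrite aE oneE scalerA mulfVK.
exists c => k kk.
(* By periodicity every block of m iterates of f starting at a multiple of m has mean [a]; only the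
   component in [H] remains. *)
have -> : cesaro k u - c *: one = m%:R^-1 *: \sum_(j < m) iter (m * k + j) T h.
  rewrite -aE /a /cesaro -scalerBr -sumrB; congr (_ *: _).
  apply: eq_bigr => j _; rewrite uE iterE//.
  have -> : iter (m * k + j) T f = iter j T f by rewrite addnC iterD F_pern.
  by rewrite addrC addKr.
have sumN n : (N (\sum_(j < n) iter (m * k + j) T h) <=
    (n%:R * ((C1 + 2) * B * lam ^+ k))%:E)%E.
  have CB0 : 0 < (C1 + 2) * B.
    by rewrite mulr_gt0// ltr_wpDl// (le_trans ler01).
  elim: n => [|n IH].
    rewrite big_ord0 mul0r -(scale0r one).
    have [b _ ob] := normed_bound one_normed.
    by have := N_scale 0 ob; rewrite Normc.normc0 mul0r.
  rewrite big_ord_recr -natr1 mulrDl mul1r; apply: N_triangle => //.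
  have kmn : (k <= m * k + n)%N by rewrite (leq_trans (leq_pmull _ m_gt0))// leq_addr.
  rewrite (le_trans (H_dec _ _ _ CB0 Hh hB _))//; first exact: leq_trans kmn.
  rewrite lee_fin mulrC ler_wpM2l ?(ltW CB0)//.
  by rewrite ler_wiXn2l// ltW.
have := N_scale (m%:R^-1) (sumN m).
rewrite (_ : Normc.normc _ = m%:R^-1) ?mulKf ?pnatr_eq0 -?lt0n//.
have -> : (m%:R^-1 : R[i]) = (m%:R^-1 : R)%:C by rewrite fmorphV rmorph_nat.
by rewrite /= expr0n addr0 sqrtr_sqr ger0_norm// invr_ge0.
Qed.

End SpectralGap.

(** * Hölder norms and integrals against probabilities *)

Section HolderNorm.
Variables (R : realType) (d : nat) (alpha : R).
Local Notation P := (projective R d.+1).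
Implicit Types f g : P -> R[i]^o.
Local Notation N := (@holder_norm R d alpha).

Lemma holder_norm_le f (a b : R) : 0 <= b ->
  (forall X, Normc.normc (f X) <= a) ->
  (forall X Y, Normc.normc (f X - f Y) <= b * mdist X Y `^ alpha) ->
  (N f <= (a + b)%:E)%E.
Proof.
move=> b0 fa fb; rewrite /holder_norm EFinD; apply: leeD.
  by apply: ge_ereal_sup => _ [X _ <-]; rewrite lee_fin.
apply: ge_ereal_sup => _ [[X Y] _ <-] /=; rewrite lee_fin.
have [->|XY] := eqVneq X Y.
  by rewrite subrr Normc.normc0 mul0r.
rewrite ler_pdivrMr ?powR_gt0//.
by rewrite lt_neqAle mdist_ge0 eq_sym andbT; apply: contra_neq XY => /mdist_positivity.
Qed.

Lemma holder_norm_ge f (r : R) : (N f <= r%:E)%E -> exists a b : R,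
  [/\ 0 <= b, a + b <= r, forall X, Normc.normc (f X) <= a &
      forall X Y, Normc.normc (f X - f Y) <= b * mdist X Y `^ alpha].
Proof.
rewrite /holder_norm; set s1 := ereal_sup _; set s2 := ereal_sup _ => h.
have f1 X : ((Normc.normc (f X))%:E <= s1)%E.
  by apply: ereal_sup_ubound; exists X.
have f2 X Y : ((Normc.normc (f X - f Y) / mdist X Y `^ alpha)%:E <= s2)%E.
  by apply: ereal_sup_ubound; exists (X, Y).
have s10 : (0 <= s1)%E by rewrite (le_trans _ (f1 point))// lee_fin normc_ge0.
have s20 : (0 <= s2)%E.
  by rewrite (le_trans _ (f2 point point))// subrr Normc.normc0 mul0r.
have sfin : (s1 \is a fin_num) && (s2 \is a fin_num).
  rewrite !ge0_fin_numE// (le_lt_trans _ (le_lt_trans h (ltry r))) ?leeDl//=.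
  by rewrite (le_lt_trans _ (le_lt_trans h (ltry r)))// leeDr.
have /andP[s1f s2f] := sfin.
exists (fine s1), (fine s2); split.
- exact: fine_ge0.
- by rewrite -lee_fin EFinD !fineK.
- by move=> X; rewrite -lee_fin fineK.
- move=> X Y; have [->|XY] := eqVneq X Y.
    by rewrite subrr Normc.normc0 mulr_ge0 ?fine_ge0 ?powR_ge0.
  rewrite -ler_pdivrMr; first by rewrite -lee_fin fineK.
  rewrite powR_gt0// lt_neqAle mdist_ge0 eq_sym andbT.
  by apply: contra_neq XY => /mdist_positivity.
Qed.

Lemma holder_norm_triangle f g (a b : R) :
  (N f <= a%:E -> N g <= b%:E -> N (f + g)%R <= (a + b)%:E)%E.
Proof.
move=> /holder_norm_ge[a1 [a2 [a20 a12 fa1 fa2]]].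
move=> /holder_norm_ge[b1 [b2 [b20 b12 gb1 gb2]]].
apply: (@le_trans _ _ ((a1 + b1 + (a2 + b2))%:E)); last by rewrite lee_fin; lra.
apply: holder_norm_le => [|X|X Y]; first exact: addr_ge0.
  by rewrite (le_trans (le_normcD _ _))// lerD.
rewrite [X in Normc.normc X](_ : _ = (f X - f Y) + (g X - g Y)).
  by rewrite mulrDl (le_trans (le_normcD _ _))// lerD.
by rewrite opprD addrACA.
Qed.

Lemma holder_norm_scale (z : R[i]) f (a : R) :
  (N f <= a%:E -> N (z *: f)%R <= (Normc.normc z * a)%:E)%E.
Proof.
move=> /holder_norm_ge[a1 [a2 [a20 a12 fa1 fa2]]].
have z0 := normc_ge0 z.
apply: (@le_trans _ _ ((Normc.normc z * a1 + Normc.normc z * a2)%:E)).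
  apply: holder_norm_le => [|X|X Y]; first exact: mulr_ge0.
    by rewrite Normc.normcM ler_wpM2l.
  rewrite [X in Normc.normc X](_ : _ = z * (f X - f Y)); last by rewrite mulrBr.
  by rewrite Normc.normcM -mulrA ler_wpM2l.
by rewrite lee_fin -mulrDr ler_wpM2l.
Qed.

End HolderNorm.

Lemma integrable_scale d (T : measurableType d) (R : realType)
    (m : {measure set T -> \bar R}) (f : T -> R) (r : R) :
  m.-integrable setT (EFin \o f) -> m.-integrable setT (EFin \o (fun w => r * f w)).
Proof.
move=> mf; rewrite (_ : EFin \o _ = (fun w => (r%:E * (EFin \o f) w)%E)).
  exact: integrableZl.
by apply/funext => w /=; rewrite EFinM.
Qed.

Lemma integrable_EFinB d (T : measurableType d) (R : realType)
    (m : {measure set T -> \bar R}) (f g : T -> R) :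
  m.-integrable setT (EFin \o f) -> m.-integrable setT (EFin \o g) ->
  m.-integrable setT (EFin \o (fun w => f w - g w)).
Proof.
move=> mf mg; rewrite (_ : EFin \o _ = (EFin \o f) \- (EFin \o g))%E//.
exact: integrableB.
Qed.

Lemma bounded_integrable d (T : measurableType d) (R : realType)
    (Q : probability T R)
    (H : T -> R) (B : R) : measurable_fun setT H -> (forall w, `|H w| <= B) ->
  Q.-integrable setT (EFin \o H).
Proof.
move=> mH HB; apply: measurable_bounded_integrable => //.
  by rewrite (le_lt_trans (probability_le1 Q measurableT))// ltry.
exists B; split; first exact: num_real.
by move=> x Bx t _; exact: le_trans (HB t) (ltW Bx).
Qed.

Lemma Rintegral_sum d (T : measurableType d) (R : realType)
    (Q : {measure set T -> \bar R}) l (u : 'I_l -> T -> R) :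
  (forall j, Q.-integrable setT (EFin \o u j)) ->
  \int[Q]_w (\sum_j u j w) = \sum_j \int[Q]_w u j w.
Proof.
move=> iu; rewrite /Rintegral.
under eq_integral do rewrite -sumEFin.
rewrite (@integral_sum _ _ _ Q setT measurableT _ (fun j w => (u j w)%:E))//.
by rewrite sum_fine// => j _; exact: (integrable_fin_num _ (iu j)).
Qed.

Lemma probability_integral_dist d (T : measurableType d) (R : realType)
    (Q : probability T R)
    (H : T -> R) (r b B : R) : measurable_fun setT H ->
  (forall w, `|H w| <= B) -> (forall w, `|H w - r| <= b) ->
  `|\int[Q]_w H w - r| <= b.
Proof.
move=> mH HB Hb; have iH := bounded_integrable Q mH HB.
have ic (c : R) : Q.-integrable setT (EFin \o cst c).
  by apply: (bounded_integrable Q _ (B := `|c|)).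
have c_int (c : R) : \int[Q]_w cst c w = c.
  by rewrite Rintegral_cst//= -[X in fine X]/(Q setT) probability_setT mulr1.
have iHr : Q.-integrable setT (EFin \o (fun w => H w - cst r w)).
  exact: integrable_EFinB.
rewrite -{1}(c_int r) -RintegralB// (le_trans (le_normr_Rintegral _ iHr))//.
rewrite -[leRHS]c_int; apply: le_Rintegral => //.
exact: (integrable_norm iHr).
Qed.

Lemma probability_integral_close d (T : measurableType d) (R : realType)
    (Q : probability T R) (H H' : T -> R) (b B B' : R) :
  measurable_fun setT H -> measurable_fun setT H' ->
  (forall w, `|H w| <= B) -> (forall w, `|H' w| <= B') ->
  (forall w, `|H w - H' w| <= b) ->
  `|\int[Q]_w H w - \int[Q]_w H' w| <= b.
Proof.
move=> mH mH' HB HB' Hb.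
rewrite -RintegralB//; [|exact: bounded_integrable HB|exact: bounded_integrable HB'].
rewrite -[X in `|X|]subr0.
apply: (probability_integral_dist Q _ Hb) => [|w]; last by rewrite subr0.
exact: measurable_funB.
Qed.

Lemma prod_close (R : realDomainType) (x x' y y' bx by' a b : R) : `|x'| <= bx -> `|y| <= by' ->
  `|x - x'| <= a -> `|y - y'| <= b -> `|x * y - x' * y'| <= a * by' + bx * b.
Proof.
move=> xb yb xa ya; have -> : x * y - x' * y' = (x - x') * y + x' * (y - y') by ring.
by rewrite (le_trans (ler_normD _ _))// !normrM lerD// ler_pM.
Qed.

(** * Weighted integrals over paths *)

Section PathOperators.
Variables (R : realType) (d : nat) (A : polishType R).
Local Notation Om := (Omega A).
Local Notation M := 'M[R[i]]_d.+1.
Local Notation P := (projective R d.+1).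
Variable v : borel A -> borel M.
Hypothesis mv : measurable_fun setT v.
Variables (mu : {measure set (borel A) -> \bar R}).
Variable nu : {sigma_finite_measure set (borel A) -> \bar R}.
Hypothesis nuE : restr_nonzero v mu nu.
Variable s : R.
Hypothesis s_gt0 : 0 < s.
Variables (e : P -> R) (kap ec eB : R).
Hypothesis kap_gt0 : 0 < kap.
Hypothesis e_cont : continuous e.
Hypothesis ec_gt0 : 0 < ec.
Hypothesis ec_le : forall X, ec <= e X.
Hypothesis e_leB : forall X, e X <= eB.
Hypothesis e_eigen : forall X,
  (\int[mu]_a (weight s e X (v a))%:E = (kap * e X)%:E)%E.
Implicit Types (phi : P -> R) (X : P) (F : Om -> R).

(** An unnormalised expectation: for phi = e, positive n and F depending on n coordinates, division
    by kap^n e(X) gives the expectation of F under [QX X]. With F = 1 it is the n-th iterate of the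
    transfer operator. *)
Definition path_int n phi X F : R :=
  \int[paths nu n]_w (F w * weight s phi X (prodmx v n w)).

Lemma e_gt0' X : 0 < e X. Proof. exact: lt_le_trans (ec_le X). Qed.

Lemma weight_ge0 phi X w : (forall X, 0 <= phi X) -> 0 <= weight s phi X w.
Proof. by move=> phi0; rewrite mulr_ge0// powR_ge0. Qed.

Lemma measurable_weight_prodmx phi X n : continuous phi ->
  measurable_fun setT (fun w => weight s phi X (prodmx v n w)).
Proof.
by move=> cphi; apply: measurable_weight => //; exact: mxmeasurable_prodmx.
Qed.

Lemma measurable_weight_v phi X : continuous phi ->
  measurable_fun setT (fun a => weight s phi X (v a)).
Proof.
by move=> cphi; apply: measurable_weight => //; exact: mxmeasurable_v.
Qed.

Lemma weight_v0 phi X (a : borel A) : (v a : M) = 0 -> weight s phi X (v a) = 0.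
Proof.
by move=> va; apply: weight0 => //; apply/eqP; rewrite growth_eq0 va mul0mx.
Qed.

Lemma integral_weight_nu phi X : continuous phi -> (forall X, 0 <= phi X) ->
  (\int[mu]_a (weight s phi X (v a))%:E =
   \int[nu]_a (weight s phi X (v a))%:E)%E.
Proof.
move=> cphi phi0; apply: nuE.
- by apply/measurable_EFinP; exact: measurable_weight_v.
- by move=> a; rewrite lee_fin weight_ge0.
- by move=> a va; rewrite weight_v0.
Qed.

Lemma integral_weight_prodmx n X :
  (\int[paths nu n]_w (weight s e X (prodmx v n w))%:E =
   (kap ^+ n * e X)%:E)%E.
Proof.
have e0 X' : 0 <= e X' := ltW (e_gt0' X').
elim: n X => [|n IH] X.
  by rewrite /= integral_dirac// diracT mul1e weight1 expr0 mul1r.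
rewrite /= ge0_integral_path_step.
- transitivity (\int[nu]_a ((kap ^+ n)%:E * (weight s e X (v a))%:E))%E.
    apply: eq_integral => a _ /=.
    under eq_integral do rewrite weightM// EFinM.
    rewrite ge0_integralZr//; last 3 first.
    + by apply/measurable_EFinP; exact: measurable_weight_prodmx.
    + by move=> w _; rewrite lee_fin weight_ge0.
    + by rewrite lee_fin powR_ge0.
    by rewrite IH -!EFinM /weight mulrA.
  rewrite ge0_integralZl//; last 3 first.
  + by apply/measurable_EFinP; exact: measurable_weight_v.
  + by move=> a _; rewrite lee_fin weight_ge0.
  + by rewrite lee_fin exprn_ge0// ltW.
  by rewrite -integral_weight_nu// e_eigen -EFinM exprSr mulrA.
- by apply/measurable_EFinP; exact: (measurable_weight_prodmx X n.+1).
- by move=> w; rewrite lee_fin weight_ge0.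
Qed.

(** As [e] is bounded below, every bounded phi is dominated by a multiple of [e], whose path
    integrals are explicit. This is the source of integrability and of the majorant for dominated
    convergence. *)
Lemma weight_le_e phi (B : R) X w : (forall X, `|phi X| <= B) ->
  `|weight s phi X w| <= B / ec * weight s e X w.
Proof.
move=> phiB; rewrite (le_trans (weight_le _ _ _ phiB))// /weight mulrA.
rewrite ler_wpM2r ?powR_ge0// -mulrA ler_peMr ?(le_trans _ (phiB X))//.
by rewrite mulrC ler_pdivlMr// mul1r.
Qed.

Lemma integrable_weight_e n X :
  (paths nu n).-integrable setT (EFin \o (fun w => weight s e X (prodmx v n w))).
Proof.
apply/integrableP; split.
  by apply/measurable_EFinP; exact: measurable_weight_prodmx.
have e0 Y : 0 <= e Y := ltW (e_gt0' Y).
under eq_integral do rewrite /= ger0_norm ?weight_ge0//.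
by rewrite integral_weight_prodmx ltry.
Qed.

Lemma path_integrand_le n phi X F (BF Bp : R) w : (forall w, `|F w| <= BF) ->
  (forall X, `|phi X| <= Bp) ->
  `|F w * weight s phi X (prodmx v n w)| <=
  BF * (Bp / ec) * weight s e X (prodmx v n w).
Proof.
move=> FB phiB; rewrite normrM -mulrA ler_pM//; exact: weight_le_e.
Qed.

Lemma integrable_path n phi X F (BF Bp : R) : measurable_fun setT F ->
  (forall w, `|F w| <= BF) -> continuous phi -> (forall X, `|phi X| <= Bp) ->
  (paths nu n).-integrable setT
    (EFin \o (fun w => F w * weight s phi X (prodmx v n w))).
Proof.
move=> mF FB cphi phiB.
apply: (@le_integrable _ _ _ _ setT _ _ (EFin \o (fun w =>
  BF * (Bp / ec) * weight s e X (prodmx v n w)))) => //.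
- apply/measurable_EFinP; apply: measurable_funM => //.
  exact: measurable_weight_prodmx.
- move=> w _ /=; rewrite lee_fin (le_trans (path_integrand_le _ _ _ FB phiB))//.
  exact: ler_norm.
- exact/integrable_scale/integrable_weight_e.
Qed.

Lemma path_int_e n X : path_int n e X (cst 1) = kap ^+ n * e X.
Proof.
rewrite /path_int /Rintegral.
under eq_integral do rewrite /= mul1r.
by rewrite integral_weight_prodmx.
Qed.

Lemma path_int_le n phi X F (BF Bp : R) : measurable_fun setT F ->
  (forall w, `|F w| <= BF) -> continuous phi -> (forall X, `|phi X| <= Bp) ->
  `|path_int n phi X F| <= BF * (Bp / ec) * (kap ^+ n * e X).
Proof.
move=> mF FB cphi phiB.
have iF := integrable_path n X mF FB cphi phiB.
rewrite (le_trans (le_normr_Rintegral _ iF))// -path_int_e /path_int.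
have ie : (paths nu n).-integrable setT
    (EFin \o (fun w => cst 1 w * weight s e X (prodmx v n w))).
  rewrite (_ : EFin \o _ = EFin \o (fun w => weight s e X (prodmx v n w))).
    exact: integrable_weight_e.
  by apply/funext => w /=; rewrite mul1r.
rewrite -RintegralZl//; apply: le_Rintegral => //.
- exact: (integrable_norm iF).
- exact: integrable_scale.
- by move=> w _; rewrite mul1r; exact: path_integrand_le.
Qed.

Lemma path_int0 phi X F : measurable_fun setT F -> continuous phi ->
  path_int 0 phi X F = F point * phi X.
Proof.
move=> mF cphi; rewrite /path_int /Rintegral /= integral_dirac//.
  by rewrite diracT mul1e /= weight1.
by apply/measurable_EFinP; exact: measurable_funM.
Qed.

Lemma path_intS n phi X F (BF Bp : R) : measurable_fun setT F ->
  (forall w, `|F w| <= BF) -> continuous phi -> (forall X, `|phi X| <= Bp) ->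
  path_int n.+1 phi X F =
  \int[nu]_a (growth (v a) X `^ s *
    path_int n phi (act (v a) X) (fun w => F (ocons (a, w)))).
Proof.
move=> mF FB cphi phiB; congr fine.
rewrite integral_path_step; last exact: (integrable_path n.+1 X mF FB cphi phiB).
apply: eq_integral => a _.
have mFa : measurable_fun setT (fun w => F (ocons (a, w))).
  exact: (measurableT_comp mF (@measurable_ocons_cst _ _ a)).
have iFa := integrable_path n (act (v a) X) mFa (fun w => FB _) cphi phiB.
rewrite /path_int /Rintegral EFinM fineK; last exact: integrable_fin_num.
rewrite -integralZl//; apply: eq_integral => w _.
by rewrite /= weightM// -EFinM mulrA mulrC.
Qed.

(** * Hölder regularity of path integrals *)

Variables (alpha : R) (K : nat).
Hypotheses (a_gt0 : 0 < alpha) (a_le1 : alpha <= 1) (a_le_s : alpha <= s).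
Hypothesis s_leK : s <= K%:R.

(** One constant bounds both the supremum and the Hölder seminorm, so that estimates compose with a
    single number. *)
Definition hol (B : R) (phi : P -> R) :=
  (forall X, `|phi X| <= B) /\ holder_fun alpha B phi.

Lemma hol_ge0 B phi : hol B phi -> 0 <= B.
Proof. by move=> [h _]; rewrite (le_trans _ (h point)). Qed.

Lemma hol_le B B' phi : B <= B' -> hol B phi -> hol B' phi.
Proof.
move=> BB' [h1 h2]; split=> [X|X Y]; first exact: le_trans (h1 X) BB'.
by rewrite (le_trans (h2 X Y))// ler_wpM2r// powR_ge0.
Qed.

Lemma hol_cst B : 0 <= B -> hol B (cst B).
Proof.
move=> B0; split=> [X|X Y] /=; first by rewrite ger0_norm.
by rewrite subrr normr0 mulr_ge0// powR_ge0.
Qed.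

Lemma hol_continuous B phi : hol B phi -> continuous phi.
Proof.
move=> hphi; have B0 := hol_ge0 hphi; have [_ h] := hphi.
move=> X; apply/(@cvgrPdist_lt _ _ _ (nbhs X) (nbhs_filter X)) => eps eps0.
pose r := (eps / (B + 1)) `^ alpha^-1.
have r0 : 0 < r by rewrite powR_gt0// divr_gt0// ltr_wpDl.
apply/nbhs_ballP; exists r => //= Y; rewrite ballEmdist /= => XY.
rewrite (le_lt_trans (h X Y))//.
apply: (@le_lt_trans _ _ (B * (eps / (B + 1)))).
  rewrite ler_wpM2l// (@le_trans _ _ (r `^ alpha))//.
    by rewrite ler_powR2 ?mdist_ge0// ltW.
  by rewrite /r -powRrM mulVf ?gt_eqF// powRr1// divr_ge0 ?ltW// ltr_wpDl.
by rewrite mulrCA gtr_pMr// ltr_pdivrMr ?ltr_wpDl// mul1r ltrDl.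
Qed.

(** (d+1)^s / ec comes from bounding the norm by weights of [e] at the basis points; each of these d
    + 1 weights has integral at most eB kap^n. *)
Definition mxnorm_const : R := d.+1%:R `^ s * (d.+1%:R * (eB / ec)).

Lemma eB_gt0 : 0 < eB.
Proof. exact: lt_le_trans (e_gt0' point) (e_leB point). Qed.

Lemma mxnorm_const_ge0 : 0 <= mxnorm_const.
Proof.
by rewrite mulr_ge0 ?powR_ge0 ?mulr_ge0 ?invr_ge0 ?(ltW ec_gt0)// ltW ?eB_gt0.
Qed.

Lemma mxnorm_le_weight (w : M) : mxnorm w `^ s <=
  (d.+1%:R `^ s / ec) * \sum_i weight s e (basis_pt R i) w.
Proof.
rewrite (le_trans (mxnorm_powR_le w s_gt0))// -mulrA ler_wpM2l ?powR_ge0//.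
rewrite mulr_sumr ler_sum// => i _; rewrite /weight mulrA ler_peMl ?powR_ge0//.
by rewrite mulrC ler_pdivlMr// mul1r.
Qed.

Lemma measurable_mxnorm d' (T : measurableType d') (w : T -> M) :
  mxmeasurable w -> measurable_fun setT (fun t => mxnorm (w t) `^ s).
Proof.
move=> mw; apply: (measurableT_comp (measurable_powR s)).
rewrite (_ : (fun t => _) = (fun t => \sum_i growth (w t) (basis_pt R i))).
  by apply: measurable_sum => i; exact: measurable_growth.
by apply/funext => t; rewrite mxnormE; apply: eq_bigr => i _;
  rewrite growth_basis.
Qed.

Lemma integrable_sum_weight n : (paths nu n).-integrable setT
  (EFin \o (fun w => \sum_i weight s e (basis_pt R i) (prodmx v n w))).
Proof.
rewrite (_ : EFin \o _ =
  (fun w => \sum_i (weight s e (basis_pt R i) (prodmx v n w))%:E)%E).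
  by apply: integrable_sum => // i _; exact: integrable_weight_e.
by apply/funext => w /=; rewrite sumEFin.
Qed.

Lemma integrable_mxnorm n : (paths nu n).-integrable setT
  (EFin \o (fun w => mxnorm (prodmx v n w) `^ s)).
Proof.
apply: (@le_integrable _ _ _ _ setT _ _ (EFin \o (fun w =>
  (d.+1%:R `^ s / ec) * \sum_i weight s e (basis_pt R i) (prodmx v n w)))) => //.
- by apply/measurable_EFinP/measurable_mxnorm; exact: mxmeasurable_prodmx.
- move=> w _ /=; rewrite lee_fin ger0_norm ?powR_ge0//.
  exact: le_trans (mxnorm_le_weight _) (ler_norm _).
- exact/integrable_scale/integrable_sum_weight.
Qed.

Lemma integral_mxnorm_le n :
  \int[paths nu n]_w (mxnorm (prodmx v n w) `^ s) <= mxnorm_const * kap ^+ n.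
Proof.
apply: (@le_trans _ _ (\int[paths nu n]_w ((d.+1%:R `^ s / ec) *
    \sum_i weight s e (basis_pt R i) (prodmx v n w)))).
  apply: le_Rintegral => //; first exact: integrable_mxnorm.
    exact/integrable_scale/integrable_sum_weight.
  by move=> w _; exact: mxnorm_le_weight.
rewrite RintegralZl//; last exact: integrable_sum_weight.
rewrite /mxnorm_const -!mulrA ler_wpM2l ?powR_ge0//.
rewrite /Rintegral; under eq_integral do rewrite -sumEFin.
rewrite integral_sum//; last by move=> i; exact: integrable_weight_e.
rewrite (eq_bigr (fun i => (kap ^+ n * e (basis_pt R i))%:E)); last first.
  by move=> i _; exact: integral_weight_prodmx.
rewrite sumEFin /=.
have H : \sum_(i < d.+1) kap ^+ n * e (basis_pt R i) <=
    d.+1%:R * (kap ^+ n * eB).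
  rewrite (@le_trans _ _ (\sum_(i < d.+1) kap ^+ n * eB))//.
    by apply: ler_sum => i _; rewrite ler_wpM2l// exprn_ge0// ltW.
  by rewrite sumr_const card_ord mulr_natl.
rewrite (le_trans (ler_wpM2l _ H)) ?invr_ge0 ?(ltW ec_gt0)//.
by rewrite le_eqVlt; apply/orP; left; apply/eqP; ring.
Qed.

Lemma path_int_holder n phi (B : R) F (BF : R) X Y : hol B phi ->
  measurable_fun setT F -> (forall w, `|F w| <= BF) ->
  `|path_int n phi X F - path_int n phi Y F| <=
  BF * (B * (1 + K%:R)) * (mxnorm_const * kap ^+ n) * mdist X Y `^ alpha.
Proof.
move=> hphi mF FB; have cphi := hol_continuous hphi; have [phiB phih] := hphi.
have B0 := hol_ge0 hphi.
have BF0 : 0 <= BF by rewrite (le_trans _ (FB point)).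
have iX := integrable_path n X mF FB cphi phiB.
have iY := integrable_path n Y mF FB cphi phiB.
rewrite /path_int -RintegralB//.
have iXY : (paths nu n).-integrable setT (EFin \o (fun w =>
    F w * weight s phi X (prodmx v n w) - F w * weight s phi Y (prodmx v n w))).
  exact: integrable_EFinB.
rewrite (le_trans (le_normr_Rintegral _ iXY))//.
pose c := BF * (B * (1 + K%:R)) * mdist X Y `^ alpha.
have c0 : 0 <= c by rewrite !mulr_ge0 ?addr_ge0 ?powR_ge0.
apply: (@le_trans _ _ (\int[paths nu n]_w (c * mxnorm (prodmx v n w) `^ s))).
  apply: le_Rintegral => //; first exact: (integrable_norm iXY).
    exact/integrable_scale/integrable_mxnorm.
  move=> w _; rewrite -mulrBr normrM /c -!mulrA ler_pM//.
  rewrite (le_trans (weight_holder s_gt0 a_gt0 a_le1 a_le_s s_leK _ _ _ B0 phiB phih))//.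
  by rewrite le_eqVlt; apply/orP; left; apply/eqP; ring.
rewrite RintegralZl//; last exact: integrable_mxnorm.
rewrite [leRHS](_ : _ = c * (mxnorm_const * kap ^+ n)).
  by rewrite ler_wpM2l// integral_mxnorm_le.
by rewrite /c; ring.
Qed.

(** The first term bounds the supremum, the second the Hölder seminorm; 1 + K is the constant of
    [weight_holder] when both bounds on phi equal B. *)
Definition path_const : R := eB / ec + (1 + K%:R) * mxnorm_const.

Lemma path_const_ge0 : 0 <= path_const.
Proof.
have eB0 := ltW eB_gt0; have ec0 := ltW ec_gt0.
by rewrite addr_ge0 ?mulr_ge0 ?invr_ge0 ?addr_ge0 ?mxnorm_const_ge0.
Qed.

Lemma path_int_hol n phi (B : R) F (BF : R) : hol B phi ->
  measurable_fun setT F -> (forall w, `|F w| <= BF) ->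
  hol (path_const * BF * B * kap ^+ n) (fun X => path_int n phi X F).
Proof.
move=> hphi mF FB; have cphi := hol_continuous hphi; have [phiB phih] := hphi.
have B0 := hol_ge0 hphi.
have BF0 : 0 <= BF by rewrite (le_trans _ (FB point)).
have k0 : 0 <= kap ^+ n by rewrite exprn_ge0// ltW.
have ec0 := ltW ec_gt0.
have eB0 := ltW eB_gt0.
have m0 := mxnorm_const_ge0.
have K0 : 0 <= 1 + K%:R :> R by rewrite addr_ge0.
split=> [X|X Y].
  rewrite (le_trans (path_int_le n X mF FB cphi phiB))//.
  rewrite (@le_trans _ _ (BF * (B / ec) * (kap ^+ n * eB)))//.
    by rewrite ler_wpM2l ?mulr_ge0 ?invr_ge0// ler_wpM2l.
  rewrite (_ : BF * _ * _ = eB / ec * (BF * B * kap ^+ n)); last by ring.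
  rewrite -(mulrA _ BF) -(mulrA path_const) ler_wpM2r ?mulr_ge0//.
  by rewrite lerDl mulr_ge0.
rewrite (le_trans (path_int_holder n X Y hphi mF FB))//.
rewrite ler_wpM2r ?powR_ge0//.
rewrite (_ : BF * _ * _ = ((1 + K%:R) * mxnorm_const) * (BF * B * kap ^+ n));
  last by ring.
rewrite -(mulrA _ BF) -(mulrA path_const) ler_wpM2r ?mulr_ge0//.
by rewrite lerDr mulr_ge0 ?invr_ge0.
Qed.

(** * The transfer operator and a Hölder eigenfunction *)

Definition gamma_op phi X : R := \int[nu]_a weight s phi X (v a).

Lemma integrable_v_e X :
  nu.-integrable setT (EFin \o (fun a => weight s e X (v a))).
Proof.
apply/integrableP; split.
  by apply/measurable_EFinP; exact: measurable_weight_v.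
have e0 Y : 0 <= e Y := ltW (e_gt0' Y).
under eq_integral do rewrite /= ger0_norm ?weight_ge0//.
by rewrite -integral_weight_nu// e_eigen ltry.
Qed.

Lemma integrable_v phi X (Bp : R) : continuous phi ->
  (forall X, `|phi X| <= Bp) ->
  nu.-integrable setT (EFin \o (fun a => weight s phi X (v a))).
Proof.
move=> cphi phiB.
apply: (@le_integrable _ _ _ _ setT _ _ (EFin \o (fun a =>
  (Bp / ec) * weight s e X (v a)))) => //.
- by apply/measurable_EFinP; exact: measurable_weight_v.
- move=> a _ /=; rewrite lee_fin.
  exact: le_trans (weight_le_e _ _ phiB) (ler_norm _).
- exact/integrable_scale/integrable_v_e.
Qed.

Lemma gamma_op_e X : gamma_op e X = kap * e X.
Proof.
rewrite /gamma_op /Rintegral -integral_weight_nu ?e_eigen// => Y.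
exact/ltW/e_gt0'.
Qed.

Lemma gamma_op_le phi psi X (B B' : R) : continuous phi -> continuous psi ->
  (forall X, `|phi X| <= B) -> (forall X, `|psi X| <= B') ->
  (forall X, phi X <= psi X) -> gamma_op phi X <= gamma_op psi X.
Proof.
move=> cphi cpsi phiB psiB pp; apply: le_Rintegral => //.
- exact: (integrable_v X cphi phiB).
- exact: (integrable_v X cpsi psiB).
- by move=> a _; rewrite ler_wpM2r// powR_ge0.
Qed.

Lemma gamma_opZ phi X (B r : R) : continuous phi -> (forall X, `|phi X| <= B) ->
  gamma_op (fun Y => r * phi Y) X = r * gamma_op phi X.
Proof.
move=> cphi phiB; rewrite /gamma_op -RintegralZl//.
  by apply: eq_Rintegral => a _; rewrite /weight mulrA.
exact: (integrable_v X cphi phiB).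
Qed.

Lemma path_intS_cst n phi X (B : R) : hol B phi ->
  path_int n.+1 phi X (cst 1) =
  gamma_op (fun Y => path_int n phi Y (cst 1)) X.
Proof.
move=> hphi; have cphi := hol_continuous hphi; have [phiB phih] := hphi.
rewrite (path_intS (BF := 1) n X _ _ cphi phiB)//.
  by apply: eq_Rintegral => a _; rewrite /weight mulrC.
by move=> w /=; rewrite normr1.
Qed.

Lemma gamma_op_cvg (f : nat -> P -> R) g X (B : R) :
  (forall n, continuous (f n)) -> continuous g ->
  (forall n X, `|f n X| <= B) ->
  (forall X, f n X @[n --> \oo] --> g X) ->
  gamma_op (f n) X @[n --> \oo] --> gamma_op g X.
Proof.
move=> cf cg fB fg.
have gB Y : `|g Y| <= B.
  by apply: (cvgr_to_le (cvg_norm (fg Y))); apply: nearW => n; exact: fB.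
have iE := fun n => integrable_v X (cf n) (fB n).
have iG := integrable_v X cg gB.
suff : (\int[nu]_a (weight s (f n) X (v a))%:E)%E @[n --> \oo] -->
    (\int[nu]_a (weight s g X (v a))%:E)%E.
  move=> h; apply: fine_cvg; rewrite fineK//.
  exact: integrable_fin_num.
apply: (@dominated_cvg _ _ _ _ setT _ _ _
   (fun a => (B / ec * weight s e X (v a))%:E)) => //.
- by move=> n; apply/measurable_EFinP; exact: measurable_weight_v.
- move=> a _; apply: cvg_EFin; first by near=> n.
  by apply: cvgM; [exact: fg|exact: cvg_cst].
- exact: (integrable_scale _ (integrable_v_e X)).
- by move=> n a _; rewrite /= lee_fin; exact: weight_le_e.
Unshelve. all: by end_near. Qed.

Lemma lim_hol (f : nat -> P -> R) g (B : R) : (forall n, hol B (f n)) ->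
  (forall X, f n X @[n --> \oo] --> g X) -> hol B g.
Proof.
move=> hf fg; split=> [X|X Y].
  by apply: (cvgr_to_le (cvg_norm (fg X))); apply: nearW => n; exact: (hf n).1.
apply: (cvgr_to_le (cvg_norm (cvgB (fg X) (fg Y)))).
by apply: nearW => n; exact: (hf n).2.
Qed.

(** The lower limit is taken through increasing infima: these inherit the Hölder constant of the
    sequence, and monotonicity gives pointwise convergence without extracting subsequences. *)
Definition tail_inf (f : nat -> P -> R) N X :=
  inf [set f n X | n in [set n | (N <= n)%N]].

Section TailInf.
Variables (f : nat -> P -> R) (B : R).
Hypothesis hf : forall n, hol B (f n).

Let has_lb N X : has_lbound [set f n X | n in [set n | (N <= n)%N]].
Proof.
exists (- B) => _ [n _ <-]; have := (hf n).1 X.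
by rewrite ler_norml => /andP[].
Qed.

Lemma tail_inf_le N n X : (N <= n)%N -> tail_inf f N X <= f n X.
Proof. by move=> Nn; apply: ge_inf => //; exists n. Qed.

Lemma le_tail_inf N X r : (forall n, (N <= n)%N -> r <= f n X) ->
  r <= tail_inf f N X.
Proof.
move=> h; apply: lb_le_inf; first by exists (f N X), N => /=.
by move=> _ [n Nn <-]; exact: h.
Qed.

Lemma tail_inf_hol N : hol B (tail_inf f N).
Proof.
have le X Y : tail_inf f N X - tail_inf f N Y <= B * mdist X Y `^ alpha.
  rewrite lerBlDr -lerBlDl; apply: le_tail_inf => n Nn.
  rewrite lerBlDl (le_trans (tail_inf_le X Nn))//.
  rewrite -lerBlDr; exact: le_trans (ler_norm _) ((hf n).2 X Y).
split=> [X|X Y].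
  rewrite ler_norml; apply/andP; split.
    apply: le_tail_inf => n _; have := (hf n).1 X.
    by rewrite ler_norml => /andP[].
  rewrite (le_trans (tail_inf_le X (leqnn N)))//.
  by have := (hf N).1 X; rewrite ler_norml => /andP[].
by rewrite ler_norml le andbT lerNl opprB metric_sym; exact: le.
Qed.

Lemma tail_inf_nd X : nondecreasing_seq (tail_inf f ^~ X).
Proof.
move=> m n mn; apply: le_tail_inf => k nk.
by apply: tail_inf_le; exact: leq_trans nk.
Qed.

Lemma tail_inf_cvg X : cvgn (tail_inf f ^~ X).
Proof.
apply: nondecreasing_is_cvgn; first exact: tail_inf_nd.
exists B => _ [n _ <-]; have := (tail_inf_hol n).1 X.
by rewrite ler_norml => /andP[].
Qed.

Lemma tail_inf_le_lim N X : tail_inf f N X <= limn (tail_inf f ^~ X).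
Proof.
exact: (nondecreasing_cvgn_le (@tail_inf_nd X) (@tail_inf_cvg X)).
Qed.

End TailInf.

Let norm1 (w : Om) : `|cst 1 w| <= 1 :> R. Proof. by rewrite normr1. Qed.

Let meas1 : measurable_fun setT (cst 1 : Om -> R).
Proof. exact: measurable_cst. Qed.

Let kapn_gt0 n : 0 < kap ^+ n. Proof. exact: exprn_gt0. Qed.

Lemma hol_scale (B r : R) phi : 0 <= r -> hol B phi ->
  hol (r * B) (fun X => r * phi X).
Proof.
move=> r0 [h1 h2]; split=> [X|X Y].
  by rewrite normrM ger0_norm// ler_wpM2l.
by rewrite -mulrBr normrM ger0_norm// -mulrA ler_wpM2l.
Qed.

(** The n-th iterate of [gamma_op] / kap, written as a path integral so that its Hölder bound does
    not deteriorate with n. *)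
Definition normalized n phi X := (kap ^+ n)^-1 * path_int n phi X (cst 1).

Lemma normalized_hol n phi (B : R) : hol B phi ->
  hol (path_const * B) (normalized n phi).
Proof.
move=> hphi; have h := path_int_hol n hphi meas1 norm1.
have k0 : 0 <= (kap ^+ n)^-1 by rewrite invr_ge0 ltW.
have := hol_scale k0 h.
by rewrite mulr1 mulrC mulfK// gt_eqF.
Qed.

Lemma gamma_normalized n phi (B : R) X : hol B phi ->
  gamma_op (normalized n phi) X = kap * normalized n.+1 phi X.
Proof.
move=> hphi; have h := path_int_hol n hphi meas1 norm1.
rewrite (gamma_opZ X _ (hol_continuous h) h.1) -(path_intS_cst n X hphi).
by rewrite /normalized exprS invfM !mulrA divff ?mul1r// gt_eqF.
Qed.

Lemma normalized0 phi (B : R) X : hol B phi -> normalized 0 phi X = phi X.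
Proof.
move=> hphi; rewrite /normalized expr0 invr1 mul1r path_int0//.
  by rewrite mul1r.
exact: hol_continuous hphi.
Qed.

(** Positivity of the operator together with its eigenfunction: a lower bound by a multiple of [e]
    survives iteration, which keeps the limits away from 0. *)
Lemma gamma_op_ge_e (r B : R) phi X : hol B phi ->
  (forall Y, r * e Y <= phi Y) -> r * (kap * e X) <= gamma_op phi X.
Proof.
move=> hphi h.
have eB' Y : `|e Y| <= eB by rewrite ger0_norm ?e_leB// ltW// e_gt0'.
have rB Y : `|r * e Y| <= `|r| * eB by rewrite normrM ler_wpM2l.
rewrite -gamma_op_e -(gamma_opZ X r e_cont eB').
apply: (gamma_op_le X _ (hol_continuous hphi) rB hphi.1 h) => Y.
by apply: (@cvgM _ _ (nbhs Y) _ (cst r) e); [exact: cvg_cst|exact: e_cont].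
Qed.

(* With T = gamma_op / kap, the lower limit u of T^n 1 satisfies T u <= u, so T^n u
   decreases to a fixed function. *)
Lemma exists_holder_eigenfunction : exists w B c,
  [/\ hol B w, 0 < c, forall X, c <= w X &
      forall X, gamma_op w X = kap * w X].
Proof.
have h1 : hol 1 (cst 1 : P -> R) by exact: hol_cst.
pose h n := normalized n (cst 1).
have hh n : hol path_const (h n).
  by have := normalized_hol n h1; rewrite mulr1.
pose cl := ec / eB.
have cl0 : 0 < cl by rewrite divr_gt0// eB_gt0.
have eB0 := eB_gt0.
have hge n X : eB^-1 * e X <= h n X.
  elim: n X => [|n IH] X.
    rewrite /h (normalized0 X h1) /cst mulrC ler_pdivrMr// mul1r.
    exact: e_leB.
  rewrite -(ler_pM2l kap_gt0) -(gamma_normalized n X h1) mulrCA.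
  exact: gamma_op_ge_e (hh n) IH.
have hcl n X : cl <= h n X.
  apply: le_trans (hge n X); rewrite /cl mulrC ler_pM2l ?invr_gt0//.
pose u X := limn (tail_inf h ^~ X).
have ucvg X : tail_inf h n X @[n --> \oo] --> u X by exact: (tail_inf_cvg hh).
have hu : hol path_const u.
  by apply: (lim_hol (f := tail_inf h)) => // n; exact: (tail_inf_hol hh).
have ucl X : cl <= u X.
  apply: (le_trans _ (tail_inf_le_lim hh 0 X)).
  by apply: le_tail_inf => n _; exact: hcl.
(* For n >= N, monotonicity gives [gamma_op] (tail_inf h N) <= kap h_{n+1}. The infimum over n and
   then the limit in N, by dominated convergence, give the inequality. *)
have gu X : gamma_op u X <= kap * u X.
  apply: (cvgr_to_le (@gamma_op_cvg (tail_inf h) u X path_const _ _ _ ucvg)).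
  - by move=> n; exact: hol_continuous (tail_inf_hol hh n).
  - exact: hol_continuous hu.
  - by move=> n; exact: (tail_inf_hol hh n).1.
  apply: nearW => N; rewrite -ler_pdivrMl//.
  apply: (le_trans _ (tail_inf_le_lim hh N.+1 X)).
  apply: le_tail_inf => -[//|n] Nn; rewrite ler_pdivrMl//.
  rewrite /h -(gamma_normalized n X h1).
  apply: (gamma_op_le X (hol_continuous (tail_inf_hol hh N))
    (hol_continuous (hh n)) (tail_inf_hol hh N).1 (hh n).1) => Y.
  exact: (tail_inf_le hh).
pose f n := normalized n u.
have hf n : hol (path_const * path_const) (f n) by exact: normalized_hol.
have fS n X : gamma_op (f n) X = kap * f n.+1 X by exact: (gamma_normalized n X hu).
have gle n m : (forall X, f n X <= f m X) -> forall X, f n.+1 X <= f m.+1 X.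
  move=> nm X; rewrite -(ler_pM2l kap_gt0) -!fS.
  exact: (gamma_op_le X (hol_continuous (hf n)) (hol_continuous (hf m))
    (hf n).1 (hf m).1).
have fnd X : nonincreasing_seq (f ^~ X).
  apply/nonincreasing_seqP => n; elim: n X => [|n IH] X; last exact: gle.
  rewrite -(ler_pM2l kap_gt0) -fS (_ : f 0%N = u) ?gu//.
  by apply/funext => Y; exact: (normalized0 Y hu).
(* Without this lower bound the decreasing limit could be the zero function. *)
have fcl n X : cl * eB^-1 * e X <= f n X.
  elim: n X => [|n IH] X.
    rewrite /f (normalized0 X hu) (le_trans _ (ucl X))// -mulrA.
    by rewrite ler_piMr ?(ltW cl0)// mulrC ler_pdivrMr// mul1r.
  rewrite -(ler_pM2l kap_gt0) -fS mulrCA.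
  exact: gamma_op_ge_e (hf n) IH.
have fcvg X : cvgn (f ^~ X).
  apply: nonincreasing_is_cvgn => //.
  by exists (cl * eB^-1 * e X) => _ [n _ <-].
exists (fun X => limn (f ^~ X)), (path_const * path_const), (cl * cl).
have hw : hol (path_const * path_const) (fun X => limn (f ^~ X)).
  exact: (lim_hol hf).
split=> // [|X|X]; first by rewrite mulr_gt0.
  apply: (@cvgr_to_ge _ _ _ _ _ _ _ (fcvg X)); apply: nearW => n.
  apply: le_trans (fcl n X); rewrite -mulrA ler_pM2l// /cl mulrC ler_pM2l ?invr_gt0//.
have g1 := @gamma_op_cvg f _ X _ (fun n => hol_continuous (hf n))
  (hol_continuous hw) (fun n => (hf n).1) fcvg.
have g2 : gamma_op (f n) X @[n --> \oo] --> kap * limn (f ^~ X).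
  under eq_fun do rewrite fS.
  apply: cvgM; first exact: cvg_cst.
  by have := fcvg X; rewrite -(cvg_shiftS (f ^~ X)).
exact: (cvg_unique _ g1 g2).
Qed.

(** * The Markov property and the normalised operator *)

Definition depends_on n (F : Om -> R) :=
  forall w w' : Om, (forall i, (i < n)%N -> w i = w' i) -> F w = F w'.

(** The Markov property at time n: what follows enters only through the position reached. Induction
    on n peels off first letters; at n = 0, [depends_on] makes F1 constant. *)
Lemma path_int_split n p phi X (B : R) F1 F2 (BF1 BF2 : R) : hol B phi ->
  measurable_fun setT F1 -> (forall w, `|F1 w| <= BF1) -> depends_on n F1 ->
  measurable_fun setT F2 -> (forall w, `|F2 w| <= BF2) ->
  path_int (n + p) phi X (fun w => F1 w * F2 (iter n (@left_shift R A) w)) =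
  path_int n (fun Y => path_int p phi Y F2) X F1.
Proof.
move=> hphi + + + mF2 F2B.
have cphi := hol_continuous hphi.
have h' := path_int_hol p hphi mF2 F2B; have c' := hol_continuous h'.
elim: n X F1 => [|n IH] X F1 mF1 F1B dF1.
  rewrite path_int0// /path_int -RintegralZl//.
    apply: eq_Rintegral => w _ /=; rewrite mulrA; congr (_ * _ * _).
    by apply: dF1 => i.
  exact: (integrable_path p X mF2 F2B cphi hphi.1).
have FB w : `|F1 w * F2 (iter n.+1 (@left_shift R A) w)| <= BF1 * BF2.
  by rewrite normrM ler_pM.
have mF : measurable_fun setT
    (fun w => F1 w * F2 (iter n.+1 (@left_shift R A) w)).
  apply: measurable_funM => //.
  exact: (measurableT_comp mF2 (@measurable_iter_shift R A n.+1)).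
rewrite addSn (path_intS (n + p) X mF FB cphi hphi.1).
rewrite (path_intS n X mF1 F1B c' h'.1).
apply: eq_Rintegral => a _; congr (_ * _).
rewrite -IH//.
- by under eq_fun do rewrite iterSr shift_ocons.
- exact: (measurableT_comp mF1 (@measurable_ocons_cst _ _ a)).
- by move=> w w' ww'; apply: dF1 => -[|i]//= ilt; exact: ww'.
Qed.

Lemma path_intDl n phi X (B : R) F1 F2 (BF1 BF2 : R) : hol B phi ->
  measurable_fun setT F1 -> (forall w, `|F1 w| <= BF1) ->
  measurable_fun setT F2 -> (forall w, `|F2 w| <= BF2) ->
  path_int n phi X (fun w => F1 w + F2 w) =
  path_int n phi X F1 + path_int n phi X F2.
Proof.
move=> hphi mF1 F1B mF2 F2B; have cphi := hol_continuous hphi.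
rewrite /path_int -RintegralD//.
- by apply: eq_Rintegral => w _; rewrite mulrDl.
- exact: (integrable_path n X mF1 F1B cphi hphi.1).
- exact: (integrable_path n X mF2 F2B cphi hphi.1).
Qed.

Lemma path_intZr n phi X (B r : R) F (BF : R) : hol B phi ->
  measurable_fun setT F -> (forall w, `|F w| <= BF) ->
  path_int n (fun Y => r * phi Y) X F = r * path_int n phi X F.
Proof.
move=> hphi mF FB; have cphi := hol_continuous hphi.
rewrite /path_int -RintegralZl//.
  by apply: eq_Rintegral => w _; rewrite /weight; ring.
exact: (integrable_path n X mF FB cphi hphi.1).
Qed.

Lemma path_intBr n phi psi X (B B' : R) F (BF : R) : hol B phi -> hol B' psi ->
  measurable_fun setT F -> (forall w, `|F w| <= BF) ->
  path_int n (fun Y => phi Y - psi Y) X F =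
  path_int n phi X F - path_int n psi X F.
Proof.
move=> hphi hpsi mF FB.
rewrite /path_int -RintegralB//.
- by apply: eq_Rintegral => w _; rewrite /weight; ring.
- exact: (integrable_path n X mF FB (hol_continuous hphi) hphi.1).
- exact: (integrable_path n X mF FB (hol_continuous hpsi) hpsi.1).
Qed.

Variable eH : R.
Hypothesis e_hol : hol eH e.

(** The Doob transform of [gamma_op] by [e]: the real, [nu]-integrated form of Q_s, identified with
    [Qop] in [QopE]. *)
Definition markov phi X := (kap * e X)^-1 * gamma_op (fun Y => phi Y * e Y) X.

Lemma hol_mul (B B' : R) phi psi : hol B phi -> hol B' psi ->
  hol (2 * (B * B')) (fun X => phi X * psi X).
Proof.
move=> h h'; have B0 := hol_ge0 h; have B'0 := hol_ge0 h'.
move: h h' => [h1 h2] [h1' h2']; split=> [X|X Y].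
  rewrite normrM (@le_trans _ _ (B * B'))//; first by rewrite ler_pM.
  by rewrite ler_peMl ?mulr_ge0// ler1n.
have -> : phi X * psi X - phi Y * psi Y =
    phi X * (psi X - psi Y) + (phi X - phi Y) * psi Y by ring.
rewrite (le_trans (ler_normD _ _))// !normrM.
rewrite (_ : 2 * (B * B') * _ = B * (B' * mdist X Y `^ alpha) +
   B * mdist X Y `^ alpha * B'); last by ring.
by rewrite lerD// ler_pM.
Qed.

Lemma hol_inv_e : hol (ec^-1 + eH * ec^-1 ^+ 2) (fun X => (e X)^-1).
Proof.
have [h1 h2] := e_hol; have eH0 := hol_ge0 e_hol.
have einv X : 0 <= (e X)^-1 <= ec^-1.
  rewrite invr_ge0 ltW ?e_gt0'//= lef_pV2 ?posrE ?e_gt0'//.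
split=> [X|X Y].
  have /andP[i0 i1] := einv X.
  by rewrite ger0_norm// (le_trans i1)// lerDl mulr_ge0// sqr_ge0.
have -> : (e X)^-1 - (e Y)^-1 = (e Y - e X) * ((e X)^-1 * (e Y)^-1).
  by field; rewrite !gt_eqF ?e_gt0'.
have /andP[i0 i1] := einv X; have /andP[j0 j1] := einv Y.
rewrite normrM (ger0_norm (mulr_ge0 i0 j0)).
apply: (@le_trans _ _ ((eH * mdist X Y `^ alpha) * (ec^-1 * ec^-1))).
  rewrite ler_pM ?mulr_ge0//; last by rewrite ler_pM.
  by rewrite distrC.
rewrite (_ : _ * _ * _ = eH * ec^-1 ^+ 2 * mdist X Y `^ alpha); last by ring.
by rewrite ler_wpM2r ?powR_ge0// lerDr invr_ge0 ltW.
Qed.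

(** Each use of [hol_mul] costs a factor 2, once for phi e and once for the division by e; the last
    factor is the bound of [hol_inv_e]. *)
Definition ratio_const : R := 4 * path_const * eH * (ec^-1 + eH * ec^-1 ^+ 2).

Lemma ratio_const_ge0 : 0 <= ratio_const.
Proof.
rewrite /ratio_const mulr_ge0 ?(hol_ge0 hol_inv_e)//.
by rewrite mulr_ge0 ?(hol_ge0 e_hol)// mulr_ge0 ?path_const_ge0.
Qed.

Lemma ratio_hol n phi (B : R) F (BF : R) : hol B phi ->
  measurable_fun setT F -> (forall w, `|F w| <= BF) ->
  hol (ratio_const * B * BF)
    (fun X => (kap ^+ n * e X)^-1 * path_int n (fun Y => phi Y * e Y) X F).
Proof.
move=> hphi mF FB.
have h := path_int_hol n (hol_mul hphi e_hol) mF FB.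
have k0 : 0 <= (kap ^+ n)^-1 by rewrite invr_ge0 ltW.
have := hol_mul (hol_scale k0 h) hol_inv_e.
rewrite (_ : _ * (_ * _) = ratio_const * B * BF); last first.
  rewrite /ratio_const; field; rewrite ?gt_eqF//.
congr hol; apply/funext => X; rewrite invfM; ring.
Qed.

Lemma path_int_markov n phi X (B : R) : hol B phi ->
  path_int n (fun Y => phi Y * e Y) X (cst 1) =
  kap ^+ n * e X * iter n markov phi X.
Proof.
move=> hphi; have hpe := hol_mul hphi e_hol.
elim: n X => [|n IH] X.
  rewrite path_int0//; last exact: hol_continuous hpe.
  by rewrite expr0 !mul1r mulrC.
rewrite (path_intS_cst n X hpe) (_ : (fun Y => path_int n _ Y _) =
    (fun Y => kap ^+ n * (iter n markov phi Y * e Y))); last first.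
  by apply/funext => Y; rewrite IH -mulrA (mulrC (e Y)).
have h : hol (((kap ^+ n)^-1) * (path_const * 1 * (2 * (B * eH)) * kap ^+ n))
    (fun Y => iter n markov phi Y * e Y).
  have := hol_scale (ltW _) (path_int_hol n hpe meas1 norm1).
  move=> /(_ (kap ^+ n)^-1); rewrite invr_gt0 => /(_ (kapn_gt0 n)).
  congr hol; apply/funext => Y; rewrite IH mulrA mulrA mulVf ?gt_eqF// mul1r.
  by rewrite mulrC.
rewrite (gamma_opZ X _ (hol_continuous h) h.1) iterS /markov.
by rewrite exprS; field; rewrite !gt_eqF ?e_gt0'.
Qed.

(** * Expectations under the path laws *)

Hypothesis kapE : kappa mu v s = kap.
Variable QX : P -> probability Om R.
Hypothesis QX_law : forall X, path_law mu v s e X (QX X).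

Lemma qnE n X (w : M) :
  qn mu v s e n X w = (kap ^+ n * e X)^-1 * weight s e X w.
Proof.
rewrite /qn kapE; case: eqVneq => wX.
  by rewrite weight0 ?mulr0//; apply/eqP; rewrite growth_eq0 wX.
rewrite /weight actE growthE invfM; ring.
Qed.

Let e0 X : 0 <= e X := ltW (e_gt0' X).

Let dens_ge0 n X w : 0 <= (kap ^+ n * e X)^-1 * weight s e X w.
Proof. by rewrite mulr_ge0 ?weight_ge0// invr_ge0 mulr_ge0 ?(ltW (kapn_gt0 n)). Qed.

Let mdens n X : measurable_fun setT
  (fun w => (kap ^+ n * e X)^-1 * weight s e X (prodmx v n w)).
Proof.
by apply: measurable_funM => //; exact: measurable_weight_prodmx.
Qed.

Lemma QX_first_coords n X B : (0 < n)%N -> measurable B ->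
  (QX X (@first_coords R A n @^-1` B) =
   \int[paths nu n]_w ((kap ^+ n * e X)^-1 * weight s e X (prodmx v n w) *
     \1_B (first_coords n w))%:E)%E.
Proof.
move=> n0 mB; rewrite (QX_law X n0 mB).
have mw : mxmeasurable (fun t : n.-tuple (borel A) => cocycle v t).
  rewrite (_ : (fun t => _) = prodmx v n \o @extend R A n).
    exact: (mxmeasurable_comp (mxmeasurable_prodmx mv n) (@measurable_extend _ _ n)).
  apply/funext => t /=; rewrite -cocycle_first_coords; congr cocycle.
  apply: (@eq_from_nth _ (point : A)); first by rewrite !size_tuple.
  move=> j; rewrite size_tuple => ilt.
  rewrite -[j]/(nat_of_ord (Ordinal ilt)) -[RHS]tnth_nth tnth_mktuple//.
rewrite (@product_integralE _ _ _ _ mu nu nuE n).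
- by apply: eq_integral => w _; rewrite qnE cocycle_first_coords.
- apply/measurable_EFinP; apply: measurable_funM => //.
  under eq_fun do rewrite qnE.
  by apply: measurable_funM => //; exact: measurable_weight.
- by move=> t; rewrite lee_fin qnE mulr_ge0.
(* A letter at which [v] vanishes makes the whole product zero: this is the condition allowing [mu]
   to be exchanged for [nu]. *)
- move=> t [a at_ va]; rewrite qnE (_ : cocycle v t = 0).
    by rewrite weight0 ?mulr0 ?mul0r//; apply/eqP; rewrite growth_eq0 mul0mx.
  elim: (tval t) at_ => [//|b l IH]; rewrite in_cons cocycle_cons.
  by move=> /orP[/eqP<-|/IH->]; rewrite ?va ?mulmx0 ?mul0mx.
Qed.

Lemma QX_integral_ge0 n X (H : Om -> R) : (0 < n)%N ->
  measurable_fun setT H -> (forall w, 0 <= H w) ->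
  (\int[QX X]_w (H (trunc n w))%:E =
   \int[paths nu n]_w (((kap ^+ n * e X)^-1 * weight s e X (prodmx v n w)) *
     H (trunc n w))%:E)%E.
Proof.
move=> n0 mH H0.
pose H' (t : n.-tuple (borel A)) := (H (extend t))%:E.
have mH' : measurable_fun setT H'.
  by apply/measurable_EFinP; exact: (measurableT_comp mH (@measurable_extend _ _ n)).
have H'0 t : (0 <= H' t)%E by rewrite lee_fin.
transitivity (\int[QX X]_w (H' \o @first_coords R A n) w)%E.
  by apply: eq_integral => w _; rewrite /= /H' extend_first_coords.
rewrite -ge0_integral_distribution//.
rewrite (@ge0_integral_mixture _ _ Om _ R (paths nu n)
  (fun w => \d_(first_coords n w))
  (fun w => (kap ^+ n * e X)^-1 * weight s e X (prodmx v n w)))//.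
- apply: eq_integral => w _; rewrite integral_dirac// diracT mul1e EFinM.
  by rewrite /H' extend_first_coords.
- move=> B mB; rewrite /dirac; apply/measurable_EFinP.
  have mI : measurable_fun setT (\1_B : n.-tuple (borel A) -> R).
    exact: measurable_indic.
  exact: (measurableT_comp mI (@measurable_first_coords _ _ n)).
- by move=> B mB; rewrite -[LHS]/(QX X (first_coords n @^-1` B)) QX_first_coords.
Qed.

(** The nonnegative case applied to H + B; the contribution of the constant B cancels because the
    path integral of 1 against [e] is exactly kap^n e(X). *)
Lemma QX_integral n X (H : Om -> R) (B : R) : (0 < n)%N ->
  measurable_fun setT H -> (forall w, `|H w| <= B) -> depends_on n H ->
  \int[QX X]_w H w = (kap ^+ n * e X)^-1 * path_int n e X H.
Proof.
move=> n0 mH HB dH.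
have B0 : 0 <= B by rewrite (le_trans _ (HB point)).
have HE w : H (trunc n w) = H w.
  by apply: dH => i ilt; rewrite /trunc ilt.
have HB0 w : 0 <= H w + B.
  by rewrite -lerBlDr sub0r; have := HB w; rewrite ler_norml => /andP[].
have mHB : measurable_fun setT (fun w => H w + B) by exact: measurable_funD.
have cstB (w : Om) : `|cst B w| <= B by rewrite ger0_norm.
have := QX_integral_ge0 X n0 mHB HB0.
under eq_integral do rewrite HE.
under [X in _ = X -> _]eq_integral do rewrite HE.
move=> /(congr1 fine).
rewrite -![fine _]/(Rintegral _ _ _) RintegralD//; last 2 first.
- exact: bounded_integrable HB.
- exact: bounded_integrable cstB.
rewrite (_ : \int[QX X]_w cst B w = B); last first.
  by rewrite Rintegral_cst//= -[X in fine X]/(QX X setT) probability_setT mulr1.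
rewrite (_ : \int[paths nu n]_w _ = (kap ^+ n * e X)^-1 *
    path_int n e X (fun w => H w + B)); last first.
  rewrite /path_int -RintegralZl//.
    by apply: eq_Rintegral => w _; ring.
  have HBB w : `|H w + B| <= B + B.
    by rewrite (le_trans (ler_normD _ _))// (ger0_norm B0) lerD2r.
  exact: (integrable_path n X mHB HBB e_cont e_hol.1).
rewrite (path_intDl n X e_hol mH HB (measurable_cst _) cstB).
rewrite mulrDr (_ : path_int n e X (cst B) = B * (kap ^+ n * e X)); last first.
  rewrite -path_int_e -(path_intZr n X B e_hol meas1 norm1) /path_int.
  by apply: eq_Rintegral => w _; rewrite /weight /=; ring.
rewrite [in X in _ = _ + X]mulrC mulfK; first exact: addIr.
by rewrite gt_eqF// mulr_gt0 ?e_gt0'.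
Qed.

Variables (eta : probability (borel P) R) (QQ : probability Om R).
Hypothesis QQ_mix : forall B, measurable B -> (QQ B = \int[eta]_X QX X B)%E.

Lemma measurable_borel_continuous phi : continuous phi ->
  measurable_fun setT (phi : borel P -> R).
Proof.
move=> cphi; apply: (measurability _ (RGenOInfty.measurableE R)) => //.
move=> _ [_ [a ->] <-]; rewrite setTI; apply: sub_sigma_algebra.
by move/continuousP : cphi; apply; exact: interval_open.
Qed.

Lemma ratio_hol_e n F (BF : R) : measurable_fun setT F ->
  (forall w, `|F w| <= BF) ->
  hol (ratio_const * BF) (fun X => (kap ^+ n * e X)^-1 * path_int n e X F).
Proof.
move=> mF FB; have := ratio_hol n (@hol_cst 1 ler01) mF FB; rewrite mulr1.
rewrite (_ : (fun Y => cst 1 Y * e Y) = e)//.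
by apply/funext => Y; rewrite /= mul1r.
Qed.

Let mpre n B : measurable B -> measurable (@first_coords R A n @^-1` B).
Proof.
by move=> mB; rewrite -[X in measurable X]setTI; exact: measurable_first_coords.
Qed.

(** The probability of a cylinder is a normalised path integral of an indicator, hence Hölder, and
    so continuous, in X. *)
Lemma measurable_QX_first_coords n B : (0 < n)%N -> measurable B ->
  measurable_fun setT (fun X : borel P => QX X (@first_coords R A n @^-1` B)).
Proof.
move=> n0 mB; pose I : Om -> R := \1_(@first_coords R A n @^-1` B).
have mI : measurable_fun setT I by apply: measurable_indic; exact: mpre.
have I1 w : `|I w| <= 1 by rewrite /I indicE; case: (_ \in _); rewrite ?normr1 ?normr0.
have dI : depends_on n I.
  have IE w : I w = \1_B (first_coords n w).
    by rewrite /I !indicE; congr ((nat_of_bool _)%:R); apply/idP/idP; rewrite !inE.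
  move=> w w' ww'; rewrite !IE; congr (\1_B _); apply: eq_from_tnth => j.
  by rewrite !tnth_mktuple ww'.
rewrite (_ : (fun X => _) = EFin \o (fun X : borel P =>
   (kap ^+ n * e X)^-1 * path_int n e X I)).
  apply/measurable_EFinP; apply: measurable_borel_continuous.
  exact: hol_continuous (ratio_hol_e n mI I1).
apply/funext => X /=; rewrite -(QX_integral X n0 mI I1 dI).
rewrite /Rintegral integral_indic ?setIT//; last exact: mpre.
by rewrite fineK// fin_num_measure//; exact: mpre.
Qed.

Lemma QQ_integral_ge0 n (H : Om -> R) : (0 < n)%N ->
  measurable_fun setT H -> (forall w, 0 <= H w) ->
  (\int[QQ]_w (H (trunc n w))%:E =
   \int[eta]_X \int[QX X]_w (H (trunc n w))%:E)%E.
Proof.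
move=> n0 mH H0.
pose H' (t : n.-tuple (borel A)) := (H (extend t))%:E.
have mH' : measurable_fun setT H'.
  by apply/measurable_EFinP; exact: (measurableT_comp mH (@measurable_extend _ _ n)).
have H'0 t : (0 <= H' t)%E by rewrite lee_fin.
have HE (Q : probability Om R) : (\int[Q]_w (H (trunc n w))%:E =
    \int[distribution Q (@first_coords R A n)]_t H' t)%E.
  rewrite ge0_integral_distribution//.
  by apply: eq_integral => w _; rewrite /= /H' extend_first_coords.
rewrite HE (@ge0_integral_mixture _ _ (borel P) _ R eta
  (fun X => distribution (QX X) (@first_coords R A n)) (cst 1))//.
- by apply: eq_integral => X _; rewrite HE mul1e.
- by move=> B mB; exact: measurable_QX_first_coords.
- move=> B mB; rewrite -[LHS]/(QQ (first_coords n @^-1` B)) QQ_mix; last exact: mpre.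
  by apply: eq_integral => X _; rewrite mul1e.
Qed.

Lemma QQ_integral n (H : Om -> R) (B : R) : (0 < n)%N ->
  measurable_fun setT H -> (forall w, `|H w| <= B) -> depends_on n H ->
  \int[QQ]_w H w =
  \int[eta]_X ((kap ^+ n * e X)^-1 * path_int n e X H).
Proof.
move=> n0 mH HB dH.
have B0 : 0 <= B by rewrite (le_trans _ (HB point)).
have HE w : H (trunc n w) = H w.
  by apply: dH => j jlt; rewrite /trunc jlt.
have HB0 w : 0 <= H w + B.
  by rewrite -lerBlDr sub0r; have := HB w; rewrite ler_norml => /andP[].
have mHB : measurable_fun setT (fun w => H w + B) by exact: measurable_funD.
have cstB (T : Type) (w : T) : `|cst B w| <= B by rewrite ger0_norm.
have iH (Q : probability Om R) := bounded_integrable Q mH HB.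
have iB (Q : probability Om R) : Q.-integrable setT (EFin \o cst B).
  exact: (bounded_integrable Q _ (cstB _)).
have sumE (Q : probability Om R) :
    (\int[Q]_w (H w + B)%:E = (\int[Q]_w H w + B)%:E)%E.
  have iHB : Q.-integrable setT (EFin \o (fun w => H w + B)).
    by apply: (@bounded_integrable _ _ _ _ _ (B + B)) => // w;
      rewrite (le_trans (ler_normD _ _))// (ger0_norm B0) lerD2r.
  rewrite -[LHS]fineK; last exact: integrable_fin_num.
  rewrite -[fine _]/(Rintegral _ _ _) RintegralD//; [|exact: iH|exact: iB].
  rewrite (_ : \int[Q]_w cst B w = B)//.
  by rewrite Rintegral_cst//= -[X in fine X]/(Q setT) probability_setT mulr1.
have := QQ_integral_ge0 n0 mHB HB0.
under eq_integral do rewrite HE.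
under [X in _ = X -> _]eq_integral => X _.
  under eq_integral do rewrite HE.
  rewrite sumE (QX_integral X n0 mH HB dH).
  over.
rewrite sumE => /(congr1 fine) /=.
have hr := ratio_hol_e n mH HB.
have mr := measurable_borel_continuous (hol_continuous hr).
rewrite -[fine _]/(Rintegral _ _ _) RintegralD//; last 2 first.
- exact: (bounded_integrable _ mr hr.1).
- exact: (bounded_integrable _ _ (cstB _)).
rewrite (_ : \int[eta]_w B = B).
  exact: addIr.
by rewrite Rintegral_cst//= -[X in fine X]/(eta setT) probability_setT mulr1.
Qed.

Lemma Rintegral_restr (G : borel A -> R) : measurable_fun setT G ->
  (forall a, (v a : M) = 0 -> G a = 0) -> \int[mu]_a G a = \int[nu]_a G a.
Proof.
move=> mG G0; congr fine; rewrite integralE [RHS]integralE.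
have mEG : measurable_fun setT (EFin \o G) by exact/measurable_EFinP.
congr (_ - _)%E; apply: nuE => //.
- exact: measurable_funepos.
- by move=> a va; rewrite funeposE /= G0// maxxx.
- exact: measurable_funeneg.
- by move=> a va; rewrite funenegE /= G0// oppr0 maxxx.
Qed.

Lemma GammaE phi X : continuous phi -> Gamma mu v s phi X = gamma_op phi X.
Proof.
move=> cphi; rewrite /Gamma /gamma_op -Rintegral_restr.
- apply: eq_Rintegral => a _; case: eqVneq => wX.
    by rewrite weight0//; apply/eqP; rewrite growth_eq0 wX.
  by rewrite /weight actE growthE.
- exact: measurable_weight_v.
- by move=> a; exact: weight_v0.
Qed.

Lemma QopE phi X (B : R) : hol B phi -> Qop mu v s e phi X = markov phi X.
Proof.
move=> hphi; have h := hol_mul hphi e_hol; have ch := hol_continuous h.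
rewrite /Qop /markov /gamma_op.
have mw := measurable_weight_v X ch.
have w0 (a : borel A) (va : (v a : M) = 0) := weight_v0 (fun Y => phi Y * e Y) X va.
rewrite -RintegralZl//; last exact: integrable_v h.1.
rewrite -Rintegral_restr; last 2 first.
- exact: measurable_funM.
- by move=> a va; rewrite w0 ?mulr0.
apply: eq_Rintegral => a _; case: eqVneq => wX.
  by rewrite weight0 ?mulr0//; apply/eqP; rewrite growth_eq0 wX.
rewrite qnE expr1 /weight actE growthE; ring.
Qed.

Lemma iter_markov_hol n phi (B : R) : hol B phi ->
  hol (ratio_const * B) (iter n markov phi).
Proof.
move=> hphi; have := ratio_hol n hphi meas1 norm1; rewrite mulr1.
congr hol; apply/funext => X; rewrite (path_int_markov n X hphi) mulKf//.
by rewrite gt_eqF// mulr_gt0 ?kapn_gt0 ?e_gt0'.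
Qed.

(** The spectral hypothesis concerns complex functions, whereas all estimates above are real; on
    real functions [QopC] acts as [markov]. *)
Definition complexified phi : P -> R[i]^o := fun X => (phi X)%:C.

Lemma holder_norm_complexified phi (B : R) : hol B phi ->
  (holder_norm alpha (complexified phi) <= (B + B)%:E)%E.
Proof.
move=> hphi; have B0 := hol_ge0 hphi; move: hphi => [h1 h2].
have normC (x : R) : Normc.normc (x%:C) = `|x|.
  by rewrite /= expr0n addr0 sqrtr_sqr.
apply: holder_norm_le => // [X|X Y]; first by rewrite normC.
by rewrite /complexified -rmorphB normC.
Qed.

Lemma QopC_complexified phi (B : R) : hol B phi ->
  QopC mu v s e (complexified phi) = complexified (markov phi).
Proof.
move=> hphi; apply/funext => X; rewrite /QopC /complexified /=.
rewrite (QopE X hphi) (QopE X (hol_cst (lexx 0))).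
congr (_ +i* _); rewrite /markov /gamma_op.
by rewrite /Rintegral integral0_eq ?mulr0// => a _; rewrite /weight !mul0r.
Qed.

Lemma iter_QopC n phi (B : R) : hol B phi ->
  iter n (QopC mu v s e) (complexified phi) = complexified (iter n markov phi).
Proof.
move=> hphi; elim: n => [//|n IH].
by rewrite !iterS IH (QopC_complexified (iter_markov_hol n hphi)).
Qed.

Lemma markov1 : markov (cst 1) = cst 1.
Proof.
apply/funext => X; rewrite /markov (_ : (fun Y => _) = e).
  by rewrite gamma_op_e mulVf// gt_eqF// mulr_gt0// e_gt0'.
by apply/funext => Y; rewrite mul1r.
Qed.

(** * Convergence of the averaged iterates *)

Hypothesis eta_inv : invariant_probability mu v s e eta.
Hypothesis Q_spectrum : peripheral_spectrum_of_Q mu v s e alpha.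
Variable m : nat.
Hypothesis m_gt0 : (0 < m)%N.
Hypothesis m_card : (peripheral_eigenvalues (@holder_norm R d alpha)
  (QopC mu v s e) #= `I_m)%card.

Lemma integral_iter_markov n phi (B : R) : hol B phi ->
  \int[eta]_X iter n markov phi X = \int[eta]_X phi X.
Proof.
move=> hphi; elim: n => [//|n IH]; rewrite -IH -[RHS]eta_inv; last first.
  exact: hol_continuous (iter_markov_hol n hphi).
by apply: eq_Rintegral => X _; rewrite (QopE X (iter_markov_hol n hphi)).
Qed.

Definition cesaro_markov n phi X : R :=
  m%:R^-1 * \sum_(j < m) iter (m * n + j) markov phi X.

Lemma integral_cesaro_markov n phi (B : R) : hol B phi ->
  \int[eta]_X cesaro_markov n phi X = \int[eta]_X phi X.
Proof.
move=> hphi; have mc k : measurable_fun setT (iter k markov phi : borel P -> R).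
  exact: measurable_borel_continuous (hol_continuous (iter_markov_hol k hphi)).
have ih k := bounded_integrable eta (mc k) (iter_markov_hol k hphi).1.
have isum : eta.-integrable setT
    (EFin \o (fun X => \sum_(j < m) iter (m * n + j) markov phi X)).
  rewrite (_ : EFin \o _ =
      (fun X => \sum_(j < m) (iter (m * n + j) markov phi X)%:E)%E).
    by apply: integrable_sum => // j _; exact: ih.
  by apply/funext => X /=; rewrite sumEFin.
rewrite RintegralZl// Rintegral_sum//.
under eq_bigr do rewrite (integral_iter_markov _ hphi).
by rewrite sumr_const card_ord -[X in _ * X]mulr_natl mulKf// pnatr_eq0 -lt0n.
Qed.

Lemma cesaro_markov_le n phi X (B : R) : hol B phi ->
  `|cesaro_markov n phi X| <= ratio_const * B.
Proof.
move=> hphi; rewrite /cesaro_markov normrM ger0_norm ?invr_ge0//.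
rewrite ler_pdivrMl ?ltr0n// (le_trans (ler_norm_sum _ _ _))//.
rewrite (@le_trans _ _ (\sum_(j < m) (ratio_const * B)))//.
  by apply: ler_sum => j _; exact: (iter_markov_hol (m * n + j) hphi).1.
by rewrite sumr_const card_ord mulr_natl.
Qed.

(** The gap gives closeness to an unspecified constant c. Averaging preserves the [eta]-integral, so
    integrating that estimate places Re c within the same error of the integral of phi. *)
Lemma cesaro_markov_cvg : exists C lam : R, [/\ 0 < C, 0 < lam, lam < 1 &
  forall phi (B : R), hol B phi -> forall n X,
    `|cesaro_markov n phi X - \int[eta]_X phi X| <= C * B * lam ^+ n].
Proof.
have [T_qc T_rad [p [p_gt0 perE simp]]] := Q_spectrum.
have pm : p = m by apply: (@card_roots_of_unity R); rewrite -perE.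
pose one : P -> R[i]^o := complexified (cst 1).
have h1 : hol 1 (cst 1 : P -> R) by exact: hol_cst.
have T_one : QopC mu v s e one = one.
  by rewrite /one (QopC_complexified h1) markov1.
have one0 : one != 0.
  by apply/eqP => /(congr1 (@^~ point)) /= [] /eqP; rewrite oner_eq0.
have oneN : normed_space (@holder_norm R d alpha) one.
  exact: bound_normed (holder_norm_complexified h1).
have T_per z : peripheral_eigenvalues (@holder_norm R d alpha) (QopC mu v s e) z ->
    z ^+ m = 1 /\ simple_eigenvalue (normed_space (@holder_norm R d alpha))
      (QopC mu v s e) z.
  move=> zp; split; last exact: simp.
  move: zp; rewrite perE => -[l _ <-]; rewrite -pm.
  exact: root_of_unity_exp.
have rc0 := ratio_const_ge0.
have C1_ge1 : 1 <= ratio_const + 1 by rewrite lerDr.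
have [C [lam [C0 lam0 lam1 [k0 gap]]]] :=
  spectral_gap (@holder_norm_triangle R d alpha) (@holder_norm_scale R d alpha)
    m_gt0 T_one one0 oneN T_qc T_rad T_per C1_ge1.
have gap_pos phi (B : R) : 0 < B -> hol B phi -> forall n X, (k0 <= n)%N ->
    `|cesaro_markov n phi X - \int[eta]_X phi X| <= 4 * C * B * lam ^+ n.
  move=> B0 hphi.
  have [|||c cE] := gap (complexified phi) (B + B).
  - exact: addr_gt0.
  - exact: holder_norm_complexified.
  - move=> k; rewrite (iter_QopC k hphi).
    rewrite (le_trans (holder_norm_complexified (iter_markov_hol k hphi)))//.
    by rewrite lee_fin -mulrDr ler_wpM2r ?lerDl// addr_ge0// ltW.
  have close n X : (k0 <= n)%N ->
      `|cesaro_markov n phi X - complex.Re c| <= C * (B + B) * lam ^+ n.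
    move=> /cE /holder_norm_ge[a [b [b0 ab ha _]]].
    apply: (@le_trans _ _ a); last by rewrite (le_trans _ ab)// lerDl.
    rewrite (le_trans _ (ha X))//.
    have -> : (cesaro (QopC mu v s e) m n (complexified phi) - c *: one) X =
        (cesaro_markov n phi X)%:C - c.
      have -> : (cesaro (QopC mu v s e) m n (complexified phi) - c *: one) X =
        m%:R^-1 * (\sum_(j < m) iter (m * n + j) (QopC mu v s e)
          (complexified phi)) X - c * one X by [].
      rewrite mulr1 fct_sumE /cesaro_markov rmorphM fmorphV rmorph_nat rmorph_sum.
      congr (_ * _ - _); apply: eq_bigr => j _.
      by rewrite (iter_QopC _ hphi).
    case: (c) => x y /=.
    by rewrite -sqrtr_sqr ler_wsqrtr// lerDl sqr_ge0.
  move=> n X nk.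
  have mc : measurable_fun setT (cesaro_markov n phi : borel P -> R).
    apply: measurable_funM => //; apply: measurable_sum => j.
    exact: measurable_borel_continuous (hol_continuous (iter_markov_hol _ hphi)).
  have := probability_integral_dist eta mc (fun X => cesaro_markov_le n X hphi)
    (fun X => close n X nk).
  rewrite (integral_cesaro_markov n hphi) => int_close.
  have := close n X nk.
  rewrite (_ : 4 * C * B * lam ^+ n =
    C * (B + B) * lam ^+ n + C * (B + B) * lam ^+ n); last by ring.
  move=> close_n; rewrite -(subrK (complex.Re c) (cesaro_markov n phi X)) -addrA.
  rewrite (le_trans (ler_normD _ _))// lerD//.
  by rewrite distrC.
(* The 4 combines the norm bound 2 B with two uses of the estimate. The second term serves n < k0,
   where the trivial bound (ratio_const + 1) B suffices since lam^n >= lam^k0. *)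
exists (4 * C + (ratio_const + 1) * lam ^- k0), lam; split => //.
  by rewrite ltr_wpDr ?mulr_gt0// mulr_ge0 ?addr_ge0// invr_ge0 exprn_ge0// ltW.
move=> phi B hphi n X.
have B0 := hol_ge0 hphi.
have l0 k : 0 < lam ^+ k by exact: exprn_gt0.
have [nk|nk] := leqP k0 n.
  (* B may be 0 while the gap requires a positive bound, so B is enlarged by an amount costing
     exactly eps. *)
  apply/ler_addgt0Pr => eps eps0.
  pose eps' := eps / (4 * C * lam ^+ n).
  have eps'0 : 0 < eps' by rewrite divr_gt0// !mulr_gt0.
  have := gap_pos phi (B + eps') _ _ n X nk.
  move=> /(_ (ltr_wpDl B0 eps'0) (hol_le _ hphi)); rewrite lerDl ltW// => /(_ isT).
  move=> /le_trans; apply.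
  rewrite (_ : 4 * C * (B + eps') * lam ^+ n = 4 * C * B * lam ^+ n + eps).
    rewrite lerD2r ler_wpM2r ?(ltW (l0 _))// ler_wpM2r// lerDl.
    by rewrite mulr_ge0 ?addr_ge0// invr_ge0 ltW.
  by rewrite /eps'; field; rewrite !gt_eqF.
have mphi := measurable_borel_continuous (hol_continuous hphi).
have intB : `|\int[eta]_X phi X| <= B.
  rewrite -[X in `|X|]subr0.
  apply: (probability_integral_dist eta mphi hphi.1) => Y.
  by rewrite subr0; exact: hphi.1.
rewrite (le_trans (ler_normB _ _))//.
rewrite (le_trans (lerD (cesaro_markov_le n X hphi) intB))//.
rewrite -{2}[B]mul1r -mulrDl -(mulrA _ B) (mulrC B) mulrA ler_wpM2r//.
rewrite mulrDl ler_wpDl ?mulr_ge0 ?(ltW (l0 _)) ?(ltW C0)//.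
rewrite -mulrA ler_peMr ?addr_ge0// mulrC ler_pdivlMr// mul1r.
by rewrite ler_wiXn2l ?(ltW lam1) ?(ltW lam0)// ltnW.
Qed.

(** * Decay of correlations *)

Lemma hol_sub (B B' : R) phi psi : hol B phi -> hol B' psi ->
  hol (B + B') (fun X => phi X - psi X).
Proof.
move=> [h1 h2] [h1' h2']; split=> [X|X Y].
  by rewrite (le_trans (ler_normB _ _))// lerD.
have -> : phi X - psi X - (phi Y - psi Y) =
  (phi X - phi Y) - (psi X - psi Y) by ring.
by rewrite mulrDl (le_trans (ler_normB _ _))// lerD.
Qed.

(** For positive p and F depending on p coordinates, the expectation under [QX X] of F times phi at
    the position reached after p steps. *)
Definition ratio p phi X F : R :=
  (kap ^+ p * e X)^-1 * path_int p (fun Y => phi Y * e Y) X F.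

Lemma ratio_sub_le p phi (B BF b c : R) X F : hol B phi ->
  measurable_fun setT F -> (forall w, `|F w| <= BF) ->
  (forall Y, `|phi Y - c| <= b) ->
  `|ratio p phi X F - c * ((kap ^+ p * e X)^-1 * path_int p e X F)| <=
  BF * (b * eB / ec).
Proof.
move=> hphi mF FB phic.
have hpe := hol_mul hphi e_hol.
have kp := kapn_gt0 p; have eX := e_gt0' X.
have eB' Y : `|e Y| <= eB by rewrite ger0_norm// ltW// e_gt0'.
have he : hol (`|c| * eH) (fun Y => `|c| * e Y) by exact: hol_scale.
have hc : hol (2 * (`|c| * eH)) (fun Y => cst c Y * e Y).
  apply: hol_mul e_hol; split=> [Y //|Y Z] /=.
  by rewrite subrr normr0 mulr_ge0 ?powR_ge0.
rewrite /ratio mulrCA -mulrBr -(path_intZr p X c e_hol mF FB).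
rewrite -(path_intBr p X hpe hc mF FB).
have cb := hol_continuous (hol_sub hpe hc).
have b_le Y : `|phi Y * e Y - c * e Y| <= b * eB.
  by rewrite -mulrBl normrM ler_pM.
rewrite normrM ger0_norm; last by rewrite invr_ge0 mulr_ge0// ltW.
rewrite ler_pdivrMl ?mulr_gt0//.
by rewrite (le_trans (path_int_le p X mF FB cb b_le))// mulrC.
Qed.

Lemma ratio_sum p l (phi : 'I_l -> P -> R) (r B BF : R) X F :
  (forall j, hol B (phi j)) ->
  measurable_fun setT F -> (forall w, `|F w| <= BF) ->
  ratio p (fun Y => r * \sum_j phi j Y) X F = r * \sum_j ratio p (phi j) X F.
Proof.
move=> hphi mF FB; have h j := hol_mul (hphi j) e_hol.
have ij j := integrable_path p X mF FB (hol_continuous (h j)) (h j).1.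
rewrite /ratio -mulr_sumr mulrCA; congr (_ * _).
rewrite /path_int -Rintegral_sum// -RintegralZl//; last first.
  rewrite (_ : EFin \o _ = (fun w => \sum_j (F w *
      weight s (fun Y => phi j Y * e Y) X (prodmx v p w))%:E)%E).
    by apply: integrable_sum => // j _; exact: ij.
  by apply/funext => w /=; rewrite sumEFin.
apply: eq_Rintegral => w _; rewrite /weight mulr_sumr.
rewrite mulr_sumr !mulr_suml mulr_sumr; apply: eq_bigr => j _; ring.
Qed.

(** Two uses of the Markov property: at time p, to detach F1, and then after l further idle steps,
    which become l iterates of [markov] applied to the conditional expectation of F2. *)
Lemma correlation_ratio p l r X F1 F2 (BF1 BF2 : R) :
  measurable_fun setT F1 -> (forall w, `|F1 w| <= BF1) -> depends_on p F1 ->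
  measurable_fun setT F2 -> (forall w, `|F2 w| <= BF2) ->
  (kap ^+ (p + (l + r)) * e X)^-1 *
    path_int (p + (l + r)) e X
      (fun w => F1 w * F2 (iter (p + l) (@left_shift R A) w)) =
  ratio p (iter l markov (fun Y => (kap ^+ r * e Y)^-1 * path_int r e Y F2)) X F1.
Proof.
move=> mF1 F1B dF1 mF2 F2B.
pose G Y := (kap ^+ r * e Y)^-1 * path_int r e Y F2.
have hG : hol (ratio_const * BF2) G by exact: ratio_hol_e.
have hGe := hol_mul hG e_hol.
have hr := path_int_hol r e_hol mF2 F2B.
have kp := kapn_gt0 p; have kl := kapn_gt0 l; have kr := kapn_gt0 r.
have mF2l : measurable_fun setT (fun w => F2 (iter l (@left_shift R A) w)).
  exact: (measurableT_comp mF2 (@measurable_iter_shift R A l)).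
transitivity ((kap ^+ (p + (l + r)) * e X)^-1 *
  path_int p (fun Y => path_int (l + r) e Y
    (fun w => cst 1 w * F2 (iter l (@left_shift R A) w))) X F1).
  congr (_ * _); rewrite -(path_int_split (l + r) X e_hol mF1 F1B dF1 (BF2 := BF2)) //.
  - apply: eq_Rintegral => w _; congr (_ * _ * _).
    by rewrite mul1r -iterD addnC.
  - by apply: measurable_funM.
  - by move=> w; rewrite mul1r; exact: F2B.
have splitl Y : path_int (l + r) e Y (fun w => cst 1 w * F2 (iter l (@left_shift R A) w)) =
    kap ^+ (l + r) * (iter l markov G Y * e Y).
  have d1 : depends_on l (cst 1 : Om -> R) by [].
  rewrite (path_int_split r Y e_hol meas1 norm1 d1 mF2 F2B).
  rewrite (_ : (fun Z => path_int r e Z F2) = (fun Z => kap ^+ r * (G Z * e Z))).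
    rewrite (path_intZr l Y _ hGe meas1 norm1) (path_int_markov l Y hG) exprD.
    ring.
  by apply/funext => Z; rewrite /G; field; rewrite !gt_eqF ?e_gt0'.
rewrite (_ : (fun Y => _) = (fun Y => kap ^+ (l + r) * (iter l markov G Y * e Y))).
  rewrite (path_intZr p X _ (hol_mul (iter_markov_hol l hG) e_hol) mF1 F1B).
  rewrite /ratio exprD; field; rewrite !gt_eqF ?e_gt0'// kapn_gt0//.
by apply/funext => Y; exact: splitl.
Qed.

Lemma depends_on_correlation p k r F1 F2 : depends_on p F1 -> depends_on r F2 ->
  (p <= k)%N ->
  depends_on (k + r) (fun w => F1 w * F2 (iter k (@left_shift R A) w)).
Proof.
move=> d1 d2 pk w w' ww'; congr (_ * _).
  by apply: d1 => j jp; apply: ww'; rewrite (leq_trans jp)// (leq_trans pk)// leq_addr.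
by apply: d2 => j jr; rewrite !iter_shiftE; apply: ww'; rewrite ltn_add2l.
Qed.

(** After averaging over j, the iterates of [markov] in [correlation_ratio] are replaced by a
    constant with error O(lam^n). The lengths p and r leave no trace, because [ratio_const] bounds
    Hölder norms for every path length; this is needed since both will grow with n. *)
Lemma correlation_decay_depends_on : exists C lam : R,
  [/\ 0 < C, 0 < lam, lam < 1 & forall p r n F1 F2 (BF1 BF2 : R),
    (0 < p)%N -> (0 < r)%N ->
    measurable_fun setT F1 -> (forall w, `|F1 w| <= BF1) -> depends_on p F1 ->
    measurable_fun setT F2 -> (forall w, `|F2 w| <= BF2) -> depends_on r F2 ->
    `|m%:R^-1 * \sum_(j < m) \int[QQ]_w
        (F1 w * F2 (iter (p + (m * n + j)) (@left_shift R A) w)) -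
      \int[QQ]_w F1 w * \int[QQ]_w F2 w| <= C * BF1 * BF2 * lam ^+ n].
Proof.
have [C [lam [C0 lam0 lam1 decay]]] := cesaro_markov_cvg.
have rc0 := ratio_const_ge0.
have ec0 := ltW ec_gt0; have eB0 := ltW eB_gt0.
have D0 : 0 <= C * ratio_const * eB / ec.
  by rewrite divr_ge0// mulr_ge0// mulr_ge0// ltW.
exists ((C * ratio_const * eB / ec) + 1), lam; split => //; first exact: ltr_wpDl.
move=> p r n F1 F2 BF1 BF2 p0 r0 mF1 F1B d1 mF2 F2B d2.
have BF10 : 0 <= BF1 by rewrite (le_trans _ (F1B point)).
have BF20 : 0 <= BF2 by rewrite (le_trans _ (F2B point)).
pose G Y := (kap ^+ r * e Y)^-1 * path_int r e Y F2.
have hG : hol (ratio_const * BF2) G by exact: ratio_hol_e.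
pose u X := (kap ^+ p * e X)^-1 * path_int p e X F1.
have hu : hol (ratio_const * BF1) u by exact: ratio_hol_e.
have hit k := iter_markov_hol k hG.
have hrat k := ratio_hol p (hit k) mF1 F1B.
rewrite (QQ_integral p0 mF1 F1B d1) (QQ_integral r0 mF2 F2B d2).
have corr j : \int[QQ]_w (F1 w * F2 (iter (p + (m * n + j)) (@left_shift R A) w)) =
    \int[eta]_X ratio p (iter (m * n + j) markov G) X F1.
  have pos : (0 < p + (m * n + j + r))%N by rewrite addn_gt0 p0.
  have dH := depends_on_correlation d1 d2 (leq_addr (m * n + j) p).
  rewrite -addnA in dH.
  have mS : measurable_fun setT
      (fun w => F2 (iter (p + (m * n + j)) (@left_shift R A) w)).
    exact: (measurableT_comp mF2 (@measurable_iter_shift R A _)).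
  rewrite (QQ_integral (B := BF1 * BF2) pos _ _ dH).
  - apply: eq_Rintegral => X _.
    exact: (correlation_ratio _ _ X mF1 F1B d1 mF2 F2B).
  - exact: measurable_funM.
  - by move=> w; rewrite normrM ler_pM.
under eq_bigr do rewrite corr.
have int_hol phi (B : R) : hol B phi -> eta.-integrable setT (EFin \o phi).
  move=> h; apply: (bounded_integrable eta _ h.1).
  exact: measurable_borel_continuous (hol_continuous h).
have ces_le X : `|cesaro_markov n G X - \int[eta]_Y G Y| <=
    C * (ratio_const * BF2) * lam ^+ n by exact: decay.
have hces : hol (ratio_const * (ratio_const * BF2)) (cesaro_markov n G).
  split=> [X|X Y]; first exact: cesaro_markov_le.
  rewrite /cesaro_markov -mulrBr -sumrB normrM ger0_norm ?invr_ge0//.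
  rewrite ler_pdivrMl ?ltr0n// (le_trans (ler_norm_sum _ _ _))//.
  rewrite (@le_trans _ _ (\sum_(j < m)
      (ratio_const * (ratio_const * BF2) * mdist X Y `^ alpha)))//.
    by apply: ler_sum => j _; exact: (hit _).2.
  by rewrite sumr_const card_ord mulr_natl.
pose c := \int[eta]_Y G Y.
have -> : m%:R^-1 * (\sum_(j < m) \int[eta]_X ratio p (iter (m * n + j) markov G) X F1) -
    (\int[eta]_X u X) * c =
    \int[eta]_X (ratio p (cesaro_markov n G) X F1 - c * u X).
  rewrite -Rintegral_sum; last by move=> j; exact: int_hol (hrat _).
  rewrite -RintegralZl//; last first.
    rewrite (_ : EFin \o _ = (fun X => \sum_(j < m)
        (ratio p (iter (m * n + j) markov G) X F1)%:E)%E).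
      by apply: integrable_sum => // j _; exact: int_hol (hrat _).
    by apply/funext => X /=; rewrite sumEFin.
  rewrite (mulrC _ c) -RintegralZl//; last exact: int_hol hu.
  rewrite -RintegralB//; last 2 first.
  - rewrite (_ : EFin \o _ = EFin \o (fun X => ratio p (cesaro_markov n G) X F1)).
      exact: int_hol (ratio_hol p hces mF1 F1B).
    apply/funext => X /=; congr EFin.
    by rewrite (ratio_sum p _ X (fun j => hit _) mF1 F1B).
  - exact/integrable_scale/(int_hol _ _ hu).
  apply: eq_Rintegral => X _.
  by rewrite (ratio_sum p _ X (fun j => hit _) mF1 F1B).
have diff_le X : `|ratio p (cesaro_markov n G) X F1 - c * u X| <=
    BF1 * (C * (ratio_const * BF2) * lam ^+ n * eB / ec).
  exact: (ratio_sub_le p X hces mF1 F1B ces_le).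
rewrite -[X in `|X|]subr0.
apply: (@le_trans _ _ (BF1 * (C * (ratio_const * BF2) * lam ^+ n * eB / ec))).
  apply: (probability_integral_dist eta _ diff_le) => [|X]; last by rewrite subr0.
  apply: measurable_funB.
    exact: measurable_borel_continuous (hol_continuous (ratio_hol p hces mF1 F1B)).
  apply: measurable_funM => //.
  exact: measurable_borel_continuous (hol_continuous hu).
rewrite (_ : BF1 * _ = C * ratio_const * eB / ec * (BF1 * BF2 * lam ^+ n)); last by ring.
rewrite -!mulrA (mulrDl _ 1) !mulrA lerDl.
by rewrite mul1r !mulr_ge0// exprn_ge0// ltW.
Qed.

(** The delay n m + j is shared: about half of it goes to the coordinates kept in f, the other half
    to mixing. Both errors are then exponential in n / 2, whence the square root in the rate. *)
Lemma correlation_decay : exists C lam : R, [/\ 0 < C, 0 < lam, lam < 1 &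
  forall n f g (Lf Lg : R), (0 < n)%N ->
    0 <= Lf -> (forall w, `|f w| <= Lf) ->
    (forall a b, `|f a - f b| <= Lf * dist_Omega a b) ->
    0 <= Lg -> (forall w, `|g w| <= Lg) ->
    (forall a b, `|g a - g b| <= Lg * dist_Omega a b) ->
    `|m%:R^-1 * \sum_(j < m) \int[QQ]_w
        (f w * g (iter (n * m + j) (@left_shift R A) w)) -
      \int[QQ]_w f w * \int[QQ]_w g w| <= C * Lf * Lg * lam ^+ n].
Proof.
have [C [lam [C0 lam0 lam1 decay]]] := correlation_decay_depends_on.
pose th := Num.max lam 2^-1.
have th0 : 0 < th by rewrite /th lt_max lam0.
have th1 : th < 1 by rewrite /th gt_max lam1 invf_lt1 ?ltr1n.
have half_th : 2^-1 <= th by rewrite /th le_max lexx orbT.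
have lam_th : lam <= th by rewrite /th le_max lexx.
pose rho := Num.sqrt th.
have rho0 : 0 < rho by rewrite sqrtr_gt0.
have rho1 : rho < 1 by rewrite -(sqrtr1 R) ltr_sqrt.
(* Of the 4, two units come from truncation in the averaged correlation and two from truncation in
   the product of means; 1 / rho absorbs the rounding in n / 2. *)
exists ((C + 4) / rho), rho; split => //; first by rewrite divr_gt0// addr_gt0.
move=> n f g Lf Lg n0 Lf0 fB fL Lg0 gB gL.
(* Keeping p coordinates of f, a multiple of m, leaves exactly m n' + j steps before the shifted g
   starts, as [kE] records; n > 0 makes p positive. *)
pose n' := n./2; pose p := (m * (n - n'))%N.
have nE : (n - n' = odd n + n')%N.
  by rewrite -{1}[n]odd_double_half -addnn addnA addnK.
have n'n : (n' <= n - n')%N by rewrite nE leq_addl.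
have n'_le : (n' <= n)%N by rewrite (leq_trans n'n)// leq_subr.
have p0 : (0 < p)%N.
  rewrite muln_gt0 m_gt0 nE addn_gt0 /n'; move: n0.
  by rewrite -{1}[n]odd_double_half addn_gt0 double_gt0.
have np : (n' <= p)%N by rewrite (leq_trans n'n)// leq_pmull.
have kE j : (n * m + j = p + (m * n' + j))%N.
  by rewrite addnA -mulnDr subnK// mulnC.
have mf := measurable_lipschitz Lf0 fL; have mg := measurable_lipschitz Lg0 gL.
pose F1 w := f (trunc p w); pose F2 w := g (trunc n w).
have mF1 : measurable_fun setT F1 := measurableT_comp mf (@measurable_trunc R A p).
have mF2 : measurable_fun setT F2 := measurableT_comp mg (@measurable_trunc R A n).
have F1B w : `|F1 w| <= Lf by exact: fB.
have F2B w : `|F2 w| <= Lg by exact: gB.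
have dtrunc k (h : Om -> R) : depends_on k (fun w => h (trunc k w)).
  move=> w w' ww'; congr h; apply/funext => l; rewrite /trunc.
  by case: ltnP => // /ww'.
pose del : R := 2^-1 ^+ n'.
have close (h : Om -> R) (L : R) k w : 0 <= L ->
    (forall a b, `|h a - h b| <= L * dist_Omega a b) -> (n' <= k)%N ->
    `|h w - h (trunc k w)| <= L * del.
  move=> L0 hL n'k; rewrite (le_trans (hL _ _))// ler_wpM2l//.
  rewrite (le_trans (dist_Omega_trunc _ _))// -exprVn.
  by rewrite ler_wiXn2l// invf_le1 ?ler1n.
have fF w : `|f w - F1 w| <= Lf * del by exact: close.
have gF w : `|g w - F2 w| <= Lg * del by exact: close.
have mS k (h : Om -> R) : measurable_fun setT h ->
    measurable_fun setT (fun w => h (iter k (@left_shift R A) w)).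
  by move=> mh; exact: (measurableT_comp mh (@measurable_iter_shift R A k)).
have int_close j : `|\int[QQ]_w (f w * g (iter (n * m + j) (@left_shift R A) w)) -
    \int[QQ]_w (F1 w * F2 (iter (n * m + j) (@left_shift R A) w))| <=
    Lf * del * Lg + Lf * (Lg * del).
  apply: (probability_integral_close QQ (B := Lf * Lg) (B' := Lf * Lg)).
  - by apply: measurable_funM => //; exact: mS.
  - by apply: measurable_funM => //; exact: mS.
  - by move=> w; rewrite normrM ler_pM.
  - by move=> w; rewrite normrM ler_pM.
  - by move=> w; exact: prod_close.
have int_le (h : Om -> R) (L : R) : measurable_fun setT h ->
    (forall w, `|h w| <= L) -> `|\int[QQ]_w h w| <= L.
  move=> mh hL; rewrite -[X in `|X|]subr0.
  by apply: (probability_integral_dist QQ mh hL) => w; rewrite subr0.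
have prod_int : `|\int[QQ]_w f w * \int[QQ]_w g w -
    \int[QQ]_w F1 w * \int[QQ]_w F2 w| <= Lf * del * Lg + Lf * (Lg * del).
  apply: prod_close; [exact: int_le|exact: int_le| |].
    exact: probability_integral_close mf mF1 fB F1B fF.
  exact: probability_integral_close mg mF2 gB F2B gF.
have avg_close : `|m%:R^-1 * \sum_(j < m) \int[QQ]_w
        (f w * g (iter (n * m + j) (@left_shift R A) w)) -
    m%:R^-1 * \sum_(j < m) \int[QQ]_w
        (F1 w * F2 (iter (n * m + j) (@left_shift R A) w))| <=
    Lf * del * Lg + Lf * (Lg * del).
  rewrite -mulrBr -sumrB normrM ger0_norm ?invr_ge0//.
  rewrite ler_pdivrMl ?ltr0n// (le_trans (ler_norm_sum _ _ _))//.
  rewrite (@le_trans _ _ (\sum_(j < m) (Lf * del * Lg + Lf * (Lg * del))))//.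
    by apply: ler_sum => j _; exact: int_close.
  by rewrite sumr_const card_ord mulr_natl.
have main : `|m%:R^-1 * \sum_(j < m) \int[QQ]_w
        (F1 w * F2 (iter (n * m + j) (@left_shift R A) w)) -
    \int[QQ]_w F1 w * \int[QQ]_w F2 w| <= C * Lf * Lg * lam ^+ n'.
  under eq_bigr do rewrite kE.
  exact: (decay p n n' F1 F2 Lf Lg p0 n0 mF1 F1B (dtrunc p f) mF2 F2B (dtrunc n g)).
(* th^n' = rho^(2 n') and 2 n' >= n - 1. *)
have rho_n' : th ^+ n' <= rho ^+ n / rho.
  rewrite ler_pdivlMr// -[th]sqr_sqrtr ?(ltW th0)// -/rho -exprM mul2n -exprSr.
  rewrite ler_wiXn2l ?(ltW rho0) ?(ltW rho1)//.
  by rewrite -[X in (X <= _)%N]odd_double_half -addn1 addnC leq_add2l; case: odd.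
have del_th : del <= th ^+ n' by rewrite lerXn2r// nnegrE ltW.
have lam_n' : lam ^+ n' <= th ^+ n' by rewrite lerXn2r// nnegrE ltW.
apply: (@le_trans _ _ (Lf * Lg * ((C + 4) * th ^+ n'))).
  have -> : Lf * Lg * ((C + 4) * th ^+ n') =
    C * Lf * Lg * th ^+ n' + 4 * (Lf * Lg * th ^+ n') by ring.
  have h1 : C * Lf * Lg * lam ^+ n' <= C * Lf * Lg * th ^+ n'.
    by rewrite ler_wpM2l// !mulr_ge0// ltW.
  have h2 : Lf * Lg * del <= Lf * Lg * th ^+ n' by rewrite ler_wpM2l// mulr_ge0.
  have e1 : Lf * del * Lg = Lf * Lg * del by ring.
  have e2 : Lf * (Lg * del) = Lf * Lg * del by ring.
  move: avg_close prod_int main; rewrite e1 e2 !ler_norml.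
  move: h1 h2; lra.
have -> : (C + 4) / rho * Lf * Lg * rho ^+ n =
  Lf * Lg * ((C + 4) * (rho ^+ n / rho)) by ring.
apply: ler_wpM2l; first exact: mulr_ge0.
by apply: ler_wpM2l => //; rewrite addr_ge0// ltW.
Qed.

End PathOperators.

(** * The eigenfunction *)

Section Eigenfunction.
Variables (R : realType) (d : nat) (A : polishType R).
Local Notation P := (projective R d.+1).
Variables (mu : {measure set (borel A) -> \bar R}).
Variable v : borel A -> borel 'M[R[i]]_d.+1.
Hypothesis mv : measurable_fun setT v.
Variables (s : R) (e : P -> R) (sigma : probability (borel P) R).
Hypothesis s_gt0 : 0 < s.
Hypothesis kappa_gt0 : 0 < kappa mu v s.
Hypothesis e_sigma : unique_eigenpair mu v s e sigma.
Hypothesis e_gt0 : forall X, 0 < e X.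

Lemma eigenfunction_cont : continuous e. Proof. by have [[[]]] := e_sigma. Qed.

(** The lower bound is the upper bound for 1/e, which is continuous because [e] does not vanish. *)
Lemma eigenfunction_bounds : exists ec eB : R,
  [/\ 0 < ec, forall X, ec <= e X & forall X, e X <= eB].
Proof.
have [eB eBP] := projective_bounded eigenfunction_cont.
have cinv : continuous (fun X => (e X)^-1).
  move=> X; apply: (@cvgV _ _ (nbhs X)); last exact: eigenfunction_cont.
  by rewrite gt_eqF.
have [c cP] := projective_bounded cinv.
have c0 : 0 < c by rewrite (lt_le_trans _ (cP point))// normr_gt0 invr_eq0 gt_eqF.
exists c^-1, eB; split=> [|X|X]; first by rewrite invr_gt0.
  rewrite -[e X]invrK lef_pV2 ?posrE ?invr_gt0//.
  by rewrite (le_trans _ (cP X))// ler_norm.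
exact: le_trans (ler_norm _) (eBP X).
Qed.

(** [Gamma] is a real integral, with value 0 when the extended integral is infinite; positivity of
    kappa e(X) excludes that case. *)
Lemma eigenfunction_integral X :
  (\int[mu]_a (weight s e X (v a))%:E = (kappa mu v s * e X)%:E)%E.
Proof.
have [[_ eE _ _] _] := e_sigma.
have keX : 0 < kappa mu v s * e X by rewrite mulr_gt0.
have : fine (\int[mu]_a (weight s e X (v a))%:E) = kappa mu v s * e X.
  rewrite -eE /Gamma; apply: eq_Rintegral => a _; case: eqVneq => wX.
    by rewrite weight0//; apply/eqP; rewrite growth_eq0 wX.
  by rewrite /weight actE growthE.
case: (\int[mu]_a _)%E => [r /= ->|/= E|/= E] //.
- by rewrite -E ltxx in keX.
- by rewrite -E ltxx in keX.
Qed.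

Lemma growth_integral_lty X : (\int[mu]_a (growth (v a) X `^ s)%:E < +oo)%E.
Proof.
have [ec [eB [ec0 ecP _]]] := eigenfunction_bounds.
have mg : measurable_fun setT (fun a => growth (v a) X `^ s).
  apply: (measurableT_comp (measurable_powR s)).
  exact: measurable_growth (mxmeasurable_v mv).
apply: (@le_lt_trans _ _ (\int[mu]_a ((ec^-1)%:E * (weight s e X (v a))%:E))%E).
  apply: ge0_le_integral => //.
  - by move=> a _; rewrite lee_fin powR_ge0.
  - exact/measurable_EFinP.
  - apply/measurable_EFinP; apply: measurable_funM => //.
    by apply: measurable_weight_v => //; exact: eigenfunction_cont.
  - move=> a _; rewrite -EFinM lee_fin /weight mulrA ler_peMl ?powR_ge0//.
    by rewrite mulrC ler_pdivlMr// mul1r.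
rewrite ge0_integralZl ?lee_fin ?invr_ge0 ?(ltW ec0)//.
- by rewrite eigenfunction_integral -EFinM ltry.
- apply/measurable_EFinP.
  by apply: measurable_weight_v => //; exact: eigenfunction_cont.
- by move=> a _; rewrite lee_fin mulr_ge0 ?powR_ge0// ltW.
Qed.

Variables (alpha : R) (K : nat).
Hypotheses (a_gt0 : 0 < alpha) (a_le1 : alpha <= 1) (a_le_s : alpha <= s).
Hypothesis s_leK : s <= K%:R.

Lemma eigenfunction_hol : exists eH : R, hol alpha eH e.
Proof.
have [ec [eB [ec0 ecP eBP]]] := eigenfunction_bounds.
have [nu nuE] := exists_restr_nonzero mv s_gt0 growth_integral_lty.
have [[_ _ e_sig _] uniq] := e_sigma.
have [w [B [c [hw c0 cw wE]]]] := exists_holder_eigenfunction mv nuE s_gt0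
  kappa_gt0 eigenfunction_cont ec0 ecP eBP eigenfunction_integral
  a_gt0 a_le1 a_le_s s_leK.
have cw_cont := hol_continuous a_gt0 hw.
have mw : measurable_fun setT (w : borel P -> R) := measurable_borel_continuous cw_cont.
have iw := bounded_integrable sigma mw hw.1.
pose r := \int[sigma]_X w X.
have r0 : 0 < r.
  apply: (lt_le_trans c0).
  have c_int : \int[sigma]_X cst c X = c.
    by rewrite Rintegral_cst//= -[X in fine X]/(sigma setT) probability_setT mulr1.
  rewrite -c_int; apply: le_Rintegral => //.
  by apply: (bounded_integrable sigma _ (B := `|c|)).
have hrw : hol alpha (r^-1 * B) (fun X => r^-1 * w X).
  by apply: hol_scale => //; rewrite invr_ge0 ltW.
have crw := hol_continuous a_gt0 hrw.
(* Uniqueness is tested on the pair formed by the rescaled Hölder function and the same [sigma];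
   dividing by r gives it integral 1. *)
have [|<- _] := uniq (fun X => r^-1 * w X) sigma; last by exists (r^-1 * B).
split => //.
- by split=> // X; rewrite mulr_ge0 ?invr_ge0 ?(ltW r0)// (le_trans (ltW c0)).
- move=> X; rewrite (GammaE mv nuE)//.
  rewrite (gamma_opZ mv nuE s_gt0 eigenfunction_cont ec0 ecP
    eigenfunction_integral X _ cw_cont hw.1).
  by rewrite wE mulrCA.
- by rewrite RintegralZl// mulVf// gt_eqF.
Qed.

End Eigenfunction.

Theorem proposition7p2 (R : realType) (d : nat) (A : polishType R)
    (mu : {measure set (borel A) -> \bar R})
    (v : borel A -> borel 'M[R[i]]_d.+1)
    (smin s : R) (smax : \bar R)
    (e : projective R d.+1 -> R)
    (sigma eta : probability (borel (projective R d.+1)) R)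
    (QX : projective R d.+1 -> probability (Omega A) R)
    (QQ : probability (Omega A) R) (m : nat)
    (v_measurable : measurable_fun setT v)
    (smin_gt0 : 0 < smin) (smin_lt_smax : (smin%:E < smax)%E)
    (moments : forall t : R, smin <= t -> (t%:E <= smax)%E ->
       (\int[mu]_a (opnorm (v a) `^ t)%:E < +oo)%E)
    (mu_irreducible : irreducible (pushforward mu v))
    (mu_contracting : contracting (pushforward mu v))
    (s_gt : smin < s) (s_lt : (s%:E < smax)%E)
    (kappa_gt0 : 0 < kappa mu v s)
    (e_sigma : unique_eigenpair mu v s e sigma)
    (e_gt0 : forall X, 0 < e X)
    (QX_law : forall X, path_law mu v s e X (QX X))
    (eta_inv : unique_invariant_probability mu v s e eta)
    (QQ_mix : forall B, measurable B -> QQ B = (\int[eta]_X QX X B)%E)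
    (Q_spectrum :
       peripheral_spectrum_of_Q mu v s e (Num.min (smin / 3%:R) 1))
    (m_gt0 : (0 < m)%N)
    (m_card : (peripheral_eigenvalues
       (@holder_norm R d (Num.min (smin / 3%:R) 1)) (QopC mu v s e) #= `I_m)%card) :
  exists C lambda : R, [/\ 0 < C, 0 < lambda, lambda < 1 &
    forall n : nat, (0 < n)%N -> forall f g : Omega A -> R,
      Lip_b f -> Lip_b g ->
      ((`| m%:R^-1 * (\sum_(j < m)
              \int[QQ]_w (f w * g (iter (n * m + j) (@left_shift R A) w)))
           - (\int[QQ]_w f w) * (\int[QQ]_w g w) |%R)%:E
        <= C%:E * lip_norm f * lip_norm g * (lambda ^+ n)%:E)%E].
Proof.
have s_gt0 : 0 < s := lt_trans smin_gt0 s_gt.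
set alpha := Num.min (smin / 3%:R) 1 in Q_spectrum m_card.
have a_gt0 : 0 < alpha by rewrite lt_min ltr01 divr_gt0.
have a_le1 : alpha <= 1 by rewrite ge_min lexx orbT.
have a_le_s : alpha <= s.
  rewrite ge_min (le_trans _ (ltW s_gt))//.
  by rewrite ler_pdivrMr// ler_peMr ?ler1n// ltW.
(* An integer above [s], as required by the Bernoulli comparison of powers. *)
have s_leK : s <= (Num.truncn s).+1%:R := ltW (truncnS_gt s).
have [ec [eB [ec0 ecP eBP]]] := eigenfunction_bounds e_sigma e_gt0.
have e_int := eigenfunction_integral s_gt0 kappa_gt0 e_sigma e_gt0.
have [nu nuE] := exists_restr_nonzero v_measurable s_gt0
  (growth_integral_lty v_measurable s_gt0 kappa_gt0 e_sigma e_gt0).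
have [eH e_hol] := eigenfunction_hol v_measurable s_gt0 kappa_gt0 e_sigma e_gt0
  a_gt0 a_le1 a_le_s s_leK.
have [C [lam [C0 lam0 lam1 decay]]] := correlation_decay v_measurable nuE s_gt0
  kappa_gt0 (eigenfunction_cont e_sigma) ec0 ecP eBP e_int a_gt0 a_le1 a_le_s
  s_leK e_hol erefl QX_law QQ_mix eta_inv.1 Q_spectrum m_gt0 m_card.
exists C, lam; split => // n n0 f g Lip_f Lip_g.
have [Lf [-> Lf0 fB fL]] := lip_norm_bounds Lip_f.
have [Lg [-> Lg0 gB gL]] := lip_norm_bounds Lip_g.
by rewrite -!EFinM lee_fin; exact: decay.
Qed.
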